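(* Let $\mathbb{F}$ be a field. The coinvariant algebra $\mathbb{F}[\Lambda]/(a_1,\dots,a_r)$ of the Weyl group $W$, with the $H_W(0)$-action $T_i\mapsto\overline\pi_i$, has an $\mathbb{F}$-basis $\{\overline\pi_w e^{\lambda_{D(w)}}: w\in W\}$ and decomposes as \[ \mathbb{F}[\Lambda]/(a_1,\dots,a_r)=\bigoplus_{\alpha\models r+1}H_W(0)\cdot\overline\pi_{w_0(\alpha)}z_\alpha, \] where each summand $H_W(0)\cdot\overline\pi_{w_0(\alpha)}z_\alpha$ has $\mathbb{F}$-basis $\{\overline\pi_w z_\alpha: w\in[w_0(\alpha),w_1(\alpha)]\}$ and is isomorphic to the projective indecomposable $H_W(0)$-module $\mathbf P_\alpha$. Consequently $\mathbb{F}[\Lambda]/(a_1,\dots,a_r)$ is isomorphic to the regular representation of $H_W(0)$.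
   Context: $W$ is the Weyl group of a (crystallographic) root system of rank $r$ with simple roots $\gamma_1,\dots,\gamma_r$, simple reflections $s_1,\dots,s_r$, fundamental weights $\lambda_1,\dots,\lambda_r$ and weight lattice $\Lambda$. $\mathbb{F}[\Lambda]$ is the group algebra of $\Lambda$ with basis $\{e^\lambda:\lambda\in\Lambda\}$, i.e. $\mathbb{F}[z_1^{\pm1},\dots,z_r^{\pm1}]$ with $z_i=e^{\lambda_i}$; $W$ acts by $w e^\lambda=e^{w\lambda}$. Demazure operators: $\pi_i f=\frac{f-e^{-\gamma_i}s_i(f)}{1-e^{-\gamma_i}}$, $\overline\pi_i=\pi_i-1$. The $0$-Hecke algebra $H_W(0)$ is generated by $T_1,\dots,T_r$ with $T_i^2=-T_i$ and the braid relations of $W$; $T_w,T'_w$ ($T'_i=T_i+1$) and $\overline\pi_w$ are defined via reduced words; $H_W(0)$ acts on $\mathbb{F}[\Lambda]$ by $T_i\mapsto\overline\pi_i$, $\mathbb{F}[\Lambda]^W$-linearly. $a_i=\sum_{w\in W/W_{i^c}}e^{w\lambda_i}$, where $W_{i^c}$ is generated by $\{s_j:j\ne i\}$. $D(w)=\{i:\ell(ws_i)<\ell(w)\}\subseteq[r]$. Compositions $\alpha$ of $r+1$ correspond bijectively to subsets $D(\alpha)\subseteq[r]$ (partial sums), and $\alpha^c$ has $D(\alpha^c)=[r]\setminus D(\alpha)$. For $I\subseteq[r]$, $\lambda_I=\sum_{i\in I}\lambda_i$; $\lambda_\alpha=\lambda_{D(\alpha)}$, $z_\alpha=e^{\lambda_\alpha}$.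 $w_0(\alpha)$ is the longest element of the parabolic subgroup generated by $\{s_i:i\in D(\alpha)\}$, and $\{w\in W: D(w)=D(\alpha)\}$ is an interval $[w_0(\alpha),w_1(\alpha)]$ in left weak order. $\mathbf P_\alpha:=H_W(0)\,T_{w_0(\alpha)}T'_{w_0(\alpha^c)}$. *)

(* Defs.v *)
From HB Require Import structures.
From mathcomp Require Import all_boot all_algebra.
From mathcomp.multinomials Require Import freeg.
From Stdlib Require Import ClassicalEpsilon.

Set Implicit Arguments.
Unset Strict Implicit.
Unset Printing Implicit Defensive.

Import GRing.Theory Num.Theory.
Local Open Scope ring_scope.

(* Root datum.  A crystallographic root system of rank r is given by  *)
(* its Cartan matrix C, C i j = <gamma_i, gamma_j^vee>.  Weights are   *)
(* row vectors of integers in the basis of fundamental weights         *)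
(* lambda_1..lambda_r, so Lambda = Z^r, and gamma_i = sum_j C i j      *)
(* lambda_j is row i of C.                                             *)

(* C is the Cartan matrix of a (finite, crystallographic) root system:
   a generalized Cartan matrix that is symmetrizable with positive
   definite symmetrization. *)
Definition cartan_finite (r : nat) (C : 'M[int]_r) : Prop :=
  [/\ forall i, C i i = 2,
      forall i j, i != j -> C i j <= 0,
      forall i j, C i j = 0 <-> C j i = 0 &
      exists d : 'I_r -> rat,
        [/\ forall i, 0 < d i,
            forall i j, d i * (C i j)%:~R = d j * (C j i)%:~R &
            forall x : 'I_r -> rat, (exists i, x i != 0) ->
              0 < \sum_i \sum_j x i * d i * (C i j)%:~R * x j]].

Section Weyl.
Variables (r : nat) (C : 'M[int]_r).

Definition weight := 'rV[int]_r.
(* Elements of W are represented by the matrices of their (faithful)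
   action on Lambda: w(lambda) = lambda *m w. *)
Definition Wmat := 'M[int]_r.

Definition fundw (i : 'I_r) : weight := delta_mx 0 i.
Definition sroot (i : 'I_r) : weight := row i C.
(* s_i(lambda) = lambda - <lambda, gamma_i^vee> gamma_i *)
Definition sref (i : 'I_r) : Wmat := 1%:M - delta_mx i i *m C.
Definition act (w : Wmat) (l : weight) : weight := l *m w.
(* product in W: (u * v)(lambda) = u (v lambda) *)
Definition wmul (u v : Wmat) : Wmat := v *m u.

Fixpoint wmat (s : seq 'I_r) : Wmat :=
  if s is i :: s' then wmul (sref i) (wmat s') else 1%:M.

Definition inW (w : Wmat) : Prop := exists s, wmat s = w.

Definition has_word_of_len (w : Wmat) (n : nat) : bool :=
  [exists t : n.-tuple 'I_r, wmat t == w].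

Definition lengthW (w : Wmat) : nat :=
  match excluded_middle_informative (exists n, has_word_of_len w n) with
  | left H => ex_minn H
  | right _ => 0%N
  end.

Definition redword (w : Wmat) : seq 'I_r :=
  if [pick t : (lengthW w).-tuple 'I_r | wmat t == w] is Some t
  then val t else [::].

Definition descents (w : Wmat) : {set 'I_r} :=
  [set i | (lengthW (wmul w (sref i)) < lengthW w)%N].

Definition inWpar (D : {set 'I_r}) (w : Wmat) : Prop :=
  exists s, all (fun i => i \in D) s /\ wmat s = w.
Definition w0 (D : {set 'I_r}) : Wmat :=
  epsilon (inhabits 1%:M)
    (fun w => inWpar D w /\ forall u, inWpar D u -> (lengthW u <= lengthW w)%N).

Definition lamset (D : {set 'I_r}) : weight := \sum_(i in D) fundw i.

Variable F : fieldType.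

Definition FL := {freeg weight / F}.
Definition expo (l : weight) : FL := << l >>.
Definition lmul (f g : FL) : FL :=
  fglift (fun l => fglift (fun m => expo (l + m)) g) f.
Definition wact (w : Wmat) (f : FL) : FL := fglift (fun l => expo (act w l)) f.

(* Demazure operator pi_i f = (f - e^{-gamma_i} s_i f)/(1 - e^{-gamma_i}) *)
Definition dem (i : 'I_r) (f : FL) : FL :=
  epsilon (inhabits 0)
    (fun g => lmul (expo 0 - expo (- sroot i)) g
              = f - lmul (expo (- sroot i)) (wact (sref i) f)).
Definition dembar (i : 'I_r) (f : FL) : FL := dem i f - f.
Definition dembar_w (w : Wmat) (f : FL) : FL := foldr dembar f (redword w).

Definition zD (D : {set 'I_r}) : FL := expo (lamset D).

(* Ws enumerates W (without repetition)                                *)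
Variable Ws : seq Wmat.

(* a_i = sum_{w in W/W_{i^c}} e^{w lambda_i} = sum over the W-orbit of lambda_i *)
Definition ainv (i : 'I_r) : FL :=
  \sum_(m <- undup [seq act w (fundw i) | w <- Ws]) expo m.

Definition inI (f : FL) : Prop :=
  exists h : 'I_r -> FL, f = \sum_i lmul (h i) (ainv i).

(* (preimage in F[Lambda] of) the summand H_W(0) . pibar_{w0(D)} z_D
   of the quotient F[Lambda]/(a_1..a_r) *)
Definition inM (D : {set 'I_r}) (f : FL) : Prop :=
  exists c : Wmat -> F,
    inI (f - \sum_(w <- Ws) c w *: dembar_w w (dembar_w (w0 D) (zD D))).

(* The 0-Hecke algebra H_W(0), as the free F-module with basis T_w     *)
(* (w in W) and left multiplication by the generators T_i:             *)
(*   T_i T_w = T_{s_i w} if l(s_i w) > l(w),  T_i T_w = - T_w else.    *)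
Definition HH := {freeg Wmat / F}.
Definition Tb (w : Wmat) : HH := << w >>.
Definition Tact (i : 'I_r) (h : HH) : HH :=
  fglift (fun w => if (lengthW w < lengthW (wmul (sref i) w))%N
                   then Tb (wmul (sref i) w) else - Tb w) h.
Definition T_w (w : Wmat) (h : HH) : HH := foldr Tact h (redword w).
Definition Tp_w (w : Wmat) (h : HH) : HH :=
  foldr (fun i h => Tact i h + h) h (redword w).

Definition inH (v : HH) : Prop := exists c : Wmat -> F, v = \sum_(w <- Ws) c w *: Tb w.

Definition xP (D : {set 'I_r}) : HH := T_w (w0 D) (Tp_w (w0 (~: D)) (Tb 1%:M)).
Definition inP (D : {set 'I_r}) (v : HH) : Prop :=
  exists c : Wmat -> F, v = \sum_(w <- Ws) c w *: T_w w (xP D).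

End Weyl.

(* Main.v *)
Require Import Defs.
From HB Require Import structures.
From mathcomp Require Import all_boot all_order all_algebra.
From mathcomp.multinomials Require Import freeg.
From mathcomp Require Import zify ring.
From Stdlib Require Import ClassicalEpsilon.

Set Implicit Arguments.
Unset Strict Implicit.
Unset Printing Implicit Defensive.

Import Order.TTheory GRing.Theory Num.Theory.
Local Open Scope ring_scope.

(* For w in W and mu dominant with D(w) contained in the support of mu, the element
   a^(mu - lambda_D(w)) pibar_w e^(lambda_D(w)) has leading term e^(w mu): pibar_w e^lambda
   has e^(w lambda) as its only term in the orbit W lambda, and the other terms of the
   product are either shorter for a W-invariant quadratic form or e^(v mu) with
   v in w W_J, W_J the stabilizer of lambda_D(w), hence v longer than w.  As every weight
   is w mu for a unique such pair, these elements form a basis of F[Lambda], and the ideal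
   (a_1, ..., a_r) is spanned by those with mu <> lambda_D(w).  So the pibar_w e^(lambda_D(w))
   form a basis of the quotient.

   The decomposition into cyclic modules only uses that the pibar_i satisfy the relations
   of H_W(0): pibar_j kills z_D for j outside D, and pi_(w0(D^c)) z_D = z_D.  Both the
   submodule generated by z_D and P_D are then spanned by the words in w with D(w) = D.
   Relations in H_W(0) itself are read off from its faithful action on e^rho.

   The braid relations are proved on F[Lambda] by reduction to a finite computation for
   each of the four rank two root systems. *)

(** [dem], [w0] and [dembar_w] are made by choice: of a quotient in F[Lambda], of a longest element,
    of a reduced word. Each must be tied down before use, by unique division by 1 - e^(-gamma_i), by
    a bound on lengths, and by Matsumoto's theorem. Length only speaks of shortest words in
    matrices, so its relation to the signs of roots, on which all the combinatorics rests, has to be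
    derived; this is done inside the dihedral groups generated by two simple reflections. Finiteness
    of W enters through the list [Ws], which yields an invariant form by averaging and the bound on
    lengths.

    The quotient is never formed: statements about it are congruences modulo [inI]. Likewise H_W(0)
    is only a free module with operators [Tact]. Their relations are not proved directly; an
    identity between elements is checked on the images in F[Lambda] and pulled back along an
    injective map. The rank two computation behind the braid relations has integer coefficients,
    which makes it valid over every field. *)

Section FreeModule.
Variables (K : choiceType) (F : fieldType).
Implicit Types (D : {freeg K / F}) (M : lmodType F).

Lemma freeg_expand D : D = \sum_(z <- dom D) coeff z D *: << z >>.
Proof.
rewrite -[LHS]freeg_sumE; apply: eq_bigr => z _.
by apply/eqP/freeg_eqP => x; rewrite coeffZ !coeffU mul1r.
Qed.

Lemma freeg_ext D1 D2 : (forall k, coeff k D1 = coeff k D2) -> D1 = D2.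
Proof. by move=> e; apply/eqP/freeg_eqP. Qed.

Lemma coeff1 (x y : K) : coeff y (<< x >> : {freeg K / F}) = (x == y)%:R.
Proof. by rewrite coeffU mul1r. Qed.

Lemma fgliftE M (f : K -> M) D :
  fglift f D = \sum_(z <- dom D) coeff z D *: f z.
Proof.
rewrite -{1}[D]Freeg_dom fglift_Freeg /prelift big_map.
by apply: eq_bigr.
Qed.

(** [dom] is not additive, so elements are compared over a common list that contains all their
    domains. *)
Lemma fglift_sub M (f : K -> M) D (s : seq K) : uniq s -> {subset dom D <= s} ->
  fglift f D = \sum_(z <- s) coeff z D *: f z.
Proof.
move=> us sub; rewrite fgliftE.
rewrite [RHS](bigID (mem (dom D))) /= [X in _ + X]big1 ?addr0; last first.
  by move=> z /coeff_outdom ->; rewrite scale0r.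
rewrite -[RHS]big_filter; apply: perm_big; apply: uniq_perm.
- exact: uniq_dom.
- exact: filter_uniq.
by move=> z; rewrite mem_filter; case E: (z \in dom D) => //; rewrite sub.
Qed.

Lemma fglift_linear M (f : K -> M) : linear (fglift f).
Proof.
move=> c D1 D2.
set s := undup (dom (c *: D1 + D2) ++ dom D1 ++ dom D2).
have us : uniq s by rewrite undup_uniq.
rewrite !(fglift_sub f us); try by move=> z zD; rewrite mem_undup !mem_cat zD ?orbT.
rewrite scaler_sumr -big_split /=; apply: eq_bigr => z _.
by rewrite coeffD coeffZ scalerDl scalerA.
Qed.

HB.instance Definition _ M (f : K -> M) :=
  GRing.isLinear.Build F {freeg K / F} M _ (fglift f) (fglift_linear f).

Lemma fglift1 M (f : K -> M) k : fglift f << k >> = f k.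
Proof. by rewrite liftU scale1r. Qed.

Lemma freeg_lin_ind (P : {freeg K / F} -> Prop) :
  P 0 -> (forall c k D, P D -> P (c *: << k >> + D)) -> forall D, P D.
Proof.
move=> P0 PS D; rewrite [D]freeg_expand.
by elim: (dom D) => [|z s IH]; rewrite ?big_nil // big_cons; apply: PS.
Qed.

Lemma linear_freeg_ext M (f g : {linear {freeg K / F} -> M}) :
  (forall k, f << k >> = g << k >>) -> f =1 g.
Proof.
move=> e; apply: freeg_lin_ind => [|c k D IH]; first by rewrite !linear0.
by rewrite !linearP e IH.
Qed.

(** Ideals, spans, supports and even the validity of a linear identity are treated as predicates of
    this kind, so that all of them can be checked on generators. *)
Definition subspace (M : lmodType F) (P : M -> Prop) :=
  P 0 /\ forall c u v, P u -> P v -> P (c *: u + v).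

Section Subspace.
Variables (M : lmodType F) (P : M -> Prop).
Hypothesis SP : subspace P.

Lemma sub0 : P 0. Proof. by case: SP. Qed.
Lemma subD u v : P u -> P v -> P (u + v).
Proof. by case: SP => _ H Pu Pv; rewrite -[u]scale1r; apply: H. Qed.
Lemma subZ c u : P u -> P (c *: u).
Proof. by case: SP => P0 H Pu; rewrite -[_ *: _]addr0; apply: H. Qed.
Lemma subN u : P u -> P (- u).
Proof. by rewrite -scaleN1r; apply: subZ. Qed.
Lemma subB u v : P u -> P v -> P (u - v).
Proof. by move=> Pu Pv; apply: subD => //; apply: subN. Qed.
Lemma sub_sum (I : Type) (s : seq I) (Q : pred I) (f : I -> M) :
  (forall i, Q i -> P (f i)) -> P (\sum_(i <- s | Q i) f i).
Proof. by move=> H; elim/big_ind: _ => //; [exact: sub0 | exact: subD]. Qed.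
Lemma sub_sum_seq (I : eqType) (s : seq I) (Q : pred I) (f : I -> M) :
  (forall i, i \in s -> Q i -> P (f i)) -> P (\sum_(i <- s | Q i) f i).
Proof.
move=> H; rewrite big_seq_cond; apply: sub_sum => i /andP[]; exact: H.
Qed.
End Subspace.

Lemma sub_fglift (M : lmodType F) (P : M -> Prop) (f : K -> M) D :
  subspace P -> (forall k, coeff k D != 0 -> P (f k)) -> P (fglift f D).
Proof.
move=> SP H; rewrite fgliftE; apply: sub_sum_seq => // k kD _.
by apply: subZ => //; apply: H; rewrite -mem_dom.
Qed.

Definition supp_in (Q : K -> Prop) D := forall k, coeff k D != 0 -> Q k.

Lemma supp_in_subspace Q : subspace (supp_in Q).
Proof.
split=> [k|c u v Hu Hv k]; first by rewrite coeff0 eqxx.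
rewrite coeffD coeffZ => H.
case: (eqVneq (coeff k u) 0) => [e|/Hu//].
by apply: Hv; move: H; rewrite e mulr0 add0r.
Qed.

Lemma supp_in1 (Q : K -> Prop) k : Q k -> supp_in Q << k >>.
Proof. by move=> Qk x; rewrite coeff1; case: (k =P x) => [<-|_] //; rewrite eqxx. Qed.

Lemma supp_inW (Q Q' : K -> Prop) D :
  (forall k, Q k -> Q' k) -> supp_in Q D -> supp_in Q' D.
Proof. by move=> H S k /S /H. Qed.

Lemma coeff_supp_in (Q : K -> Prop) D k : supp_in Q D -> ~ Q k -> coeff k D = 0.
Proof. by move=> S nQ; apply/eqP/negPn/negP => /S. Qed.

End FreeModule.

Lemma supp_in_lift (F : fieldType) (K K' : choiceType) (Q : K' -> Prop) (f : K -> {freeg K' / F}) (D : {freeg K / F}) :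
  (forall k, coeff k D != 0 -> supp_in Q (f k)) -> supp_in Q (fglift f D).
Proof. by move=> H; apply: sub_fglift => //; exact: supp_in_subspace. Qed.

(** * The group algebra of the weight lattice *)

Section GroupAlgebra.
Variables (r : nat) (F : fieldType).
Local Notation FL := (FL r F).
Local Notation weight := 'rV[int]_r.
Implicit Types (f g h : FL) (l m : weight).
Local Notation expo := (expo F).

Lemma lmul_linearr f : linear (lmul f).
Proof.
move=> c g h; rewrite /lmul !fgliftE scaler_sumr -big_split /=.
by apply: eq_bigr => l _; rewrite linearP scalerDr !scalerA mulrC.
Qed.
HB.instance Definition _ f := GRing.isLinear.Build F FL FL _ (lmul f) (lmul_linearr f).

Lemma lmul_linearl g : linear (fun f => lmul f g).
Proof. by move=> c f h; rewrite /lmul linearP. Qed.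
Definition lmulr g f := lmul f g.
HB.instance Definition _ g := GRing.isLinear.Build F FL FL _ (lmulr g) (lmul_linearl g).

Lemma lmulDl f g h : lmul (f + g) h = lmul f h + lmul g h.
Proof. exact: (linearD (lmulr h)). Qed.
Lemma lmulBl f g h : lmul (f - g) h = lmul f h - lmul g h.
Proof. exact: (linearB (lmulr h)). Qed.
Lemma lmulZl c f h : lmul (c *: f) h = c *: lmul f h.
Proof. exact: (linearZZ (lmulr h)). Qed.
Lemma lmul0l h : lmul 0 h = 0.
Proof. exact: (linear0 (lmulr h)). Qed.
Lemma lmul_suml (I : Type) (s : seq I) (Q : pred I) (f : I -> FL) h :
  lmul (\sum_(i <- s | Q i) f i) h = \sum_(i <- s | Q i) lmul (f i) h.
Proof. exact: (linear_sum (lmulr h)). Qed.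

Lemma lmulXX l m : lmul (expo l) (expo m) = expo (l + m).
Proof. by rewrite /lmul !fglift1. Qed.

Lemma lmul1l f : lmul (expo 0) f = f.
Proof.
elim/freeg_lin_ind: f => [|c k f IH]; first by rewrite linear0.
by rewrite linearP /= IH lmulXX add0r.
Qed.

Lemma lmulC f g : lmul f g = lmul g f.
Proof.
elim/freeg_lin_ind: f => [|c k f IH]; first by rewrite lmul0l linear0.
rewrite lmulDl lmulZl linearP /= -IH; congr (_ *: _ + _).
clear IH; elim/freeg_lin_ind: g => [|d m g IH]; first by rewrite lmul0l linear0.
by rewrite lmulDl lmulZl linearP /= -IH !lmulXX [k + m]addrC.
Qed.

Lemma lmulA f g h : lmul f (lmul g h) = lmul (lmul f g) h.
Proof.
elim/freeg_lin_ind: f => [|c k f IH]; first by rewrite !lmul0l.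
rewrite lmulDl lmulZl IH [lmul (_ + _) g]lmulDl lmulZl lmulDl lmulZl; congr (_ *: _ + _).
clear IH; elim/freeg_lin_ind: g => [|d m g IH]; first by rewrite !(lmul0l, linear0).
rewrite lmulDl lmulZl !linearP /= IH lmulDl lmulZl; congr (_ *: _ + _).
clear IH; elim/freeg_lin_ind: h => [|d' m' h IH]; first by rewrite !(lmul0l, linear0).
by rewrite !linearP /= IH !lmulXX addrA.
Qed.

Lemma lmulCA f g h : lmul f (lmul g h) = lmul g (lmul f h).
Proof. by rewrite !lmulA (lmulC f). Qed.

Lemma coeff_lmulX l f m : coeff m (lmul (expo l) f) = coeff (m - l) f.
Proof.
elim/freeg_lin_ind: f => [|c k f IH]; first by rewrite linear0 !coeff0.
rewrite linearP /= lmulXX !(coeffD, coeffZ) IH !coeff1; congr (_ * _%:R + _).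
by congr nat_of_bool; rewrite -[RHS](inj_eq (addrI l)) [l + (m - l)]addrC subrK.
Qed.

(** The support would be stable under translation by [-l], hence infinite unless empty. This makes 1
    - e^(-gamma_i) a non-zero-divisor. *)
Lemma shift_invariant_eq0 l f : l != 0 -> lmul (expo l) f = f -> f = 0.
Proof.
move=> l0 e; apply: freeg_ext => m; rewrite coeff0; apply/eqP; apply: contraT => m0.
have inD n : m - l *+ n \in dom f.
  elim: n => [|n]; first by rewrite mulr0n subr0 mem_dom.
  by rewrite !mem_dom -{1}e coeff_lmulX mulrSr opprD addrA.
have inj : injective (fun n : nat => m - l *+ n).
  move=> n1 n2 /addrI /oppr_inj /rowP H.
  have [i li] : exists i, l 0 i != 0.
    apply/existsP; rewrite -negb_forall; apply: contraNN l0 => /forallP H0.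
    by apply/eqP/rowP => i; rewrite mxE; apply/eqP; exact: H0.
  by move: (H i); rewrite !mulmxnE; apply: mulrIn.
have : (size (map (fun n : nat => (m - l *+ n)%R) (iota 0 (size (dom f)).+1)) <= size (dom f))%N.
  apply: uniq_leq_size; first by rewrite map_inj_uniq ?iota_uniq.
  by move=> k /mapP[n _ ->].
by rewrite size_map size_iota ltnn.
Qed.

End GroupAlgebra.

Lemma mulmxzE (m n : nat) (A : 'M[int]_(m, n)) (z : int) i j :
  (A *~ z) i j = A i j * z.
Proof. by rewrite -scaler_int mxE intz mulrC. Qed.

(** * Demazure operators in closed form *)

Section Demazure.
Variables (r : nat) (C : 'M[int]_r) (F : fieldType).
Local Notation FL := (FL r F).
Local Notation weight := 'rV[int]_r.
Local Notation Wmat := 'M[int]_r.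
Implicit Types (f g h : FL) (l m : weight) (u v w : Wmat) (i j : 'I_r).
Local Notation expo := (expo F).
Local Notation "''a_' i" := (sroot C i) (at level 8, i at level 2, format "''a_' i").
Local Notation s_ := (sref C).

Lemma act_sref i l : act (s_ i) l = l - 'a_i *~ l 0 i.
Proof.
rewrite /act /sref mulmxBr mulmx1 mulmxA; congr (_ - _).
apply/rowP => j; rewrite mulmxzE !mxE (bigD1 i) //= big1 ?addr0.
  rewrite !mxE (bigD1 i) //= big1 ?addr0; first by rewrite !mxE !eqxx mulr1 mulrC.
  by move=> k ki; rewrite mxE (negbTE ki) mulr0.
by move=> k ki; rewrite mxE big1 ?mul0r // => k' _; rewrite mxE (negbTE ki) andbF mulr0.
Qed.

Lemma actD w l m : act w (l + m) = act w l + act w m.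
Proof. by rewrite /act mulmxDl. Qed.
Lemma actN w l : act w (- l) = - act w l.
Proof. by rewrite /act mulNmx. Qed.
Lemma actB w l m : act w (l - m) = act w l - act w m.
Proof. by rewrite actD actN. Qed.
Lemma act0 w : act w 0 = 0 :> weight.
Proof. by rewrite /act mul0mx. Qed.
Lemma actMz w l n : act w (l *~ n) = act w l *~ n.
Proof. by rewrite /act -!scaler_int scalemxAl. Qed.
Lemma act1 l : act 1%:M l = l.
Proof. by rewrite /act mulmx1. Qed.
Lemma act_mul u v l : act (wmul u v) l = act u (act v l).
Proof. by rewrite /act /wmul mulmxA. Qed.
Lemma act_sum w (I : Type) (s : seq I) (P : pred I) (f : I -> weight) :
  act w (\sum_(k <- s | P k) f k) = \sum_(k <- s | P k) act w (f k).
Proof. by rewrite /act mulmx_suml. Qed.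

HB.instance Definition _ w := GRing.Linear.copy (@wact r F w) (fglift (fun l => expo (act w l))).

Lemma wactX w l : wact w (expo l) = expo (act w l).
Proof. exact: fglift1. Qed.

Lemma wact_lmul w f g : wact w (lmul f g) = lmul (wact w f) (wact w g).
Proof.
elim/freeg_lin_ind: f => [|c k f IH]; first by rewrite lmul0l !linear0 lmul0l.
rewrite lmulDl lmulZl !linearP /= IH lmulDl lmulZl; congr (_ *: _ + _).
clear IH; elim/freeg_lin_ind: g => [|d m g IH]; first by rewrite !linear0.
by rewrite !linearP /= IH lmulXX !wactX lmulXX actD.
Qed.

Hypothesis C2 : forall i, C i i = 2.

Lemma srootii i : ('a_i) 0 i = 2. Proof. by rewrite mxE C2. Qed.

Lemma sroot_neq0 i : 'a_i != 0.
Proof.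
by apply/eqP => e; move: (srootii i); rewrite e mxE.
Qed.

Lemma sref_invol i : wmul (s_ i) (s_ i) = 1%:M.
Proof.
apply/row_matrixP => k; rewrite !rowE mulmx1 -/(act _ _) act_mul !act_sref.
by apply/rowP=> j; rewrite !(mulmxzE, mxE) C2; lia.
Qed.

Lemma act_sroot i : act (s_ i) 'a_i = - 'a_i.
Proof. by rewrite act_sref srootii; apply/rowP=> j; rewrite !(mulmxzE, mxE) ; lia. Qed.

(** The quotient summed as a geometric series: the root string from l to s_i l when the coordinate
    is nonnegative, otherwise minus the points strictly between them. In particular coordinate -1
    gives 0. *)
Definition demX i l : FL :=
  match l 0 i with
  | Posz n => \sum_(j < n.+1) expo (l - 'a_i *+ j)
  | Negz n => - \sum_(j < n) expo (l + 'a_i *+ j.+1)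
  end.
Definition dbX i l : FL :=
  match l 0 i with
  | Posz n => \sum_(j < n) expo (l - 'a_i *+ j.+1)
  | Negz n => - \sum_(j < n.+1) expo (l + 'a_i *+ j)
  end.
Definition demL i : FL -> FL := fglift (demX i).
Definition dbL i : FL -> FL := fglift (dbX i).
HB.instance Definition _ i := GRing.Linear.copy (demL i) (fglift (demX i)).
HB.instance Definition _ i := GRing.Linear.copy (dbL i) (fglift (dbX i)).

Lemma demLX i l : demL i (expo l) = demX i l. Proof. exact: fglift1. Qed.
Lemma dbLX i l : dbL i (expo l) = dbX i l. Proof. exact: fglift1. Qed.

Lemma demL_dbL i f : demL i f = dbL i f + f.
Proof.
elim/freeg_lin_ind: f => [|c l f IH]; first by rewrite !linear0 addr0.
rewrite !linearP /= IH [X in _ = X]addrACA -scalerDr; congr (_ *: _ + _).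
rewrite demLX dbLX /demX /dbX; case: (l 0 i) => n.
  by rewrite big_ord_recl mulr0n subr0 addrC.
by rewrite [X in - X + _]big_ord_recl mulr0n addr0 opprD addrAC addNr add0r.
Qed.

Local Notation root_den i := (expo 0 - expo (- 'a_i)).

Lemma root_den_inj i g h : lmul (root_den i) g = lmul (root_den i) h -> g = h.
Proof.
move=> /eqP; rewrite -subr_eq0 -linearB /= lmulBl lmul1l subr_eq0 => /eqP e.
apply/eqP; rewrite -subr_eq0; apply/eqP.
apply: (@shift_invariant_eq0 _ _ (- 'a_i)); last by rewrite -e.
by rewrite oppr_eq0 sroot_neq0.
Qed.

Lemma demL_spec i f :
  lmul (root_den i) (demL i f) = f - lmul (expo (- 'a_i)) (wact (s_ i) f).
Proof.
elim/freeg_lin_ind: f => [|c l f IH]; first by rewrite !linear0 addr0.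
rewrite !linearP /= IH addrACA -scalerDr; congr (_ *: _ + _).
rewrite demLX wactX lmulXX act_sref lmulBl lmul1l /demX.
case: (l 0 i) => n.
  rewrite (linear_sum (lmul _)) /= -sumrB.
  rewrite (eq_bigr (fun j : 'I_n.+1 =>
      - (expo (l - 'a_i *+ j.+1) - expo (l - 'a_i *+ j)))); last first.
    by move=> j _; rewrite lmulXX opprB mulrS opprD addrCA.
  rewrite sumrN -(big_mkord xpredT (fun j : nat => expo (l - 'a_i *+ j.+1) - expo (l - 'a_i *+ j))).
  rewrite telescope_sumr // mulr0n subr0 opprB; congr (_ - expo _).
  by rewrite -pmulrn mulrS opprD addrCA.
rewrite (linearN (lmul _)) (linear_sum (lmul _)) /= opprK addrC -sumrB.
rewrite (eq_bigr (fun j : 'I_n =>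
      - (expo (l + 'a_i *+ j.+1) - expo (l + 'a_i *+ j)))); last first.
  by move=> j _; rewrite lmulXX opprB mulrS addrCA addKr.
rewrite sumrN -(big_mkord xpredT (fun j : nat => expo (l + 'a_i *+ j.+1) - expo (l + 'a_i *+ j))).
rewrite telescope_sumr // mulr0n addr0 opprB; congr (_ - expo _).
by rewrite NegzE mulrNz opprK -pmulrn mulrS addrCA addKr.
Qed.

(** The equation behind the choice in [dem] has a solution by [demL_spec], and only one by
    [root_den_inj]. *)
Lemma demE i f : dem C i f = demL i f.
Proof.
apply: (@root_den_inj i); rewrite demL_spec.
apply: (epsilon_spec (inhabits 0) (fun g => lmul (root_den i) g
              = f - lmul (expo (- 'a_i)) (wact (s_ i) f))).
by exists (demL i f); rewrite demL_spec.
Qed.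

Lemma dembarE i f : dembar C i f = dbL i f.
Proof. by rewrite /dembar demE demL_dbL addrK. Qed.

Lemma dbL_demL i f : dbL i f = demL i f - f.
Proof. by rewrite demL_dbL addrK. Qed.

Lemma demL_inv i f : wact (s_ i) f = f -> demL i f = f.
Proof.
move=> e; apply: (@root_den_inj i); rewrite demL_spec e lmulBl.
by rewrite lmul1l.
Qed.

(** Applying s_i to the defining equation multiplies both the denominator 1 - e^(-gamma_i) and the
    numerator by -e^(gamma_i). *)
Lemma wact_demL i f : wact (s_ i) (demL i f) = demL i f.
Proof.
have wK g : wact (s_ i) (wact (s_ i) g) = g.
  elim/freeg_lin_ind: g => [|c l g IH]; first by rewrite !linear0.
  by rewrite !linearP /= IH !wactX -act_mul sref_invol act1.
apply: (@root_den_inj i); rewrite demL_spec.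
have := congr1 (wact (s_ i)) (demL_spec i f).
rewrite wact_lmul !linearB /= wact_lmul wK !wactX act0 actN act_sroot opprK => e.
have -> : root_den i = - lmul (expo (- 'a_i)) (expo 0 - expo 'a_i).
  by rewrite linearB /= !lmulXX addr0 addNr opprB.
rewrite -[- lmul _ _]scaleN1r lmulZl -lmulA e scaleN1r linearB /= lmulA lmulXX addNr lmul1l.
by rewrite opprB.
Qed.

Lemma demL_idem i f : demL i (demL i f) = demL i f.
Proof. by apply: demL_inv; apply: wact_demL. Qed.

Lemma dbL_idem i f : dbL i (dbL i f) = - dbL i f.
Proof. by rewrite !dbL_demL linearB /= demL_idem subrr sub0r. Qed.

Lemma demL_lmul i a f : wact (s_ i) a = a -> demL i (lmul a f) = lmul a (demL i f).
Proof.
move=> e; apply: (@root_den_inj i); rewrite demL_spec wact_lmul e.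
by rewrite [RHS]lmulCA demL_spec linearB /=; congr (_ - _); rewrite lmulCA.
Qed.

Lemma dbL_lmul i a f : wact (s_ i) a = a -> dbL i (lmul a f) = lmul a (dbL i f).
Proof. by move=> e; rewrite !dbL_demL demL_lmul // linearB. Qed.

Lemma dbL0 i l : l 0 i = 0 -> dbL i (expo l) = 0.
Proof. by move=> e; rewrite dbLX /dbX (e : l 0 i = Posz 0) big_ord0. Qed.

End Demazure.

(** * Root combinatorics of the Weyl group *)

Section CartanMatrix.
Variables (r : nat) (C : 'M[int]_r).
Hypothesis CF : cartan_finite C.

Lemma cartan_diag i : C i i = 2. Proof. by case: CF. Qed.

Lemma cartan_inj (y : 'rV[int]_r) : y *m C = 0 -> y = 0.
Proof.
case: CF => _ _ _ [d [d0 _ dpos]] yC; apply/eqP; apply: contraT => y0.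
have [i yi] : exists i, y 0 i != 0.
  apply/existsP; rewrite -negb_forall; apply: contraNN y0 => /forallP H0.
  by apply/eqP/rowP => i; rewrite mxE; apply/eqP; exact: H0.
(* Dividing by [d] turns the form at [x] into the sum of (y C)_j x_j, which vanishes. *)
pose x i : rat := (y 0 i)%:~R / d i.
have := dpos x; rewrite exchange_big /= big1; first by move=> H; apply: H; exists i;
  rewrite mulf_neq0 ?intr_eq0 // invr_eq0 gt_eqF.
move=> j _; rewrite -mulr_suml (eq_bigr (fun i => (y 0 i * C i j)%:~R)).
  by rewrite -rmorph_sum /=; move/rowP: yC => /(_ j); rewrite !mxE => ->; rewrite mul0r.
by move=> k _; rewrite /x divfK ?gt_eqF // intrM.
Qed.

Lemma cartan_rank2 i j : i != j ->
  (C i j, C j i) \in [:: (0, 0); (-1, -1); (-1, -2); (-2, -1); (-1, -3); (-3, -1)].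
Proof.
move=> ij; case: (CF) => _ neg zer [d [d0 dsym dpos]].
have ji : j != i by rewrite eq_sym.
have a0 := neg _ _ ij; have b0 := neg _ _ ji.
have lt4 : C i j * C j i < 4.
  (* At this vector the form equals 2 d_j (4 - C_ij C_ji), so positivity bounds the product of the
     two entries. *)
  pose x k : rat := if k == i then - (C i j)%:~R else if k == j then 2 else 0.
  have : 0 < \sum_k \sum_l x k * d k * (C k l)%:~R * x l.
    by apply: dpos; exists j; rewrite /x (negbTE ji) eqxx.
  have sum2 (f : 'I_r -> rat) : (forall k, k != i -> k != j -> f k = 0) ->
      \sum_k f k = f i + f j.
    move=> H; rewrite (bigD1 i) //= (bigD1 j) //= big1 ?addr0 //.
    by move=> k /andP[]; exact: H.
  rewrite sum2; last by move=> k ki kj; rewrite big1 // => l _; rewrite /x (negbTE ki) (negbTE kj) !mul0r.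
  rewrite !sum2; try by move=> k ki kj; rewrite [x k]/x (negbTE ki) (negbTE kj) !mulr0.
  rewrite /x !eqxx (negbTE ji) !cartan_diag.
  have := dsym i j; have := d0 i; have := d0 j.
  rewrite -(ltr_int rat) intrM.
  move: (d i) (d j) ((C i j)%:~R : rat) ((C j i)%:~R : rat) => di dj a b pj p1 e.
  move=> H.
  have : 0 < 2 * dj * (4 - a * b).
    by move: H; congr (0 < _); apply/eqP; rewrite -subr_eq0; apply/eqP; ring: e.
  by rewrite pmulr_rgt0 ?subr_gt0 // mulr_gt0.
have z1 : C i j = 0 -> C j i = 0 by move/zer.
have z2 : C j i = 0 -> C i j = 0 by move/zer.
move: a0 b0 lt4 z1 z2; rewrite !inE !xpair_eqE.
move: (C i j) (C j i) => a b.
case: a => [[|n]|n] //; case: b => [[|m]|m] //; try by [move=> *; exfalso; lia]; move=> _ _ H _ _.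
  by case: n H => [|[|[|n]]]; case: m => [|[|[|m]]] //= H; exfalso; move: H; rewrite !NegzE; nia.
Qed.
End CartanMatrix.

(** * Words, lengths and inverses in the Weyl group *)

Section Words.
Variables (r : nat) (C : 'M[int]_r).
Hypothesis C2 : forall i, C i i = 2.
Local Notation weight := 'rV[int]_r.
Local Notation Wmat := 'M[int]_r.
Implicit Types (l m : weight) (u v w : Wmat) (i j : 'I_r) (s t : seq 'I_r).
Local Notation s_ := (sref C).
Local Notation wm := (wmat C).
Local Notation len := (lengthW C).
Local Notation inW := (inW C).

Lemma wmulA u v w : wmul u (wmul v w) = wmul (wmul u v) w.
Proof. by rewrite /wmul mulmxA. Qed.
Lemma wmul1 w : wmul w 1%:M = w. Proof. by rewrite /wmul mul1mx. Qed.
Lemma wmul1l w : wmul 1%:M w = w. Proof. by rewrite /wmul mulmx1. Qed.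

Lemma wmat1 i : wm [:: i] = s_ i. Proof. by rewrite /= wmul1. Qed.

Lemma wmat_cat s t : wm (s ++ t) = wmul (wm s) (wm t).
Proof. by elim: s => [|i s IH] /=; rewrite ?wmul1l // IH wmulA. Qed.

Lemma wmat_rcons s i : wm (rcons s i) = wmul (wm s) (s_ i).
Proof. by rewrite -cats1 wmat_cat wmat1. Qed.

Lemma wmul_srefK i w : wmul (wmul w (s_ i)) (s_ i) = w.
Proof. by rewrite -wmulA (sref_invol C2) wmul1. Qed.

Lemma sref_wmulK i w : wmul (s_ i) (wmul (s_ i) w) = w.
Proof. by rewrite wmulA (sref_invol C2) wmul1l. Qed.

Lemma wmat_rev s : wmul (wm s) (wm (rev s)) = 1%:M.
Proof.
elim: s => [|i s IH]; first by rewrite wmul1.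
by rewrite rev_cons wmat_rcons /= -wmulA (wmulA (wm s)) IH wmul1l (sref_invol C2).
Qed.

Lemma wmat_rev' s : wmul (wm (rev s)) (wm s) = 1%:M.
Proof. by rewrite -{2}[s]revK wmat_rev. Qed.

Lemma wmat_invmx s : invmx (wm s) = wm (rev s).
Proof.
have [_ U] := mulmx1_unit (wmat_rev s).
by apply: (can_inj (mulKmx U)); rewrite mulmxV //; have := wmat_rev' s; rewrite /wmul => ->.
Qed.

Lemma inW_wmat s : inW (wm s). Proof. by exists s. Qed.
Lemma inW1 : inW 1%:M. Proof. by exists [::]. Qed.
Lemma inW_sref i : inW (s_ i). Proof. by exists [:: i]; rewrite wmat1. Qed.
Lemma inW_mul u v : inW u -> inW v -> inW (wmul u v).
Proof. by move=> [s <-] [t <-]; exists (s ++ t); rewrite wmat_cat. Qed.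
Lemma inW_inv u : inW u -> inW (invmx u).
Proof. by move=> [s <-]; rewrite wmat_invmx; apply: inW_wmat. Qed.
Lemma inW_mulr w i : inW w -> inW (wmul w (s_ i)).
Proof. by move=> h; apply: inW_mul => //; apply: inW_sref. Qed.
Lemma inW_mull w i : inW w -> inW (wmul (s_ i) w).
Proof. by move=> h; apply: inW_mul => //; apply: inW_sref. Qed.
Lemma wmulV u : inW u -> wmul u (invmx u) = 1%:M.
Proof. by move=> [s <-]; rewrite wmat_invmx wmat_rev. Qed.
Lemma wmulVl u : inW u -> wmul (invmx u) u = 1%:M.
Proof. by move=> [s <-]; rewrite wmat_invmx wmat_rev'. Qed.
Lemma wmulKV u w : inW u -> wmul (wmul w (invmx u)) u = w.
Proof. by move=> h; rewrite -wmulA wmulVl // wmul1. Qed.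
Lemma wmulK u w : inW u -> wmul (wmul w u) (invmx u) = w.
Proof. by move=> h; rewrite -wmulA wmulV // wmul1. Qed.
Lemma wmulVK u w : inW u -> wmul (invmx u) (wmul u w) = w.
Proof. by move=> h; rewrite wmulA wmulVl // wmul1l. Qed.
Lemma wmulVKV u w : inW u -> wmul u (wmul (invmx u) w) = w.
Proof. by move=> h; rewrite wmulA wmulV // wmul1l. Qed.
Lemma invmx_wmul u v : inW u -> inW v -> invmx (wmul u v) = wmul (invmx v) (invmx u).
Proof.
move=> hu hv; rewrite -[RHS](wmulVK _ (inW_mul hu hv)); set y := invmx (wmul u v).
by rewrite -(wmulA u) (wmulA v) wmulV // wmul1l wmulV // wmul1.
Qed.
Lemma actK u l : inW u -> act (invmx u) (act u l) = l.
Proof. by move=> h; rewrite -act_mul wmulVl // act1. Qed.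
Lemma actVK u l : inW u -> act u (act (invmx u) l) = l.
Proof. by move=> h; rewrite -act_mul wmulV // act1. Qed.
Lemma act_inj u l m : inW u -> act u l = act u m -> l = m.
Proof. by move=> h e; rewrite -(actK l h) e actK. Qed.
Lemma act_eq u v : (forall l, act u l = act v l) -> u = v.
Proof. by move=> e; apply/row_matrixP => k; rewrite !rowE; exact: e. Qed.
Lemma invmx_sref i : invmx (s_ i) = s_ i.
Proof. by rewrite -[RHS](wmulVK _ (inW_sref i)) (sref_invol C2) wmul1. Qed.

Lemma has_wordP w n : reflect (exists2 s, wm s = w & size s = n) (has_word_of_len C w n).
Proof.
apply: (iffP existsP) => [[t /eqP e]|[s e sz]].
  by exists t => //; rewrite size_tuple.
by exists (tcast sz (in_tuple s)); rewrite val_tcast e.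
Qed.

Lemma len_word w : inW w -> exists2 s, wm s = w & size s = len w.
Proof.
move=> [s e]; apply/has_wordP; rewrite /lengthW.
case: excluded_middle_informative => [H|[]]; first by case: ex_minnP.
by exists (size s); apply/has_wordP; exists s.
Qed.

Lemma len_wmat s : (len (wm s) <= size s)%N.
Proof.
rewrite /lengthW; case: excluded_middle_informative => // H.
by case: ex_minnP => n _; apply; apply/has_wordP; exists s.
Qed.

Lemma redword_spec w : inW w -> wm (redword C w) = w /\ size (redword C w) = len w.
Proof.
move=> /len_word[s e sz]; rewrite /redword; case: pickP => [t /eqP et|/(_ (tcast sz (in_tuple s)))].
  by rewrite et size_tuple.
by rewrite val_tcast e eqxx.
Qed.

Lemma len1 : len 1%:M = 0%N.
Proof. by have := len_wmat [::]; rewrite leqn0 => /eqP. Qed.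

Lemma len0 w : inW w -> len w = 0%N -> w = 1%:M.
Proof. by move=> /len_word[s <- <-] /size0nil ->. Qed.

Lemma len_mul u v : inW u -> inW v -> (len (wmul u v) <= len u + len v)%N.
Proof.
move=> /len_word[s <- <-] /len_word[t <- <-].
by rewrite -wmat_cat -size_cat len_wmat.
Qed.

Lemma len_inv_le u : inW u -> (len (invmx u) <= len u)%N.
Proof. by move=> /len_word[s <- <-]; rewrite wmat_invmx -(size_rev s) len_wmat. Qed.

Lemma len_inv u : inW u -> len (invmx u) = len u.
Proof.
move=> h; apply/eqP; rewrite eqn_leq len_inv_le // -{1}[u]invmxK.
by rewrite len_inv_le //; apply: inW_inv.
Qed.

Lemma len_sref i : (len (s_ i) <= 1)%N.
Proof. by rewrite -wmat1 len_wmat. Qed.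

Lemma len_mulr w i : inW w -> (len (wmul w (s_ i)) <= (len w).+1)%N.
Proof.
move=> h; apply: leq_trans (len_mul h (inW_sref i)) _.
by rewrite -addn1 leq_add2l len_sref.
Qed.
Lemma len_mulr' w i : inW w -> (len w <= (len (wmul w (s_ i))).+1)%N.
Proof. by move=> h; rewrite -{1}(wmul_srefK i w) len_mulr //; apply: inW_mulr. Qed.
Lemma len_mull w i : inW w -> (len (wmul (s_ i) w) <= (len w).+1)%N.
Proof.
move=> h; apply: leq_trans (len_mul (inW_sref i) h) _.
by rewrite -add1n leq_add2r len_sref.
Qed.
Definition is_reduced s := size s = len (wm s).

Lemma reduced_redword w : inW w -> is_reduced (redword C w).
Proof. by move=> /redword_spec[e sz]; rewrite /is_reduced e. Qed.

Lemma reduced_catl s t : is_reduced (s ++ t) -> is_reduced s.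
Proof.
rewrite /is_reduced size_cat wmat_cat => e; apply/eqP.
rewrite eqn_leq len_wmat andbT -(leq_add2r (size t)) e.
apply: leq_trans (len_mul (inW_wmat s) (inW_wmat t)) _.
by rewrite leq_add2l len_wmat.
Qed.

Lemma reduced_catr s t : is_reduced (s ++ t) -> is_reduced t.
Proof.
rewrite /is_reduced size_cat wmat_cat => e; apply/eqP.
rewrite eqn_leq len_wmat andbT -(leq_add2l (size s)) e.
apply: leq_trans (len_mul (inW_wmat s) (inW_wmat t)) _.
by rewrite leq_add2r len_wmat.
Qed.

Lemma reduced_rcons s i : is_reduced (rcons s i) -> is_reduced s.
Proof. by rewrite -cats1; apply: reduced_catl. Qed.
Lemma reduced_cons s i : is_reduced (i :: s) -> is_reduced s.
Proof. by rewrite -cat1s; apply: reduced_catr. Qed.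

Lemma reduced_word w : inW w -> exists2 s, wm s = w & is_reduced s.
Proof. by move=> /redword_spec[e sz]; exists (redword C w); rewrite // /is_reduced e. Qed.

Lemma last_letter w : inW w -> (0 < len w)%N ->
  exists i, (len (wmul w (s_ i))).+1 = len w.
Proof.
move=> h; have [s <- rs] := reduced_word h; rewrite -rs.
case/lastP: s rs => // s i rs _; exists i.
by rewrite wmat_rcons wmul_srefK size_rcons (reduced_rcons rs).
Qed.

Definition nonneg_root_comb l := exists2 y : weight, (forall i, 0 <= y 0 i) & l = y *m C.

Lemma nonneg_root_combD l m : nonneg_root_comb l -> nonneg_root_comb m -> nonneg_root_comb (l + m).
Proof.
move=> [y y0 ->] [z z0 ->]; exists (y + z); last by rewrite mulmxDl.
by move=> i; rewrite mxE addr_ge0.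
Qed.
Lemma nonneg_root_combMz l n : 0 <= n -> nonneg_root_comb l -> nonneg_root_comb (l *~ n).
Proof.
move=> n0 [y y0 ->]; exists (y *~ n); last by rewrite -!scaler_int scalemxAl.
by move=> i; rewrite mulmxzE mulr_ge0.
Qed.
Lemma nonneg_root_comb0 : nonneg_root_comb 0. Proof. by exists 0; rewrite ?mul0mx // => i; rewrite mxE. Qed.
Lemma nonneg_root_comb_sroot i : nonneg_root_comb (sroot C i).
Proof. by exists (delta_mx 0 i); rewrite /sroot ?rowE // => j; rewrite mxE; case: (_ && _). Qed.
Lemma nonneg_root_comb_sum (I : Type) (s : seq I) (P : pred I) (f : I -> weight) :
  (forall k, P k -> nonneg_root_comb (f k)) -> nonneg_root_comb (\sum_(k <- s | P k) f k).
Proof. by move=> H; elim/big_ind: _ => //; [exact: nonneg_root_comb0|exact: nonneg_root_combD]. Qed.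
Lemma mulmx_sroot (y : weight) : y *m C = \sum_i sroot C i *~ y 0 i.
Proof.
rewrite mulmx_sum_row; apply: eq_bigr => i _.
by rewrite -scaler_int intz.
Qed.

Lemma nonneg_root_comb_anti l : (forall y : weight, y *m C = 0 -> y = 0) -> nonneg_root_comb l -> nonneg_root_comb (- l) -> l = 0.
Proof.
move=> inj [y y0 e] [z z0 e'].
have /inj : (y + z) *m C = 0 by rewrite mulmxDl -e -e' subrr.
move=> /rowP yz; suff y_0 : y = 0 by rewrite e y_0 mul0mx.
apply/rowP => i; move: (yz i) (y0 i) (z0 i); rewrite !mxE.
by move: (y 0 i) (z 0 i) => a b; lia.
Qed.

End Words.

(** * The invariant quadratic form *)

Section InvariantForm.
Variables (r : nat) (C : 'M[int]_r) (Ws : seq 'M[int]_r).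
Hypothesis C2 : forall i, C i i = 2.
Hypothesis Ws_uniq : uniq Ws.
Hypothesis WsP : forall w, w \in Ws <-> inW C w.
Local Notation weight := 'rV[int]_r.
Local Notation Wmat := 'M[int]_r.
Implicit Types (l m k x y : weight) (u v w : Wmat) (i j : 'I_r).
Local Notation "''a_' i" := (sroot C i) (at level 8, i at level 2, format "''a_' i").
Local Notation inW := (inW C).

Lemma perm_Ws_mull u : inW u -> perm_eq [seq u *m w | w <- Ws] Ws.
Proof.
move=> hu; have inj : injective (mulmx u : Wmat -> Wmat).
  move=> v w e; rewrite -(wmulK C2 v hu) -[RHS](wmulK C2 w hu).
  by rewrite /wmul e.
apply: uniq_perm => // [|w]; first by rewrite map_inj_uniq.
apply/mapP/idP => [[v /WsP hv ->]|/WsP hw]; first by apply/WsP; apply: inW_mul.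
exists (wmul w (invmx u)); first by apply/WsP; apply: inW_mul => //; apply: inW_inv.
by rewrite -/(wmul _ u) (wmulKV C2).
Qed.

(* Averaging over the finite group W makes the standard form W-invariant. *)
Definition form x y : int := \sum_(w <- Ws) \sum_j (x *m w) 0 j * (y *m w) 0 j.

Lemma formC x y : form x y = form y x.
Proof. by apply: eq_bigr => w _; apply: eq_bigr => j _; rewrite mulrC. Qed.
Lemma formDl x y z : form (x + y) z = form x z + form y z.
Proof.
rewrite /form -big_split /=; apply: eq_bigr => w _; rewrite -big_split /=.
by apply: eq_bigr => j _; rewrite mulmxDl mxE mulrDl.
Qed.
Lemma formDr x y z : form x (y + z) = form x y + form x z.
Proof. by rewrite formC formDl formC (formC z). Qed.
Lemma formMl x y (n : int) : form (x *~ n) y = form x y * n.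
Proof.
rewrite /form mulr_suml; apply: eq_bigr => w _; rewrite mulr_suml.
by apply: eq_bigr => j _; rewrite -!scaler_int -scalemxAl [X in X * _]mxE intz -mulrA [n * _]mulrC.
Qed.
Lemma formMr x y (n : int) : form x (y *~ n) = form x y * n.
Proof. by rewrite formC formMl formC. Qed.
Lemma form0l y : form 0 y = 0.
Proof. by rewrite -(mulr0z (0 : weight)) formMl mulr0. Qed.
Lemma formNl x y : form (- x) y = - form x y.
Proof. by rewrite -mulrN1z formMl mulrN1. Qed.
Lemma formNr x y : form x (- y) = - form x y.
Proof. by rewrite formC formNl formC. Qed.
Lemma formBl x y z : form (x - y) z = form x z - form y z.
Proof. by rewrite formDl formNl. Qed.
Lemma formBr x y z : form x (y - z) = form x y - form x z.
Proof. by rewrite formDr formNr. Qed.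
Lemma form_suml (I : Type) (s : seq I) (P : pred I) (f : I -> weight) y :
  form (\sum_(k <- s | P k) f k) y = \sum_(k <- s | P k) form (f k) y.
Proof.
elim: s => [|a s IH]; first by rewrite !big_nil form0l.
by rewrite !big_cons; case: ifP => _; rewrite ?formDl IH.
Qed.
Lemma form_sumr (I : Type) (s : seq I) (P : pred I) (f : I -> weight) y :
  form y (\sum_(k <- s | P k) f k) = \sum_(k <- s | P k) form y (f k).
Proof. by rewrite formC form_suml; apply: eq_bigr => k _; rewrite formC. Qed.

Lemma form_act u x y : inW u -> form (act u x) (act u y) = form x y.
Proof.
move=> hu; rewrite /form -[RHS](perm_big _ (perm_Ws_mull hu)) big_map.
by apply: eq_bigr => w _; apply: eq_bigr => j _; rewrite /act !mulmxA.
Qed.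

Lemma form_ge0 x : 0 <= form x x.
Proof. by apply: sumr_ge0 => w _; apply: sumr_ge0 => j _; rewrite -expr2 sqr_ge0. Qed.

Lemma form_eq0 x : form x x = 0 -> x = 0.
Proof.
move/eqP; rewrite psumr_eq0; last first.
  by move=> w _; apply: sumr_ge0 => j _; rewrite -expr2 sqr_ge0.
move/allP/(_ 1%:M) => H; have /H : 1%:M \in Ws by apply/WsP; apply: inW1.
rewrite /= psumr_eq0; last by move=> j _; rewrite -expr2 sqr_ge0.
rewrite mulmx1 => /allP H'; apply/rowP => j; rewrite mxE.
by have := H' j (mem_index_enum _); rewrite /= -expr2 sqrf_eq0 => /eqP.
Qed.

Lemma form_gt0 x : x != 0 -> 0 < form x x.
Proof.
by move=> x0; rewrite lt_def form_ge0 andbT; apply: contraNneq x0 => /form_eq0 ->.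
Qed.

Lemma root_gt0 i : 0 < form 'a_i 'a_i.
Proof. by apply: form_gt0; apply: sroot_neq0. Qed.

(** Invariance under s_i, which negates a_i. The factor 2 stays on the left to remain in the
    integers. *)
Lemma form_sroot l i : form l 'a_i * 2 = l 0 i * form 'a_i 'a_i.
Proof.
have := form_act l 'a_i (inW_sref C i).
rewrite act_sroot // act_sref formNr formBl formMl.
by move: (form l _) (form 'a_i _) (l 0 i) => a b c; lia.
Qed.

Definition dom_wt l := forall i, 0 <= l 0 i.

Lemma form_sroot_ge0 l i : 0 <= l 0 i -> 0 <= form l 'a_i.
Proof.
move=> l0; have := form_sroot l i; have : 0 <= l 0 i * form 'a_i 'a_i by rewrite mulr_ge0 // form_ge0.
by move: (form l _) (l 0 i * _) => a b; lia.
Qed.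

Lemma form_pos_ge0 l k : dom_wt l -> nonneg_root_comb C k -> 0 <= form l k.
Proof.
move=> dl [y y0 ->]; rewrite mulmx_sroot form_sumr; apply: sumr_ge0 => i _.
by rewrite formMr mulr_ge0 // form_sroot_ge0.
Qed.

Lemma coord_act_root w l i : inW w ->
  act w l 0 i * form 'a_i 'a_i = form l (act (invmx w) 'a_i) * 2.
Proof.
move=> hw; rewrite -form_sroot -(form_act _ (act (invmx w) _) hw) (actVK C2) //.
Qed.

Lemma coord_act_ge0 w l i : inW w -> dom_wt l -> nonneg_root_comb C (act (invmx w) 'a_i) -> 0 <= act w l 0 i.
Proof.
move=> hw dl pr; rewrite -(pmulr_lge0 _ (root_gt0 i)) coord_act_root //.
by rewrite mulr_ge0 // form_pos_ge0.
Qed.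

End InvariantForm.

(** * Dihedral subgroups of rank two *)

Section RankTwo.
Variables (r : nat) (C : 'M[int]_r).
Hypothesis CF : cartan_finite C.
Let C2 := cartan_diag CF.
Local Notation weight := 'rV[int]_r.
Local Notation s_ := (sref C).
Local Notation "''a_' i" := (sroot C i) (at level 8, i at level 2, format "''a_' i").

(* The alternating word of length n with last letter t. *)
Fixpoint alt (T : Type) n (s t : T) : seq T :=
  if n is n'.+1 then (if odd n' then s else t) :: alt n' s t else [::].

Lemma altSr T n (s t : T) : alt n.+1 s t = rcons (alt n t s) t.
Proof. by elim: n => [//|n IH]; rewrite [LHS]/= -/(alt n.+1 s t) IH /=; case: (odd n). Qed.

Lemma size_alt T n (s t : T) : size (alt n s t) = n.
Proof. by elim: n => //= n ->. Qed.

(* The order of s_i s_j. *)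
Definition coxeter_m (i j : 'I_r) : nat := nth 0%N [:: 2; 3; 4; 6]%N (absz (C i j * C j i)%R).

Lemma coxeter_mC i j : coxeter_m i j = coxeter_m j i.
Proof. by rewrite /coxeter_m mulrC. Qed.

Lemma act_sref_comb i j (l : weight) (x y : int) :
  act (s_ i) (l - ('a_i *~ x + 'a_j *~ y)) =
  l - ('a_i *~ (l 0 i - x - y * C j i) + 'a_j *~ y).
Proof.
rewrite act_sref; apply/rowP => q; rewrite !(mxE, mulmxzE) C2.
move: (l 0 q) (C i q) (C j q) (C j i) (l 0 i) => a b c d e; ring.
Qed.

(** The multiples of a_i and a_j subtracted from a weight by an alternating word. Tracking these two
    integers alone turns questions about W into polynomial identities in the coordinates [a],
    [b]. *)
Fixpoint comb_walk n (p q a b : int) : int * int :=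
  if n is n'.+1 then
    let: (x, y) := comb_walk n' p q a b in
    if odd n' then (a - x - y * q, y) else (x, b - y - x * p)
  else (0, 0).

Lemma act_alt n i j (l : weight) :
  act (wmat C (alt n i j)) l =
  l - ('a_i *~ (comb_walk n (C i j) (C j i) (l 0 i) (l 0 j)).1
     + 'a_j *~ (comb_walk n (C i j) (C j i) (l 0 i) (l 0 j)).2).
Proof.
elim: n => [|n IH]; first by rewrite act1 !mulr0z addr0 subr0.
have -> : wmat C (alt n.+1 i j) = wmul (s_ (if odd n then i else j)) (wmat C (alt n i j)) by [].
rewrite act_mul IH.
set p := C i j; set q := C j i; set a := l 0 i; set b := l 0 j.
have -> : comb_walk n.+1 p q a b = let: (x, y) := comb_walk n p q a b in
    if odd n then (a - x - y * q, y) else (x, b - y - x * p) by [].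
case: (comb_walk n p q a b) => x y; case: (odd n); rewrite [fst _]/= [snd _]/=.
  exact: act_sref_comb.
have := act_sref_comb j i l y x; rewrite ![_ + 'a_i *~ _]addrC; exact.
Qed.

Lemma rank2_braid i j : i != j -> wmat C (alt (coxeter_m i j) i j) = wmat C (alt (coxeter_m i j) j i).
Proof.
move=> ij; apply: act_eq => l; rewrite !act_alt [X in _ = _ - X]addrC.
suff e a b : comb_walk (coxeter_m i j) (C i j) (C j i) a b =
    ((comb_walk (coxeter_m i j) (C j i) (C i j) b a).2, (comb_walk (coxeter_m i j) (C j i) (C i j) b a).1).
  by rewrite e.
have := cartan_rank2 CF ij; rewrite !inE /coxeter_m.
move: (C i j) (C j i) => p q.
by move=> /or4P[|||/or3P[]] /eqP[-> ->]; congr (_, _); rewrite /=; ring.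
Qed.

(** The last letter is [j], so fewer than m letters do not push a_i out of the cone of a_i and a_j.
    The walk starts from Cartan entries, so each case is a computation. *)
Lemma rank2_pos n i j : i != j -> (n < coxeter_m i j)%N ->
  exists x y : int, [/\ 0 <= x, 0 <= y & act (wmat C (alt n i j)) 'a_i = 'a_i *~ x + 'a_j *~ y].
Proof.
move=> ij; rewrite act_alt srootii // [sroot C i 0 j]mxE.
set x := (comb_walk _ _ _ _ _).1; set y := (comb_walk _ _ _ _ _).2.
move=> nm; exists (1 - x), (- y); rewrite subr_ge0 oppr_ge0.
suff [x0 y0] : x <= 1 /\ y <= 0.
  by split=> //; rewrite mulrzBr mulrNz mulr1z opprD addrA.
move: nm; rewrite {}/x {}/y.
have := cartan_rank2 CF ij; rewrite !inE /coxeter_m => /or4P[|||/or3P[]] /eqP[-> ->] /=;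
  by case: n => [|[|[|[|[|[|n]]]]]].
Qed.

End RankTwo.

(** * Signs of roots, lengths and descents *)

Section WeylGroup.
Variables (r : nat) (C : 'M[int]_r).
Hypothesis CF : cartan_finite C.
Let C2 := cartan_diag CF.
Local Notation weight := 'rV[int]_r.
Local Notation Wmat := 'M[int]_r.
Implicit Types (l mu : weight) (u v w : Wmat) (i j : 'I_r) (D : {set 'I_r}).
Local Notation s_ := (sref C).
Local Notation "''a_' i" := (sroot C i) (at level 8, i at level 2, format "''a_' i").
Local Notation inW := (inW C).
Local Notation len := (lengthW C).
Local Notation wm := (wmat C).
Local Notation nonneg_root_comb := (nonneg_root_comb C).

Lemma act_pos_comb w i j (p q : int) : 0 <= p -> 0 <= q ->
  nonneg_root_comb (act w 'a_i) -> nonneg_root_comb (act w 'a_j) -> nonneg_root_comb (act w ('a_i *~ p + 'a_j *~ q)).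
Proof. by move=> p0 q0 pi pj; rewrite actD !actMz; apply: nonneg_root_combD; apply: nonneg_root_combMz. Qed.

(* Write w = v u with u a maximal alternating suffix in s_i and a last letter t of
   w.  By maximality v keeps both simple roots positive (induction on the length),
   and u is too short to send a_i outside the cone of a_i and a_t. *)
Lemma root_sign_aux n w i : inW w -> (len w <= n)%N ->
  (len w <= len (wmul w (s_ i)))%N -> nonneg_root_comb (act w 'a_i).
Proof.
elim: n w i => [|n IH] w i hw wn up.
  by rewrite (len0 hw) ?act1; [exact: nonneg_root_comb_sroot | apply/eqP; rewrite -leqn0].
have [w0|wpos] := posnP (len w); first by rewrite (len0 hw w0) act1; exact: nonneg_root_comb_sroot.
have [t tw] := last_letter C2 hw wpos.
have it : i != t by apply: contraTneq up => ->; rewrite -tw ltnn.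
pose Q k := exists v, [/\ inW v, w = wmul v (wm (alt k i t)) & (len v + k)%N = len w].
have Q1 : Q 1%N.
  exists (wmul w (s_ t)); split; first exact: inW_mulr.
    by rewrite (wmat1 C t) wmul_srefK.
  by rewrite addn1.
have Qdown k : Q k.+1 -> Q k.
  move=> [v [hv ew lv]]; set b := if odd k then i else t.
  have e' : w = wmul (wmul v (s_ b)) (wm (alt k i t)) by rewrite ew -wmulA.
  exists (wmul v (s_ b)); split=> //; first exact: inW_mulr.
  apply/eqP; rewrite eqn_leq {2}e'; apply/andP; split.
    by rewrite -lv -addSnnS leq_add2r len_mulr.
  apply: leq_trans (len_mul (inW_mulr b hv) (inW_wmat C _)) _.
  by rewrite leq_add2l; apply: leq_trans (len_wmat _ _) _; rewrite size_alt.
have [k Qk nQk] : exists2 k, Q k.+1 & ~ Q k.+2.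
  have : forall d, (exists2 k, Q k.+1 & ~ Q k.+2) \/ Q d.+1.
    elim=> [|d [e|Qd]]; [by right|by left|].
    case: (excluded_middle_informative (Q d.+2)) => h; first by right.
    by left; exists d.
  case/(_ (len w)) => // -[v [_ _ lv]]; exfalso; lia.
(* With an alternating suffix of length m, the braid relation would rewrite it to end in [i], and w
   s_i would be shorter than w. *)
have km : (k.+1 < coxeter_m C i t)%N.
  rewrite ltnNge; apply/negP => mk.
  have down d q : Q (d + q)%N -> Q q.
    by elim: d => // d IHd; rewrite addSn => /Qdown.
  have Qm : Q (coxeter_m C i t) by apply: (down (k.+1 - coxeter_m C i t)%N); rewrite subnK.
  have [v [hv ew lv]] := Qm.
  have [m' em] : exists m', coxeter_m C i t = m'.+1.
    have := cartan_rank2 CF it; rewrite !inE /coxeter_m => /or4P[|||/or3P[]] /eqP[-> ->] /=;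
    by eexists.
  move: ew lv; rewrite (rank2_braid CF it) em altSr wmat_rcons wmulA => ew lv.
  move: up; rewrite {2}ew (wmul_srefK C2) leqNgt => /negP; apply.
  apply: leq_ltn_trans (len_mul hv (inW_wmat C _)) _.
  rewrite -lv addnS ltnS leq_add2l; apply: leq_trans (len_wmat _ _) _.
  by rewrite size_alt.
have [v [hv ew lv]] := Qk.
set b := if odd k then i else t; set a := if odd k then t else i.
have vn : (len v <= n)%N by move: wn; rewrite -lv; lia.
(* If v s_a were shorter, [a] would extend the alternating suffix, against its maximality. *)
have pa : nonneg_root_comb (act v 'a_a).
  apply: IH => //; rewrite leqNgt; apply/negP => lt; apply: nQk.
  exists (wmul v (s_ a)); split; first exact: inW_mulr.
    rewrite [wm _]/= -/(wm (alt k.+1 i t)) if_neg -/a -wmulA (sref_wmulK C2) //.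
  by have := len_mulr' C2 a hv; move: lt lv; lia.
(* If v s_b were shorter, it would absorb the first letter of the suffix and give w a word that is
   too short. *)
have pb : nonneg_root_comb (act v 'a_b).
  apply: IH => //; rewrite leqNgt; apply/negP => lt.
  have : (len w <= len (wmul v (s_ b)) + k)%N.
    rewrite {1}ew [wm _]/= wmulA; apply: leq_trans (len_mul (inW_mulr b hv) (inW_wmat C _)) _.
    by rewrite leq_add2l; apply: leq_trans (len_wmat _ _) _; rewrite size_alt.
  by rewrite -lv; lia.
have [pi pt] : nonneg_root_comb (act v 'a_i) /\ nonneg_root_comb (act v 'a_t).
  by move: pa pb; rewrite /a /b; case: (odd k).
have [x [y [x0 y0 e]]] := rank2_pos CF it km.
by rewrite ew act_mul e; apply: act_pos_comb.
Qed.

Lemma root_pos w i : inW w -> (len w <= len (wmul w (s_ i)))%N -> nonneg_root_comb (act w 'a_i).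
Proof. by move=> hw; apply: (root_sign_aux (n := len w)). Qed.

Lemma root_neg w i : inW w -> (len (wmul w (s_ i)) < len w)%N -> nonneg_root_comb (- act w 'a_i).
Proof.
move=> hw lt; rewrite -actN -(act_sroot C2) -act_mul; apply: root_pos.
  exact: inW_mulr.
by rewrite (wmul_srefK C2) ltnW.
Qed.

Lemma act_sroot_neq0 w i : inW w -> act w 'a_i != 0.
Proof.
move=> hw; apply/eqP => e; move: (sroot_neq0 C2 i); rewrite -(actK C2 'a_i hw) e.
by rewrite act0 eqxx.
Qed.

Lemma root_not_pos_neg w i : inW w -> nonneg_root_comb (act w 'a_i) -> ~ nonneg_root_comb (- act w 'a_i).
Proof.
move=> hw p n; move: (act_sroot_neq0 i hw).
by rewrite (nonneg_root_comb_anti (cartan_inj CF) p n) eqxx.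
Qed.

(** Equal lengths are excluded without a parity argument: [root_pos] would also apply to w s_i and
    make the negative of the root positive. *)
Lemma len_mulr_pos w i : inW w -> nonneg_root_comb (act w 'a_i) -> len (wmul w (s_ i)) = (len w).+1.
Proof.
move=> hw p; have lt : ~~ (len (wmul w (s_ i)) <= len w)%N.
  apply/negP; rewrite leq_eqVlt => /orP[/eqP e|/(root_neg hw)]; last exact: root_not_pos_neg.
  have := @root_pos _ i (inW_mulr i hw); rewrite (wmul_srefK C2) e leqnn => /(_ isT).
  by rewrite act_mul (act_sroot C2) actN; apply: root_not_pos_neg.
by apply/eqP; rewrite eqn_leq len_mulr // ltnNge.
Qed.

Lemma len_mulr_neg w i : inW w -> nonneg_root_comb (- act w 'a_i) -> len w = (len (wmul w (s_ i))).+1.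
Proof.
move=> hw; rewrite -actN -(act_sroot C2) -act_mul => p.
by rewrite -(len_mulr_pos (inW_mulr i hw) p) (wmul_srefK C2).
Qed.

Lemma root_cases w i : inW w ->
  (nonneg_root_comb (act w 'a_i) /\ len (wmul w (s_ i)) = (len w).+1)
  \/ (nonneg_root_comb (- act w 'a_i) /\ len w = (len (wmul w (s_ i))).+1).
Proof.
move=> hw; case: (leqP (len w) (len (wmul w (s_ i)))) => [/(root_pos hw) p|/(root_neg hw) p].
  by left; split=> //; apply: len_mulr_pos.
by right; split=> //; apply: len_mulr_neg.
Qed.

Lemma descentsP w i : inW w -> reflect (nonneg_root_comb (- act w 'a_i)) (i \in descents C w).
Proof.
move=> hw; apply: (iffP idP); rewrite inE; case: (root_cases i hw) => -[p ->] //.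
- by rewrite ltnNge leqnSn.
- by move=> n; case: (root_not_pos_neg hw p n).
Qed.

Lemma ndescentsP w i : inW w -> reflect (nonneg_root_comb (act w 'a_i)) (i \notin descents C w).
Proof.
move=> hw; apply: (iffP idP); rewrite inE; case: (root_cases i hw) => -[p ->] //.
- by rewrite ltnSn.
- by rewrite ltnNge leqnSn.
- by move=> p'; case: (root_not_pos_neg hw p' p).
Qed.

Lemma len_mull_cases w i : inW w ->
  (nonneg_root_comb (act (invmx w) 'a_i) /\ len (wmul (s_ i) w) = (len w).+1)
  \/ (nonneg_root_comb (- act (invmx w) 'a_i) /\ len w = (len (wmul (s_ i) w)).+1).
Proof.
move=> hw; have e : len (wmul (s_ i) w) = len (wmul (invmx w) (s_ i)).
  by rewrite -(len_inv C2 (inW_mull i hw)) (invmx_wmul C2) // ?(invmx_sref C2) //; apply: inW_sref.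
rewrite e -(len_inv C2 hw); apply: root_cases; exact: inW_inv.
Qed.

Lemma descents_mull w i : inW w -> (len w < len (wmul (s_ i) w))%N ->
  descents C w \subset descents C (wmul (s_ i) w).
Proof.
move=> hw lt; apply/subsetP => j; rewrite !inE => lj; rewrite -wmulA.
have := len_mull i (inW_mulr j hw); move: lt lj; lia.
Qed.

Lemma rev_alt T n (s t : T) : rev (alt n s t) = if odd n then alt n s t else alt n t s.
Proof.
elim: n => [//|n IH]; rewrite [alt _ _ _ in LHS]/= rev_cons IH oddS.
by case: (odd n) => /=; rewrite -?altSr // .
Qed.

Lemma coxeter_m_gt0 i j : i != j -> exists m, coxeter_m C i j = m.+1.
Proof.
move=> ij; have := cartan_rank2 CF ij.
by rewrite !inE /coxeter_m => /or4P[|||/or3P[]] /eqP[-> ->] /=; eexists.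
Qed.

(** w negates the whole cone of a_i and a_j. After stripping fewer than m alternating letters, the
    next simple root still pulls back into that cone, so the length drops once more. *)
Lemma dihedral_suffix w i j k : inW w -> i != j -> i \in descents C w -> j \in descents C w ->
  (k <= coxeter_m C i j)%N ->
  exists2 v, inW v & w = wmul v (wm (alt k i j)) /\ (len v + k)%N = len w.
Proof.
move=> hw ij /(descentsP _ hw) ni /(descentsP _ hw) nj; elim: k => [|k IH] km.
  by exists w; rewrite // wmul1 addn0.
have [v hv [ew lv]] := IH (ltnW km); set a := if odd k then i else j.
have ev : v = wmul w (wm (rev (alt k i j))) by rewrite ew -wmulA (wmat_rev C2) wmul1.
have [x [y [x0 y0 e]]] : exists x y : int, [/\ 0 <= x, 0 <= y &
    act (wm (rev (alt k i j))) 'a_a = 'a_i *~ x + 'a_j *~ y].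
  rewrite rev_alt /a; case: (odd k); first exact: rank2_pos.
  have [] := @rank2_pos _ _ CF k j i; rewrite 1?eq_sym 1?coxeter_mC //.
  by move=> x [y [x0 y0 e]]; exists y, x; rewrite addrC.
have /(len_mulr_neg hv) l1 : nonneg_root_comb (- act v 'a_a).
  rewrite ev act_mul e actD !actMz opprD -!mulNrz.
  by apply: nonneg_root_combD; apply: nonneg_root_combMz.
exists (wmul v (s_ a)); first exact: inW_mulr.
split; last by rewrite -lv l1; lia.
by rewrite -/a [wm _]/= -/a -wmulA (sref_wmulK C2).
Qed.

(** * Matsumoto's theorem *)

Section Matsumoto.
Variables (E : Type) (Op : 'I_r -> E -> E).
Hypothesis braid : forall i j, i != j ->
  forall z, foldr Op z (alt (coxeter_m C i j) i j) = foldr Op z (alt (coxeter_m C i j) j i).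

(** Induction on the length. If the last letters i and j differ, both are descents, so w also has
    reduced words ending in either alternating word of length m; these link [s] to [t]. The
    operators are arbitrary so that the result covers both pibar_i and pi_i. *)
Lemma matsumoto s t z : is_reduced C s -> is_reduced C t -> wm s = wm t ->
  foldr Op z s = foldr Op z t.
Proof.
move En : (size s) => n; elim: n s t z En => [|n IH] s t z En rs rt e.
  have : size t = 0%N by rewrite rt -e -rs.
  by move/size0nil ->; move/size0nil: En ->.
have same i s' t' z' : size s' = n -> is_reduced C (rcons s' i) -> is_reduced C (rcons t' i) ->
    wm (rcons s' i) = wm (rcons t' i) -> foldr Op z' (rcons s' i) = foldr Op z' (rcons t' i).
  move=> ss rs' rt' e'; rewrite !foldr_rcons; apply: IH => //.
  - exact: reduced_rcons rs'.
  - exact: reduced_rcons rt'.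
  by have := congr1 (fun w => wmul w (s_ i)) e'; rewrite /= !wmat_rcons !(wmul_srefK C2).
have st : size t = n.+1 by rewrite rt -e -rs.
case/lastP: s En rs e => // s i; rewrite size_rcons => -[En] rs e.
case/lastP: t st rt e => // t j; rewrite size_rcons => -[Et] rt e.
have [eij|ij] := eqVneq i j; first by subst j; apply: same.
have hw := inW_wmat C (rcons s i); set w := wm (rcons s i) in e hw.
have lastD i' s' : is_reduced C (rcons s' i') -> i' \in descents C (wm (rcons s' i')).
  move=> rs'; rewrite inE {1}wmat_rcons (wmul_srefK C2) -rs' size_rcons ltnS.
  exact: len_wmat.
have iD : i \in descents C w by apply: lastD.
have jD : j \in descents C w by rewrite e; apply: lastD.
have [v hv [ew lv]] := dihedral_suffix hw ij iD jD (leqnn _).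
have [y ey ry] := reduced_word hv.
have [m em] := coxeter_m_gt0 ij.
have ew' : w = wmul v (wm (alt (coxeter_m C i j) j i)) by rewrite -(rank2_braid CF ij).
have red q : size q = coxeter_m C i j -> w = wmul v (wm q) -> is_reduced C (y ++ q).
  by move=> sq eq; rewrite /is_reduced size_cat wmat_cat ey -eq sq ry ey.
have szw : len w = n.+1 by rewrite /w -rs size_rcons En.
have szy : (size y + m)%N = n by move: lv; rewrite em szw -ey -ry; lia.
transitivity (foldr Op z (y ++ alt (coxeter_m C i j) j i)).
  have := red _ (size_alt _ _ _) ew'; rewrite em altSr -rcons_cat => r1.
  apply: same => //; rewrite rcons_cat -altSr -em wmat_cat ey -ew' //.
transitivity (foldr Op z (y ++ alt (coxeter_m C i j) i j)).
  by rewrite !foldr_cat braid.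
have := red _ (size_alt _ _ _) ew; rewrite em altSr -rcons_cat => r1.
apply: same => //; first by rewrite size_cat size_alt.
by rewrite rcons_cat -altSr -em wmat_cat ey -ew.
Qed.
End Matsumoto.

End WeylGroup.

(** * Parabolic subgroups and stabilizers of dominant weights *)

Section Parabolic.
Variables (r : nat) (C : 'M[int]_r) (Ws : seq 'M[int]_r).
Hypothesis CF : cartan_finite C.
Hypothesis Ws_uniq : uniq Ws.
Hypothesis WsP : forall w, w \in Ws <-> inW C w.
Let C2 := cartan_diag CF.
Local Notation weight := 'rV[int]_r.
Local Notation Wmat := 'M[int]_r.
Implicit Types (l mu : weight) (u v w : Wmat) (i j : 'I_r) (D : {set 'I_r}).
Local Notation s_ := (sref C).
Local Notation "''a_' i" := (sroot C i) (at level 8, i at level 2, format "''a_' i").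
Local Notation inW := (inW C).
Local Notation len := (lengthW C).
Local Notation nonneg_root_comb := (nonneg_root_comb C).
Local Notation form := (form Ws).
Local Notation desc := (descents C).

(* If a_j is negated by u then (mu, a_j) = (u mu, u a_j) <= 0, so the reduced words of
   u only involve reflections fixing mu. *)
Lemma stab_len u mu : inW u -> dom_wt mu -> dom_wt (act u mu) ->
  act u mu = mu /\ forall w, inW w ->
    ((forall j, mu 0 j = 0 -> j \notin desc w) -> len (wmul w u) = (len w + len u)%N)
    /\ ((forall j, mu 0 j = 0 -> j \in desc w) -> (len (wmul w u) + len u)%N = len w).
Proof.
move En : (len u) => n; elim: n u En => [|n IH] u En hu dmu dumu.
  rewrite (len0 hu En) act1; split=> // w hw.
  by rewrite wmul1 !addn0.
have [|j ej] := last_letter C2 hu; first by rewrite En.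
have hu' := inW_mulr j hu; set u' := wmul u (s_ j) in hu' ej.
have eu : u = wmul u' (s_ j) by rewrite (wmul_srefK C2).
have nj : nonneg_root_comb (- act u 'a_j) by apply/(descentsP CF _ hu); rewrite inE -/u' -ej.
have gt0 := root_gt0 C2 WsP j.
have mj0 : mu 0 j = 0.
  have le0 : form mu 'a_j <= 0.
    rewrite -(form_act C2 Ws_uniq WsP _ _ hu) -oppr_ge0 -formNr.
    by rewrite (form_pos_ge0 C2 Ws_uniq WsP).
  have := form_sroot C2 Ws_uniq WsP mu j.
  have := dmu j; rewrite le_eqVlt => /orP[/eqP //|mu0].
  have := mulr_gt0 mu0 gt0.
  by move: (form _ _) (mu 0 j * _) le0 => a b; lia.
have smu : act (s_ j) mu = mu by rewrite act_sref mj0 mulr0z subr0.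
have eact : act u' mu = act u mu by rewrite /u' act_mul smu.
have En' : len u' = n by move: ej; rewrite En => -[].
have [|fix_u' IHw] := IH u' En' hu' dmu; first by rewrite eact.
split=> [|w hw]; first by rewrite -eact.
have [y y0 ey] : nonneg_root_comb (act u' 'a_j).
  by case: (root_cases CF j hu') => -[] // _; rewrite -eu En En'; lia.
(* As u' fixes mu, (mu, u' a_j) = (mu, a_j) = 0. This is a sum of nonnegative terms, so only simple
   roots orthogonal to mu occur in u' a_j, and on those the sign under w is known. *)
have y_supp i : y 0 i = 0 \/ mu 0 i = 0.
  have sum0 : form mu (act u' 'a_j) = 0.
    rewrite -{1}fix_u' (form_act C2 Ws_uniq WsP) //.
    by have := form_sroot C2 Ws_uniq WsP mu j; rewrite mj0 mul0r; move: (form _ _) => a; lia.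
  move: sum0; rewrite ey mulmx_sroot form_sumr => /eqP.
  rewrite psumr_eq0; last first.
    by move=> k _; rewrite formMr mulr_ge0 // (form_sroot_ge0 C2 Ws_uniq WsP).
  move/allP => /(_ i (mem_index_enum _)) /=; rewrite formMr mulf_eq0 => /orP[/eqP f0|/eqP]; last by left.
  right; have := form_sroot C2 Ws_uniq WsP mu i; rewrite f0 mul0r => /esym/eqP.
  by rewrite mulf_eq0 (gt_eqF (root_gt0 C2 WsP i)) orbF => /eqP.
have ewu : act (wmul w u') 'a_j = \sum_i act w 'a_i *~ y 0 i.
  by rewrite act_mul ey mulmx_sroot act_sum; apply: eq_bigr => i _; rewrite actMz.
have hwu' := inW_mul hw hu'.
have [IH1 IH2] := IHw w hw.
split=> H.
  rewrite eu wmulA (len_mulr_pos CF hwu') ?IH1 ?addnS //.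
  rewrite ewu; apply: nonneg_root_comb_sum => i _; case: (y_supp i) => [->|/H /(ndescentsP CF _ hw) p].
    by rewrite mulr0z; apply: nonneg_root_comb0.
  exact: nonneg_root_combMz.
rewrite -(IH2 H) (len_mulr_neg CF hwu' (i := j)); first by rewrite eu wmulA; lia.
rewrite ewu -sumrN; apply: nonneg_root_comb_sum => i _; case: (y_supp i) => [->|/H /(descentsP CF _ hw) p].
  by rewrite mulr0z oppr0; apply: nonneg_root_comb0.
by rewrite -mulNrz; apply: nonneg_root_combMz.
Qed.

Lemma dom_wt_uniq u v mu mu' : inW u -> inW v -> dom_wt mu -> dom_wt mu' ->
  act u mu = act v mu' -> mu = mu'.
Proof.
move=> hu hv d d' e.
have e' : act (wmul (invmx v) u) mu = mu' by rewrite act_mul e (actK C2).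
have hvu : inW (wmul (invmx v) u) by apply: inW_mul => //; apply: (inW_inv C2).
have du : dom_wt (act (wmul (invmx v) u) mu) by rewrite e'.
by have [<- _] := stab_len hvu d du.
Qed.

(** w^-1 v fixes mu, so by [stab_len] the lengths add in v = w (w^-1 v). *)
Lemma min_coset_len v w mu : inW v -> inW w -> dom_wt mu -> act v mu = act w mu ->
  (forall j, mu 0 j = 0 -> j \notin desc w) ->
  (len w <= len v)%N /\ (len v = len w -> v = w).
Proof.
move=> hv hw d e H; have hu := inW_mul (inW_inv C2 hw) hv.
have e' : act (wmul (invmx w) v) mu = mu by rewrite act_mul e (actK C2).
have du : dom_wt (act (wmul (invmx w) v) mu) by rewrite e'.
have [_ /(_ w hw) [/(_ H) + _]] := stab_len hu d du.
rewrite (wmulVKV C2) // => ->; split; first exact: leq_addr.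
by rewrite -[RHS]addn0 => /addnI /(len0 hu) e1; rewrite -[v](wmulVKV C2 _ hw) e1 wmul1.
Qed.

Lemma lamsetE D j : lamset D 0 j = (j \in D)%:R.
Proof.
rewrite /lamset summxE; case: (boolP (j \in D)) => jD.
  rewrite (bigD1 j) //= big1 ?addr0 ?mxE ?eqxx //.
  by move=> i /andP[_ ij]; rewrite mxE eq_sym (negbTE ij).
rewrite big1 // => i iD; rewrite mxE eqxx /=; case: (j =P i) => // e.
by move: jD; rewrite e iD.
Qed.

Lemma dom_lamset D : dom_wt (lamset D).
Proof. by move=> j; rewrite lamsetE; case: (_ \in _). Qed.

Lemma lamset_eq0 D j : lamset D 0 j = 0 <-> j \notin D.
Proof. by rewrite lamsetE; case: (_ \in _). Qed.

Lemma inWpar_inW D w : inWpar C D w -> inW w.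
Proof. by move=> [s [_ <-]]; apply: inW_wmat. Qed.

Lemma act_inWpar_fix D w l : inWpar C D w -> (forall j, j \in D -> l 0 j = 0) -> act w l = l.
Proof.
move=> [s [+ <-]] l0; elim: s => [|i s IH] /=; first by rewrite act1.
by move=> /andP[iD /IH e]; rewrite act_mul e act_sref l0 // mulr0z subr0.
Qed.

Lemma inWpar_fix D w : inWpar C D w -> act w (lamset (~: D)) = lamset (~: D).
Proof. by move=> h; apply: act_inWpar_fix h _ => j jD; apply/lamset_eq0; rewrite inE jD. Qed.

Lemma inWpar_mulr D w i : i \in D -> inWpar C D w -> inWpar C D (wmul w (s_ i)).
Proof.
move=> iD [s [sD <-]]; exists (rcons s i).
by rewrite wmat_rcons; split=> //; rewrite all_rcons iD.
Qed.
Lemma inWpar_mull D w i : i \in D -> inWpar C D w -> inWpar C D (wmul (s_ i) w).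
Proof. by move=> iD [s [sD <-]]; exists (i :: s); split=> //=; rewrite iD. Qed.
Lemma inWpar_inv D w : inWpar C D w -> inWpar C D (invmx w).
Proof.
by move=> [s [sD <-]]; exists (rev s); rewrite (wmat_invmx C2) all_rev.
Qed.

Lemma len_bounded : exists N, forall w, inW w -> (len w <= N)%N.
Proof.
exists (\max_(w <- Ws) len w)%N => w /WsP hw.
exact: (@leq_bigmax_seq _ Ws xpredT len w hw).
Qed.

Local Notation w0 := (w0 C).

(** The choice in [w0] has a witness because lengths in W are bounded. *)
Lemma w0_spec D : inWpar C D (w0 D) /\ forall u, inWpar C D u -> (len u <= len (w0 D))%N.
Proof.
apply: (epsilon_spec (inhabits 1%:M)
  (fun w => inWpar C D w /\ forall u, inWpar C D u -> (len u <= len w)%N)).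
have [N HN] := len_bounded.
pose Q n := exists2 w, inWpar C D w & len w = n.
have : forall d, (exists2 w, inWpar C D w & forall u, inWpar C D u -> (len u <= len w)%N)
                 \/ exists2 w, inWpar C D w & (d <= len w)%N.
  elim=> [|d [e|[w hw dw]]]; [|by left|].
    by right; exists 1%:M => //; exists [::].
  case: (excluded_middle_informative (exists2 v, inWpar C D v & (len w < len v)%N)) => [[v hv lt]|h].
    by right; exists v => //; apply: leq_ltn_trans lt.
  left; exists w => // u hu; rewrite leqNgt; apply/negP => lt; apply: h; by exists u.
case/(_ N.+1) => [[w hw H]|[w hw H]]; first by exists w.
by move: H; rewrite ltnNge HN //; apply: inWpar_inW hw.
Qed.

Lemma w0_inWpar D : inWpar C D (w0 D). Proof. by case: (w0_spec D). Qed.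
Lemma w0_inW D : inW (w0 D). Proof. exact: inWpar_inW (w0_inWpar D). Qed.

(** For i outside D the weight lambda_(D^c) has positive product with a_i. Since w fixes that
    weight, w a_i also has positive product with it and cannot be negative. *)
Lemma descents_inWpar D w : inWpar C D w -> desc w \subset D.
Proof.
move=> hp; have hw := inWpar_inW hp; apply/subsetP => i /(descentsP CF i hw) n.
apply: contraT => iD.
have := form_pos_ge0 C2 Ws_uniq WsP (dom_lamset (~: D)) n.
rewrite formNr oppr_ge0 -{1}(inWpar_fix hp) (form_act C2 Ws_uniq WsP) //.
have := form_sroot C2 Ws_uniq WsP (lamset (~: D)) i; rewrite lamsetE inE iD mul1r.
by have := root_gt0 C2 WsP i; move: (form _ _) (form _ _) => a b; lia.
Qed.

Lemma descents_w0 D : desc (w0 D) = D.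
Proof.
have [hp Hmax] := w0_spec D; have hw := w0_inW D.
apply/eqP; rewrite eqEsubset descents_inWpar //=; apply/subsetP => i iD.
apply/(descentsP CF i hw); case: (root_cases CF i hw) => -[] // _ e.
by have := Hmax _ (inWpar_mulr iD hp); rewrite e ltnn.
Qed.

Lemma w0_left_descent D i : i \in D -> len (w0 D) = (len (wmul (s_ i) (w0 D))).+1.
Proof.
move=> iD; case: (len_mull_cases CF i (w0_inW D)) => -[] // _ e.
by have := (w0_spec D).2 _ (inWpar_mull iD (w0_inWpar D)); rewrite e ltnn.
Qed.

(** lambda_(D^c) vanishes exactly at D, so the subtractive half of [stab_len] applies to the inverse
    of [w0 D]. *)
Lemma w0_factor D w : inW w -> D \subset desc w ->
  exists2 v, inW v & w = wmul v (w0 D) /\ len w = (len v + len (w0 D))%N.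
Proof.
move=> hw sub; exists (wmul w (invmx (w0 D))); first by apply: inW_mul => //; apply: (inW_inv C2) (w0_inW D).
rewrite (wmulKV C2); last exact: w0_inW.
split=> //.
have hi := inWpar_inv (w0_inWpar D).
have du : dom_wt (act (invmx (w0 D)) (lamset (~: D))) by rewrite inWpar_fix //; apply: dom_lamset.
have [_ /(_ w hw) [_ <-]] := stab_len (inWpar_inW hi) (@dom_lamset (~: D)) du; first by rewrite (len_inv C2) //; apply: w0_inW.
by move=> j /lamset_eq0; rewrite inE negbK => /(subsetP sub).
Qed.

Lemma parabolic_len D w u : inW w -> inWpar C D u -> [disjoint D & desc w] ->
  len (wmul w u) = (len w + len u)%N.
Proof.
move=> hw hu dis.
have du : dom_wt (act u (lamset (~: D))) by rewrite inWpar_fix //; apply: dom_lamset.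
have [_ /(_ w hw) [-> //]] := stab_len (inWpar_inW hu) (@dom_lamset (~: D)) du.
move=> j /lamset_eq0; rewrite inE negbK => jD.
by apply/negP => jd; move/pred0P: dis => /(_ j) /=; rewrite jD jd.
Qed.

End Parabolic.

(** * Alternating products of operators and of their shifts by the identity *)

Fixpoint galt (T : Type) n (c d : T) : seq T := if n is n'.+1 then c :: galt n' d c else [::].

Lemma alt_galt T n (i j : T) : alt n i j = if odd n then galt n j i else galt n i j.
Proof. by elim: n => //= n ->; case: (odd n). Qed.

Section ShiftedOperators.
Variables (F : fieldType) (V : lmodType F) (I : eqType) (Op : I -> {linear V -> V}).
Hypothesis Op_sq : forall i z, Op i (Op i z) = - Op i z.

Let Op' i z := Op i z + z.
Let G z n c d := foldr (fun i => Op i) z (galt n c d).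

(** Expanding the shifted product gives every shorter alternating word once, because Op^2 = -Op
    makes the sum telescope. All but the last term is symmetric in c and d, so a braid relation for
    [Op] passes to [Op']. *)
Lemma foldr_shifted n c d z : foldr Op' z (galt n.+1 c d) =
  z + \sum_(1 <= p < n.+1) (G z p c d + G z p d c) + G z n.+1 c d.
Proof.
have GS p c' d' : Op c' (G z p d' c') = G z p.+1 c' d' by [].
have GN p c' d' : Op c' (G z p.+1 c' d') = - G z p.+1 c' d' by rewrite -GS Op_sq.
have G1 c' d' : G z 1 c' d' = Op c' z by [].
elim: n c d => [|n IH] c d; first by rewrite big_geq //= /Op' addr0 addrC.
have -> : foldr Op' z (galt n.+2 c d) = Op' c (foldr Op' z (galt n.+1 d c)) by [].
rewrite IH /Op'; set S := \sum_(1 <= p < n.+1) _.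
have eS : Op c S = G z n.+1 c d - G z 1 c d.
  rewrite /S linear_sum -(@telescope_sumr _ 1 n.+1 (fun p => G z p c d)) //=.
  apply: eq_big_nat => p /andP[p1 _]; rewrite linearD /= GS; case: p p1 => // p _.
  by rewrite GN.
have -> : Op c (z + S + G z n.+1 d c) = G z n.+1 c d + G z n.+2 c d.
  by rewrite !linearD /= GS eS -(G1 c d) [G z 1 _ _ + _]addrC subrK.
rewrite big_nat_recr //= .
have -> : \sum_(1 <= p < n.+1) (G z p c d + G z p d c) = S.
  by apply: eq_bigr => p _; rewrite addrC.
by rewrite [LHS]addrC -!addrA; congr (_ + (_ + _)); rewrite addrCA.
Qed.

Lemma shifted_braid n i j z :
  (forall z, foldr (fun i => Op i) z (alt n i j) = foldr (fun i => Op i) z (alt n j i)) ->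
  foldr Op' z (alt n i j) = foldr Op' z (alt n j i).
Proof.
case: n => // n H.
have HG z' : G z' n.+1 i j = G z' n.+1 j i.
  by move: (H z'); rewrite !alt_galt /G; case: (odd n.+1).
have e : foldr Op' z (galt n.+1 i j) = foldr Op' z (galt n.+1 j i).
  by rewrite !foldr_shifted HG; congr (_ + _ + _); apply: eq_bigr => p _; rewrite addrC.
by rewrite !alt_galt; case: (odd n.+1).
Qed.

End ShiftedOperators.

(** * Braid relations of the Demazure operators *)

(* [n] is fuel: after collecting like terms all coefficients of [L] are zero. *)
Fixpoint vanish (T : eqType) n (L : seq (int * T)) : bool :=
  match n, L with
  | _, [::] => true
  | 0%N, _ => false
  | n'.+1, t :: L' =>
      (foldr (fun s z => if s.2 == t.2 then s.1 + z else z) t.1 L' == 0)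
      && vanish n' [seq s <- L' | s.2 != t.2]
  end.

Lemma vanishP (F : fieldType) (V : lmodType F) (T : eqType) (g : T -> V) n L :
  vanish n L -> \sum_(t <- L) t.1%:~R *: g t.2 = 0.
Proof.
elim: n L => [|n IH] [|t L] //=; rewrite ?big_nil // => /andP[/eqP z /IH v].
rewrite big_cons (bigID (fun s => s.2 == t.2)) /= -[X in _ + (_ + X)]big_filter v addr0.
have -> : \sum_(s <- L | s.2 == t.2) s.1%:~R *: g s.2 =
          (\sum_(s <- L | s.2 == t.2) s.1)%:~R *: g t.2.
  rewrite rmorph_sum scaler_suml; apply: eq_bigr => s /eqP -> //.
rewrite -scalerDl -intrD; suff -> : t.1 + \sum_(s <- L | s.2 == t.2) s.1 = 0 by rewrite scale0r.
rewrite -[RHS]z {v z}; elim: L => [|s L IHL] /=; first by rewrite big_nil addr0.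
by rewrite big_cons; case: ifP => // _; rewrite -IHL addrCA.
Qed.

(* [(c, (x, y))] stands for the term c e^(l - x a_i - y a_j); [a], [b] are the
   coordinates l_i, l_j, and [p], [q] the Cartan entries C i j, C j i. *)
Definition rk2_weight := (int * int)%type.
Definition db_term1 (a q : int) (t : int * rk2_weight) : seq (int * rk2_weight) :=
  let: (c, (x, y)) := t in
  match a - (x + x) - y * q with
  | Posz n => [seq (c, (x + Posz k.+1, y)) | k <- iota 0 n]
  | Negz n => [seq (- c, (x - Posz k, y)) | k <- iota 0 n.+1]
  end.
Definition db_term2 (b p : int) (t : int * rk2_weight) : seq (int * rk2_weight) :=
  let: (c, (x, y)) := t in
  match b - (y + y) - x * p with
  | Posz n => [seq (c, (x, y + Posz k.+1)) | k <- iota 0 n]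
  | Negz n => [seq (- c, (x, y - Posz k)) | k <- iota 0 n.+1]
  end.
Fixpoint db_alt (n : nat) (fst2 : bool) (p q a b : int) L :=
  if n is n'.+1 then
    let L' := db_alt n' fst2 p q a b L in
    if odd n' (+) fst2 then flatten (map (db_term1 a q) L') else flatten (map (db_term2 b p) L')
  else L.
Definition neg_terms (L : seq (int * rk2_weight)) := [seq (- t.1, t.2) | t <- L].

(** The fuel 1000 only has to reach the number of distinct weights in the two expansions. *)
Definition rk2_base p q a b n :=
  vanish 1000 (db_alt n false p q a b [:: (1, (0, 0))] ++ neg_terms (db_alt n true p q a b [:: (1, (0, 0))])).

(* Up to scaling, the invariant quadratic form of the rank two weight lattice. *)
Definition rk2_form (p q x y : int) : int :=
  if p == 0 then x * x + y * y else - p * (x * x) + p * q * (x * y) - q * (y * y).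

Definition rk2_types : seq (int * int * nat) :=
  [:: (0, 0, 2%N); (-1, -1, 3%N); (-1, -2, 4%N); (-2, -1, 4%N); (-1, -3, 6%N); (-3, -1, 6%N)].

(* The orbit of the i-th fundamental weight, as lambda_i - x a_i - y a_j. *)
Definition rk2_orbit (p q : int) m : seq rk2_weight :=
  [seq let: t := comb_walk k q p 0 1 in (t.2, t.1) | k <- iota 0 m].

Section RankTwoNumerics.
Variables (p q : int) (m : nat).
Hypothesis pqm : (p, q, m) \in rk2_types.

Lemma rk2_base_true a b : a \in [:: 0; 1] -> b \in [:: 0; 1] -> rk2_base p q a b m.
Proof.
move: pqm; rewrite !inE => /or4P[|||/or3P[]] /eqP[-> -> ->] /orP[]/eqP-> /orP[]/eqP->;
by vm_compute.
Qed.

Lemma rk2_form_ge0 x y : 0 <= rk2_form p q x y.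
Proof.
have h1 := sqr_ge0 (2 * x + 3 * y); have h2 := sqr_ge0 y; have h3 := sqr_ge0 x.
have h4 := sqr_ge0 (x + y); have h5 := sqr_ge0 (2 * y + 3 * x).
move: h1 h2 h3 h4 h5; rewrite !expr2 /rk2_form.
by move: pqm; rewrite !inE => /or4P[|||/or3P[]] /eqP[-> -> _] /=; nia.
Qed.

Lemma rk2_form_segment k b t : 0 < t -> t < k ->
  rk2_form p q (k - (t + t)) (b - t * p) < rk2_form p q k b.
Proof.
move=> t0 tk; have : 0 < t * (k - t) by rewrite mulr_gt0 // subr_gt0.
rewrite /rk2_form.
by move: pqm; rewrite !inE => /or4P[|||/or3P[]] /eqP[-> -> _] /=; nia.
Qed.

Lemma rk2_form_refl a b : rk2_form p q (- a) (b - a * p) = rk2_form p q a b.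
Proof.
rewrite /rk2_form.
by move: pqm; rewrite !inE => /or4P[|||/or3P[]] /eqP[-> -> _] /=; ring.
Qed.

(** Both sides are norms of differences with rho = (1, 1): reflecting away a negative coordinate
    brings a weight closer to rho. *)
Lemma rk2_form_up a b : a < 0 ->
  rk2_form p q (- a - 1) (b - a * p - 1) < rk2_form p q (a - 1) (b - 1).
Proof.
rewrite /rk2_form.
by move: pqm; rewrite !inE => /or4P[|||/or3P[]] /eqP[-> -> _] /=; nia.
Qed.

Lemma rk2_orbit_refl1 : perm_eq [seq (1 - t.1 - t.2 * q, t.2) | t <- rk2_orbit p q m] (rk2_orbit p q m).
Proof. by move: pqm; rewrite !inE => /or4P[|||/or3P[]] /eqP[-> -> ->]; vm_compute. Qed.

Lemma rk2_orbit_refl2 : perm_eq [seq (t.1, - t.2 - t.1 * p) | t <- rk2_orbit p q m] (rk2_orbit p q m).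
Proof. by move: pqm; rewrite !inE => /or4P[|||/or3P[]] /eqP[-> -> ->]; vm_compute. Qed.

(** In the product of e^(l - lambda_i) with the orbit sum of lambda_i, the term e^l is strictly the
    longest. For a = 1 the term l - a_i would be s_i l, as long as l. *)
Lemma rk2_orbit_head : exists O, rk2_orbit p q m = (0, 0) :: O /\
  forall t a b, t \in O -> 2 <= a -> 0 <= b ->
  rk2_form p q (a - (t.1 + t.1) - t.2 * q) (b - (t.2 + t.2) - t.1 * p) < rk2_form p q a b.
Proof.
have [m' em] : exists m', m = m'.+1.
  by move: pqm; rewrite !inE => /or4P[|||/or3P[]] /eqP[_ _ ->]; eexists.
exists (behead (rk2_orbit p q m)); split; first by rewrite em.
move=> [x y] a b; rewrite /rk2_form.
by move: pqm; rewrite !inE => /or4P[|||/or3P[]] /eqP[-> -> ->] /=;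
  rewrite !inE; do ?[move=> /orP[]]; do ?[move=> /eqP[-> ->] /=; nia].
Qed.

Lemma rk2_form_lower a b : 2 <= a -> 0 <= b -> rk2_form p q (a - 1) b < rk2_form p q a b.
Proof.
rewrite /rk2_form.
by move: pqm; rewrite !inE => /or4P[|||/or3P[]] /eqP[-> -> _] /=; nia.
Qed.
End RankTwoNumerics.

Section DemazureBraid.
Variables (r : nat) (C : 'M[int]_r) (F : fieldType).
Hypothesis CF : cartan_finite C.
Let C2 := cartan_diag CF.
Local Notation FL := (FL r F).
Local Notation weight := 'rV[int]_r.
Implicit Types (f g h a : FL) (l mu : weight) (i j : 'I_r).
Local Notation s_ := (sref C).
Local Notation db := (dbL C).
Definition dbL_word (s : seq 'I_r) (f : FL) : FL := foldr (fun i => dbL C i) f s.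

Lemma dbL_word_linear s : linear (dbL_word s).
Proof. by move=> c f g; elim: s => //= i s ->; rewrite -!/(dbL_word _ _) linearP. Qed.
HB.instance Definition _ s := GRing.isLinear.Build F FL FL _ (dbL_word s) (dbL_word_linear s).

Definition braid_at i j f := dbL_word (alt (coxeter_m C i j) i j) f = dbL_word (alt (coxeter_m C i j) j i) f.

Lemma braid_at_subspace i j : subspace (braid_at i j).
Proof.
split=> [|c f g]; rewrite /braid_at; first by rewrite !linear0.
by move=> ef eg; rewrite !linearP /= ef eg.
Qed.

Lemma braid_atC i j f : braid_at i j f -> braid_at j i f.
Proof. by rewrite /braid_at coxeter_mC => ->. Qed.

Lemma dbL_word_lmul s a f : (forall i, i \in s -> wact (s_ i) a = a) ->
  dbL_word s (lmul a f) = lmul a (dbL_word s f).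
Proof.
elim: s => //= i s IH H; rewrite IH; last by move=> k ks; apply: H; rewrite inE ks orbT.
by rewrite (dbL_lmul C2) // H // mem_head.
Qed.

Lemma mem_alt n i j k : k \in alt n i j -> k = i \/ k = j.
Proof.
elim: n => //= n IH; rewrite inE => /orP[/eqP->|/IH//].
by case: (odd n); [left|right].
Qed.

Lemma braid_at_lmul i j a f : wact (s_ i) a = a -> wact (s_ j) a = a ->
  braid_at i j f -> braid_at i j (lmul a f).
Proof.
move=> ai aj; rewrite /braid_at => e; rewrite !dbL_word_lmul ?e //;
by move=> k /mem_alt[] ->.
Qed.

(** Both sides are minus the common value at [f]. On one side the last letter absorbs [db j]; on the
    other the word grows to length m + 1, and after the relation at [f] its first two letters
    coincide. *)
Lemma braid_at_db i j f : i != j -> braid_at i j f -> braid_at i j (db j f).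
Proof.
move=> ij; rewrite /braid_at => e.
have [m em] := coxeter_m_gt0 CF ij.
have -> : dbL_word (alt (coxeter_m C i j) i j) (db j f) = - dbL_word (alt (coxeter_m C i j) i j) f.
  by rewrite em altSr /dbL_word !foldr_rcons (dbL_idem C2) -!/(dbL_word _ _) linearN.
have -> : dbL_word (alt (coxeter_m C i j) j i) (db j f) = dbL_word (alt (coxeter_m C i j).+1 i j) f.
  by rewrite /dbL_word altSr foldr_rcons.
have -> : dbL_word (alt (coxeter_m C i j).+1 i j) f =
    db (if odd (coxeter_m C i j) then i else j) (dbL_word (alt (coxeter_m C i j) i j) f) by [].
rewrite e em [alt m.+1 j i]/= [dbL_word (_ :: _) f]/= /= -/(dbL_word _ f).
by case: (odd m) => /=; rewrite (dbL_idem C2).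
Qed.

End DemazureBraid.

Section DemazureBraidAll.
Variables (r : nat) (C : 'M[int]_r) (F : fieldType).
Hypothesis CF : cartan_finite C.
Let C2 := cartan_diag CF.
Local Notation FL := (FL r F).
Local Notation weight := 'rV[int]_r.
Implicit Types (f g h a : FL) (l mu : weight) (i j : 'I_r).
Local Notation expo := (expo F).
Local Notation s_ := (sref C).
Local Notation "''a_' i" := (sroot C i) (at level 8, i at level 2, format "''a_' i").
Local Notation db := (dbL C).
Local Notation dbL_word := (dbL_word C).

Lemma cartan_types i j : i != j -> (C i j, C j i, coxeter_m C i j) \in rk2_types.
Proof.
by move=> ij; have := cartan_rank2 CF ij;
  rewrite !inE /coxeter_m => /or4P[|||/or3P[]] /eqP[-> ->].
Qed.

Definition rk2_ev i j l (L : seq (int * rk2_weight)) : FL :=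
  \sum_(t <- L) t.1%:~R *: expo (l - ('a_i *~ t.2.1 + 'a_j *~ t.2.2)).

Lemma rk2_coord i j l (x y : int) :
  (l - ('a_i *~ x + 'a_j *~ y)) 0 i = l 0 i - (x + x) - y * C j i.
Proof.
rewrite !(mxE, mulmxzE) C2; move: (l 0 i) (C j i) => u v; lia.
Qed.

Lemma rk2_evC i j l L : rk2_ev i j l L = rk2_ev j i l [seq (t.1, (t.2.2, t.2.1)) | t <- L].
Proof. by rewrite /rk2_ev big_map; apply: eq_bigr => t _ /=; rewrite ['a_j *~ _ + _]addrC. Qed.

Lemma db_ev1 i j l L :
  db i (rk2_ev i j l L) = rk2_ev i j l (flatten (map (db_term1 (l 0 i) (C j i)) L)).
Proof.
rewrite /rk2_ev linear_sum big_flatten big_map; apply: eq_bigr => -[c [x y]] _.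
rewrite linearZ /= dbLX /dbX rk2_coord /db_term1; case: (_ - _ - _) => n.
  rewrite big_map scaler_sumr -[X in iota 0 X](subn0 n) -/(index_iota 0 n) big_mkord.
  apply: eq_bigr => k _ /=; congr (_ *: expo _).
  rewrite pmulrn; apply/rowP => u; rewrite !(mxE, mulmxzE).
  by move: (l 0 u) (C i u) (C j u) => e1 e2 e3; ring.
rewrite -[_ :: _]/[seq (- c, (x - Posz k, y)) | k <- iota 0 n.+1].
rewrite big_map scalerN scaler_sumr -[X in iota 0 X](subn0 n.+1) -/(index_iota 0 n.+1) big_mkord.
rewrite -sumrN; apply: eq_bigr => k _ /=; rewrite rmorphN scaleNr.
congr (- (_ *: expo _)); rewrite pmulrn; apply/rowP => u; rewrite !(mxE, mulmxzE).
by move: (l 0 u) (C i u) (C j u) => e1 e2 e3; ring.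
Qed.

Lemma db_ev2 i j l L :
  db j (rk2_ev i j l L) = rk2_ev i j l (flatten (map (db_term2 (l 0 j) (C i j)) L)).
Proof.
rewrite rk2_evC db_ev1 [RHS]rk2_evC; congr rk2_ev.
rewrite map_flatten -!map_comp; congr flatten; apply: eq_map => -[c [x y]] /=.
by case: (_ - _ - _) => n /=; rewrite -map_comp.
Qed.

Lemma dbL_word_ev (b : bool) n i j l L :
  dbL_word (if b then alt n j i else alt n i j) (rk2_ev i j l L) =
  rk2_ev i j l (db_alt n b (C i j) (C j i) (l 0 i) (l 0 j) L).
Proof.
elim: n => [|n IH]; first by case: b.
have -> : dbL_word (if b then alt n.+1 j i else alt n.+1 i j) (rk2_ev i j l L) =
  db (if odd n (+) b then i else j) (dbL_word (if b then alt n j i else alt n i j) (rk2_ev i j l L)).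
  by case: b {IH} => /=; case: (odd n).
have stepE p q x y : db_alt n.+1 b p q x y L = if odd n (+) b
  then flatten (map (db_term1 x q) (db_alt n b p q x y L))
  else flatten (map (db_term2 y p) (db_alt n b p q x y L)) by [].
by rewrite IH stepE; case: (odd n (+) b); [apply: db_ev1|apply: db_ev2].
Qed.

(** Terms are collected over the integers and mapped to [F] only afterwards. *)
Lemma braid_at_base i j l : i != j -> l 0 i \in [:: 0; 1] -> l 0 j \in [:: 0; 1] ->
  braid_at C i j (expo l).
Proof.
move=> ij li lj.
have := rk2_base_true (cartan_types ij) li lj; rewrite /rk2_base.
set L := (X in vanish _ X) => /(vanishP (fun t => expo (l - ('a_i *~ t.1 + 'a_j *~ t.2)))).
rewrite /L big_cat /= [X in _ + X]big_map.
under [X in _ + X]eq_bigr => t _ do rewrite /= rmorphN scaleNr.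
rewrite sumrN -!/(rk2_ev i j l _) -(dbL_word_ev false) -(dbL_word_ev true) => /eqP.
rewrite subr_eq0 /braid_at /rk2_ev big_seq1 /= scale1r !mulr0z addr0 subr0.
by move/eqP.
Qed.

Definition rk2_norm i j l : int := rk2_form (C i j) (C j i) (l 0 i) (l 0 j).

Lemma rk2_normC i j l : i != j -> rk2_norm i j l = rk2_norm j i l.
Proof.
move=> ij; rewrite /rk2_norm /rk2_form; move: (l 0 i) (l 0 j) => x y.
by have := cartan_rank2 CF ij; rewrite !inE => /or4P[|||/or3P[]] /eqP[-> ->] /=; ring.
Qed.

(* [braid_at] is a module over the s_i, s_j-invariants, stable under the operators;
   reflecting to a dominant weight and peeling off orbit sums leaves only the weights
   with l_i, l_j in {0, 1}, for which the relation is computed. *)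
Definition braid_below i j l :=
  forall mu, rk2_norm i j mu < rk2_norm i j l -> braid_at C i j (expo mu).

Lemma coord_sub_root i j l (t : int) : (l - 'a_i *~ t) 0 j = l 0 j - t * C i j.
Proof. by rewrite !(mxE, mulmxzE); move: (l 0 j) (C i j) => x y; ring. Qed.

(** pibar_i e^(s_i l) is e^l plus terms strictly inside the root string, which are shorter. *)
Lemma braid_at_neg i j l : i != j -> braid_below i j l -> l 0 i < 0 ->
  braid_at C i j (expo (act (s_ i) l)) -> braid_at C i j (expo l).
Proof.
move=> ij below; case El : (l 0 i) => [//|n] _ good.
set k := act (s_ i) l in good.
have ek : k = l - 'a_i *~ l 0 i by rewrite /k act_sref.
have ki : k 0 i = Posz n.+1.
  by rewrite ek coord_sub_root C2 El NegzE; lia.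
have -> : expo l = db i (expo k) - \sum_(t < n) expo (k - 'a_i *+ t.+1).
  rewrite dbLX /dbX ki big_ord_recr /= addrC addrK; congr expo.
  by rewrite ek El NegzE mulrNz opprK -pmulrn addrK.
apply: (subB (braid_at_subspace _ _ _ _)).
  by apply: braid_atC; apply: (braid_at_db CF) => //; rewrite 1?eq_sym //; apply: braid_atC.
apply: (sub_sum (braid_at_subspace _ _ _ _)) => t _; apply: below.
rewrite /rk2_norm pmulrn !coord_sub_root ki C2.
have := rk2_form_refl (cartan_types ij) (l 0 i) (l 0 j).
have -> : - l 0 i = Posz n.+1 by rewrite El NegzE opprK.
have <- : k 0 j = l 0 j - l 0 i * C i j by rewrite ek coord_sub_root.
move=> <-; have -> : Posz t.+1 * 2 = Posz t.+1 + Posz t.+1 by lia.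
by apply: (rk2_form_segment (cartan_types ij)); have := ltn_ord t; lia.
Qed.

Lemma braid_at_dom i j l : i != j -> braid_below i j l -> 2 <= l 0 i -> 0 <= l 0 j ->
  braid_at C i j (expo l).
Proof.
move=> ij below li lj; set p := C i j; set q := C j i; set m := coxeter_m C i j.
have [O [eO ltO]] := rk2_orbit_head (cartan_types ij).
pose wt (t : rk2_weight) := fundw i - ('a_i *~ t.1 + 'a_j *~ t.2).
pose orb : FL := \sum_(t <- rk2_orbit p q m) expo (wt t).
have ji : j != i by rewrite eq_sym.
have wti t : wt t 0 i = 1 - (t.1 + t.1) - t.2 * q.
  by rewrite /wt rk2_coord /fundw mxE !eqxx.
have wtj t : wt t 0 j = - (t.2 + t.2) - t.1 * p.
  by rewrite /wt [_ *~ _ + _]addrC rk2_coord /fundw mxE (negbTE ji) andbF sub0r.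
have inv_i : wact (s_ i) orb = orb.
  have P := rk2_orbit_refl1 (cartan_types ij); rewrite -/p -/q -/m in P.
  rewrite /orb; move: (rk2_orbit p q m) P => O' P.
  rewrite linear_sum -[RHS](perm_big _ P) big_map /=.
  apply: eq_bigr => t _; rewrite wactX act_sref wti /wt; congr expo.
  apply/rowP => u; rewrite !(mxE, mulmxzE) /= -/q.
  by move: (C i u) (C j u) (_%:R : int) => e1 e2 e3; ring.
have inv_j : wact (s_ j) orb = orb.
  have P := rk2_orbit_refl2 (cartan_types ij); rewrite -/p -/q -/m in P.
  rewrite /orb; move: (rk2_orbit p q m) P => O' P.
  rewrite linear_sum -[RHS](perm_big _ P) big_map /=.
  apply: eq_bigr => t _; rewrite wactX act_sref wtj /wt; congr expo.
  apply/rowP => u; rewrite !(mxE, mulmxzE) /= -/p.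
  by move: (C i u) (C j u) (_%:R : int) => e1 e2 e3; ring.
have e : lmul orb (expo (l - fundw i)) =
    expo l + \sum_(t <- O) expo (l - ('a_i *~ t.1 + 'a_j *~ t.2)).
  rewrite lmulC /orb eO linear_sum big_cons /= lmulXX {1}/wt !mulr0z addr0 subr0 subrK.
  by congr (_ + _); apply: eq_bigr => t _; rewrite lmulXX /wt addrA subrK.
rewrite -[expo l](addrK (\sum_(t <- O) expo (l - ('a_i *~ t.1 + 'a_j *~ t.2)))) -e.
apply: (subB (braid_at_subspace _ _ _ _)).
  apply: (braid_at_lmul CF) => //; apply: below; rewrite /rk2_norm.
  have -> : (l - fundw i) 0 i = l 0 i - 1 by rewrite !mxE !eqxx.
  have -> : (l - fundw i) 0 j = l 0 j by rewrite !mxE (negbTE ji) andbF subr0.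
  exact: (rk2_form_lower (cartan_types ij)).
apply: (sub_sum_seq (braid_at_subspace _ _ _ _)) => t tO _; apply: below.
rewrite /rk2_norm rk2_coord [_ *~ _ + _]addrC rk2_coord.
exact: ltO.
Qed.

Lemma braid_at_expo i j l : i != j -> braid_at C i j (expo l).
Proof.
move=> ij; have ji : j != i by rewrite eq_sym.
move: {2}(absz (rk2_norm i j l)) (leqnn (absz (rk2_norm i j l))) => n.
elim/ltn_ind: n l => n IHn l.
(* The outer induction is on the norm. A reflection keeps the norm, so an inner induction on the
   distance to rho handles weights outside the dominant chamber. *)
pose up (k : weight) : int := rk2_form (C i j) (C j i) (k 0 i - 1) (k 0 j - 1).
move: {2}(absz (up l)) (leqnn (absz (up l))) => u.
elim/ltn_ind: u l => u IHu l lu ln.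
have nn k : 0 <= rk2_norm i j k by apply: (rk2_form_ge0 (cartan_types ij)).
have uu k : 0 <= up k by apply: (rk2_form_ge0 (cartan_types ij)).
have below : braid_below i j l.
  move=> mu lt; apply: (IHn (absz (rk2_norm i j mu))) => //.
  by move: (nn mu) (nn l) ln lt; lia.
have below' : braid_below j i l.
  by move=> mu; rewrite -!(rk2_normC _ ij) => /below; exact: braid_atC.
have [li|li] := ltP (l 0 i) 0.
  apply: braid_at_neg => //; apply: (IHu (absz (up (act (s_ i) l)))) => //.
    have := rk2_form_up (cartan_types ij) (l 0 j) li.
    move: (uu l) (uu (act (s_ i) l)) lu; rewrite /up act_sref !coord_sub_root C2.
    have -> : l 0 i - l 0 i * 2 = - l 0 i by lia.
    by move: (rk2_form _ _ (- _ - 1) _) (rk2_form _ _ _ _) => A B; lia.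
  move: ln; rewrite /rk2_norm act_sref !coord_sub_root C2.
  have -> : l 0 i - l 0 i * 2 = - l 0 i by lia.
  by rewrite (rk2_form_refl (cartan_types ij)).
have [lj|lj] := ltP (l 0 j) 0.
  apply: braid_atC; apply: braid_at_neg => //; apply: braid_atC.
  apply: (IHu (absz (up (act (s_ j) l)))) => //.
    have := rk2_form_up (cartan_types ji) (l 0 i) lj.
    move: (uu l) (uu (act (s_ j) l)) lu; rewrite /up act_sref !coord_sub_root C2.
    have -> : l 0 j - l 0 j * 2 = - l 0 j by lia.
    have upC x y : rk2_form (C j i) (C i j) y x = rk2_form (C i j) (C j i) x y.
      rewrite /rk2_form.
      by have := cartan_rank2 CF ij; rewrite !inE => /or4P[|||/or3P[]] /eqP[-> ->] /=; ring.
    rewrite !upC.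
    by move: (rk2_form _ _ _ (- _ - 1)) (rk2_form _ _ _ _) => A B; lia.
  move: ln; rewrite !(rk2_normC _ ij) /rk2_norm act_sref !coord_sub_root C2.
  have -> : l 0 j - l 0 j * 2 = - l 0 j by lia.
  by rewrite (rk2_form_refl (cartan_types ji)).
have [li2|li2] := leP 2 (l 0 i); first exact: braid_at_dom.
have [lj2|lj2] := leP 2 (l 0 j); first by apply: braid_atC; apply: braid_at_dom.
by apply: braid_at_base => //; rewrite !inE;
  [move: (l 0 i) li li2 | move: (l 0 j) lj lj2] => -[[|[|]]|].
Qed.

Theorem dbL_braid i j f : i != j ->
  dbL_word (alt (coxeter_m C i j) i j) f = dbL_word (alt (coxeter_m C i j) j i) f.
Proof.
move=> ij; elim/freeg_lin_ind: f => [|c l f IH].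
  exact: (sub0 (braid_at_subspace C F i j)).
by apply: (braid_at_subspace C F i j).2 => //; apply: braid_at_expo.
Qed.

Theorem demL_braid i j f : i != j ->
  foldr (fun i => demL C i) f (alt (coxeter_m C i j) i j) = foldr (fun i => demL C i) f (alt (coxeter_m C i j) j i).
Proof.
move=> ij.
have e s : foldr (fun i => demL C i) f s = foldr (fun i z => db i z + z) f s.
  by elim: s => //= k s ->; rewrite demL_dbL.
rewrite !e; apply: (@shifted_braid _ _ _ (fun i => db i)) => [k z|z]; first exact: dbL_idem.
exact: dbL_braid.
Qed.

End DemazureBraidAll.

(** * Steinberg's triangularity *)

Section Dominance.
Variables (r : nat) (C : 'M[int]_r) (Ws : seq 'M[int]_r) (F : fieldType).
Hypothesis CF : cartan_finite C.
Hypothesis Ws_uniq : uniq Ws.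
Hypothesis WsP : forall w, w \in Ws <-> inW C w.
Let C2 := cartan_diag CF.
Local Notation weight := 'rV[int]_r.
Local Notation Wmat := 'M[int]_r.
Implicit Types (l k mu delta : weight) (u v w : Wmat) (i j : 'I_r) (D : {set 'I_r}).
Local Notation expo := (expo F).
Local Notation s_ := (sref C).
Local Notation "''a_' i" := (sroot C i) (at level 8, i at level 2, format "''a_' i").
Local Notation inW := (inW C).
Local Notation len := (lengthW C).
Local Notation wm := (wmat C).
Local Notation form := (form Ws).
Local Notation qn l := (form l l).
Local Notation db := (dbL C).
Local Notation dbL_word := (dbL_word C).

Lemma weight_fundw l : l = \sum_j fundw j *~ l 0 j.
Proof.
rewrite {1}(row_sum_delta l); apply: eq_bigr => j _.
by rewrite -scaler_int intz.
Qed.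

Lemma dom_fundw j : dom_wt (fundw j).
Proof. by move=> i; rewrite mxE; case: (_ && _). Qed.

Lemma dom_wtD l k : dom_wt l -> dom_wt k -> dom_wt (l + k).
Proof. by move=> dl dk i; rewrite mxE addr_ge0. Qed.

(** Along a reduced word each letter subtracts a nonnegative multiple of a simple root. *)
Lemma form_act_le delta mu w : dom_wt delta -> dom_wt mu -> inW w ->
  form delta (act w mu) <= form delta mu.
Proof.
move=> dd dm hw; have [s <- rs] := reduced_word hw.
elim: s rs => [|i s IH] rs; first by rewrite act1.
have rs' := reduced_cons rs; have h' := inW_wmat C s.
apply: le_trans (IH rs'); rewrite [wm _]/= act_mul act_sref formBr formMr.
rewrite gerBl mulr_ge0 ?(form_sroot_ge0 C2 Ws_uniq WsP) //.
apply: (coord_act_ge0 C2 Ws_uniq WsP) => //.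
case: (len_mull_cases CF i h') => -[] // _; have := rs; rewrite /is_reduced /= => <-.
by rewrite -rs' => e; exfalso; lia.
Qed.

(* l lies in the convex hull of the orbit W mu, mu dominant. *)
Definition below l mu := forall v, inW v -> forall j, form (fundw j) (act v l) <= form (fundw j) mu.

Lemma below_orbit mu w : dom_wt mu -> inW w -> below (act w mu) mu.
Proof.
move=> dm hw v hv j; rewrite -act_mul; apply: form_act_le => //; first exact: dom_fundw.
exact: inW_mul.
Qed.

Lemma below_act l mu w : inW w -> below l mu -> below (act w l) mu.
Proof. by move=> hw H v hv j; rewrite -act_mul; apply: H; apply: inW_mul. Qed.

Lemma belowD l l' mu mu' : below l mu -> below l' mu' -> below (l + l') (mu + mu').
Proof. by move=> H H' v hv j; rewrite actD !formDr lerD ?H ?H'. Qed.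

(** The weight lies between l and s_i l, and the defining inequalities are affine in [t]. *)
Lemma below_segment l mu i (t : int) : below l mu ->
  (0 <= t <= l 0 i) || (l 0 i <= t <= 0) -> below (l - 'a_i *~ t) mu.
Proof.
move=> H ht v hv j; rewrite actB actMz formBr formMr.
have h1 := H v hv j; have := H (wmul v (s_ i)) (inW_mulr i hv) j.
rewrite act_mul act_sref actB actMz formBr formMr.
move: h1 ht; set x := form _ (act v l); set y := form _ (act v 'a_i); set z := form _ mu.
move: x y z (l 0 i) => x y z k xz /orP[] /andP[t1 t2] yk; have [y0|/ltW y0] := leP 0 y.
- by have := mulr_ge0 y0 t1; lia.
- by have : 0 <= - y * (k - t); [by rewrite mulr_ge0 ?oppr_ge0 ?subr_ge0|lia].
- by have : 0 <= y * (t - k); [by rewrite mulr_ge0 ?subr_ge0|lia].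
- by have : 0 <= - y * - t; [by rewrite mulr_ge0 ?oppr_ge0|lia].
Qed.

Lemma qn_segment l i (t : int) :
  qn (l - 'a_i *~ t) = qn l - t * (l 0 i - t) * qn 'a_i.
Proof.
rewrite !(formBl, formBr, formMl, formMr) (formC _ 'a_i l).
have := form_sroot C2 Ws_uniq WsP l i.
set x := form l l; set y := form 'a_i 'a_i; set z := form l 'a_i.
move: x y z (l 0 i) => x y z k e. transitivity (x - t * (z * 2) + t * t * y); [ring | rewrite e; ring].
Qed.

Lemma dominant_rep l : exists2 w, inW w & dom_wt (act w l).
Proof.
pose rho : weight := const_mx 1.
(* Squared distance to rho, which drops when a negative coordinate is reflected. *)
pose N k := absz (qn (k - rho)).
have dr : dom_wt rho by move=> i; rewrite mxE.
move: {2}(N l) (leqnn (N l)) => n; elim/ltn_ind: n l => n IH l ln.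
case: (excluded_middle_informative (dom_wt l)) => [d|nd].
  by exists 1%:M; rewrite ?act1 //; apply: inW1.
have [i li] : exists i, l 0 i < 0.
  have : ~~ [forall i, 0 <= l 0 i] by apply/negP => /forallP.
  by rewrite negb_forall => /existsP[i]; rewrite -ltNge => li; exists i.
have [|w hw d] := IH (N (act (s_ i) l)) _ (act (s_ i) l) (leqnn _); last first.
  by exists (wmul w (s_ i)); [apply: inW_mulr | rewrite act_mul].
apply: leq_trans ln; rewrite /N act_sref.
have -> : l - 'a_i *~ l 0 i - rho = (l - rho) - 'a_i *~ l 0 i by rewrite addrAC.
rewrite qn_segment.
have -> : (l - rho) 0 i = l 0 i - 1 by rewrite !mxE.
have := form_ge0 Ws (l - rho - 'a_i *~ l 0 i); rewrite qn_segment.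
have -> : (l - rho) 0 i = l 0 i - 1 by rewrite !mxE.
have := form_ge0 Ws (l - rho); have := root_gt0 C2 WsP i.
by move: (form _ _) (form _ _) (l 0 i) li => x y z; nia.
Qed.

Lemma form_below_le l mu delta : below l mu -> dom_wt delta -> form delta l <= form delta mu.
Proof.
move=> H dd; rewrite (weight_fundw delta) !form_suml ler_sum // => j _.
rewrite !formMl ler_wpM2r //.
by have := H _ (inW1 C) j; rewrite act1.
Qed.

Lemma form_below_eq l mu : (forall j, form (fundw j) l = form (fundw j) mu) -> l = mu.
Proof.
move=> H; apply/eqP; rewrite -subr_eq0; apply/eqP; apply: (form_eq0 WsP).
set x := l - mu; rewrite {1}(weight_fundw x) form_suml big1 // => j _.
by rewrite formMl /x formBr H subrr mul0r.
Qed.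

(** For the dominant representative k of l, (k, k) <= (k, mu) <= (mu, mu). Equality throughout
    forces mu - k to have norm 0. *)
Lemma below_qn l mu : dom_wt mu -> below l mu ->
  qn l <= qn mu /\ (qn l = qn mu -> exists2 v, inW v & l = act v mu).
Proof.
move=> dm H; have [w hw d] := dominant_rep l.
have Hw := below_act hw H.
have e : qn (act w l) = qn l by apply: (form_act C2 Ws_uniq WsP).
have h1 := form_below_le Hw d; have h2 := form_below_le Hw dm.
rewrite -e; split.
  by apply: le_trans h1 _; rewrite formC.
move=> e1; exists (invmx w); first exact: (inW_inv C2).
suff -> : mu = act w l by rewrite (actK C2).
apply/eqP; rewrite -subr_eq0; apply/eqP; apply: (form_eq0 WsP).
move: h1 h2 e1; rewrite !(formBl, formBr) (formC _ (act w l) mu).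
by move: (form _ _) (form _ _) (form _ _) => x y z; lia.
Qed.

(** After applying v^-1 the inequalities for the two summands add up to equalities, so each of them
    is an equality. *)
Lemma below_split l l' mu mu' v : inW v -> below l mu -> below l' mu' ->
  l + l' = act v (mu + mu') -> l = act v mu /\ l' = act v mu'.
Proof.
move=> hv H H' e; have hi := inW_inv C2 hv.
have e' : act (invmx v) l + act (invmx v) l' = mu + mu' by rewrite -actD e (actK C2).
suff [e1 e2] : act (invmx v) l = mu /\ act (invmx v) l' = mu'.
  by rewrite -e1 -e2 !(actVK C2).
suff e1 : act (invmx v) l = mu by move: e'; rewrite e1 => /addrI.
apply: form_below_eq => j; have := H _ hi j; have := H' _ hi j.
have := congr1 (form (fundw j)) e'; rewrite !formDr.
by move: (form _ (act _ l)) (form _ (act _ l')) (form _ mu) (form _ mu') => x y z t; lia.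
Qed.

Definition strictly_below mu l := below l mu /\ qn l < qn mu.

Lemma supp_db_strictly_below mu i l : strictly_below mu l -> supp_in (strictly_below mu) (db i (expo l)).
Proof.
move=> [H lt].
have seg (t : int) : (0 <= t <= l 0 i) || (l 0 i <= t <= 0) -> strictly_below mu (l - 'a_i *~ t).
  move=> ht; split; first exact: below_segment.
  apply: le_lt_trans lt; rewrite qn_segment gerBl mulr_ge0 ?form_ge0 //.
  by move: (l 0 i) ht => k; nia.
rewrite dbLX /dbX; case El : (l 0 i) => [n|n].
  apply: (sub_sum (supp_in_subspace _ _)) => t _; apply: supp_in1.
  by rewrite pmulrn; apply: seg => //; rewrite El; have := ltn_ord t; lia.
apply: (subN (supp_in_subspace _ _)); apply: (sub_sum (supp_in_subspace _ _)) => t _; apply: supp_in1.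
rewrite pmulrn -[_ *~ _]opprK -mulrNz; apply: seg => //.
by rewrite El NegzE; have := ltn_ord t; lia.
Qed.

Definition min_coset mu w := forall v, inW v -> act v mu = act w mu -> (len w <= len v)%N.

(** At each letter the extremal weight has a positive coordinate: nonnegative as the word is
    reduced, nonzero as the coset representative is minimal. So pibar_i yields the other end of the
    root string with coefficient 1, plus shorter interior terms. *)
Lemma dbL_word_extremal s mu : is_reduced C s -> dom_wt mu -> min_coset mu (wm s) ->
  exists2 h, supp_in (strictly_below mu) h & dbL_word s (expo mu) = expo (act (wm s) mu) + h.
Proof.
move=> + dm; elim: s => [|i s IH] rs ms.
  by exists 0; [exact: (sub0 (supp_in_subspace _ _)) | rewrite act1 addr0].
have rs' := reduced_cons rs; have h' := inW_wmat C s.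
have es : wm (i :: s) = wmul (s_ i) (wm s) by [].
have ms' : min_coset mu (wm s).
  move=> v hv e; rewrite -rs' -ltnS -[(size s).+1]/(size (i :: s)) rs.
  apply: leq_trans (len_mull i hv); apply: ms; first exact: inW_mull.
  by rewrite es !act_mul e.
have [h sh eh] := IH rs' ms'; set x := act (wm s) mu in eh.
have bx : below x mu by apply: below_orbit.
have qx : qn x = qn mu by apply: (form_act C2 Ws_uniq WsP).
have x0 : 0 <= x 0 i.
  apply: (coord_act_ge0 C2 Ws_uniq WsP) => //.
  case: (len_mull_cases CF i h') => -[] // _; rewrite -es -rs -rs' /= => e; exfalso; lia.
have xn0 : x 0 i != 0.
  apply/eqP => e; have := ms _ h'; rewrite es act_mul act_sref -/x e mulr0z subr0.
  by move=> /(_ erefl); rewrite -es -rs -rs' /= ltnn.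
case Ex : (x 0 i) x0 xn0 => [[|n]|n] // _ _.
exists (\sum_(t < n) expo (x - 'a_i *+ t.+1) + db i h).
  apply: (subD (supp_in_subspace _ _)).
    apply: (sub_sum (supp_in_subspace _ _)) => t _; apply: supp_in1; split.
      by rewrite pmulrn; apply: below_segment => //; rewrite Ex; have := ltn_ord t; lia.
    rewrite pmulrn qn_segment qx ltrBlDr ltrDl mulr_gt0 ?(root_gt0 C2 WsP) // Ex.
    by have := ltn_ord t; nia.
  by apply: supp_in_lift => k /sh; rewrite -dbLX; apply: supp_db_strictly_below.
rewrite [dbL_word _ _]/= -/(dbL_word s _) eh linearD /= addrA; congr (_ + _).
rewrite dbLX /dbX Ex big_ord_recr /= addrC; congr (expo _ + _).
by rewrite act_mul -/x act_sref Ex -pmulrn.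
Qed.

End Dominance.

(** * Unitriangular families in a free module *)

Section Unitriangular.
Variables (K : choiceType) (F : fieldType) (B : K -> {freeg K / F}) (meas : K -> nat).
Hypothesis B_diag : forall k, coeff k (B k) = 1.
Hypothesis B_lower : forall k k', coeff k' (B k) != 0 -> k' != k -> (meas k' < meas k)%N.

(** At an index of maximal measure in the support of [g], no other member of the family
    contributes. *)
Lemma unitriangular_inj g : fglift B g = 0 -> g = 0.
Proof.
move=> e; apply/eqP; rewrite -dom_eq0; apply/eqP; case Ed : (dom g) => [//|k0 s].
have kd0 : k0 \in dom g by rewrite Ed mem_head.
have [k kd kmax] : exists2 k, k \in dom g & forall k', k' \in dom g -> (meas k' <= meas k)%N.
  rewrite Ed; elim: s k0 {Ed kd0} => [|k1 s IH] k0.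
    by exists k0; rewrite ?mem_head // => k'; rewrite inE => /eqP->.
  have [k kd kmax] := IH k1; have [le|lt] := leqP (meas k0) (meas k).
    exists k; first by rewrite inE kd orbT.
    by move=> k'; rewrite inE => /orP[/eqP->//|/kmax].
  exists k0; first exact: mem_head.
  move=> k'; rewrite inE => /orP[/eqP->//|/kmax le]; exact: leq_trans le (ltnW lt).
have := congr1 (coeff k) e; rewrite fgliftE raddf_sum coeff0 /= (bigD1_seq k) ?uniq_dom //=.
rewrite coeffZ B_diag mulr1 big1_seq ?addr0; first by move/eqP; move: kd; rewrite mem_dom => /negPf->.
move=> k' /andP[k'k k'd]; rewrite coeffZ.
have -> : coeff k (B k') = 0; last by rewrite mulr0.
apply/eqP/negPn/negP => /B_lower; rewrite eq_sym => /(_ k'k); rewrite ltnNge.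
by rewrite kmax.
Qed.

Lemma unitriangular_surj f : exists g, f = fglift B g.
Proof.
pose P (f : {freeg K / F}) := exists g, f = fglift B g.
have SP : subspace P.
  split=> [|c u v [g ->] [h ->]]; first by exists 0; rewrite linear0.
  by exists (c *: g + h); rewrite linearP.
have Pk k : P << k >>.
  move: {2}(meas k) (leqnn (meas k)) => n; elim/ltn_ind: n k => n IH k kn.
  have -> : << k >> = B k - \sum_(k' <- dom (B k) | k' != k) coeff k' (B k) *: << k' >>.
    rewrite [X in X - _]freeg_expand (bigD1_seq k) ?uniq_dom ?mem_dom ?B_diag ?oner_neq0 //=.
    by rewrite scale1r addrK.
  apply: (subB SP); first by exists << k >>; rewrite fglift1.
  apply: (sub_sum_seq SP) => k' k'd k'k; apply: (subZ SP); apply: (IH (meas k')) => //.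
  by apply: leq_trans kn; apply: B_lower => //; rewrite -mem_dom.
rewrite [f]freeg_expand; apply: (sub_sum SP) => k _; exact: (subZ SP).
Qed.
End Unitriangular.

(** * Orbit sums, leading terms and Steinberg's basis *)

Section LeadingTerms.
Variables (r : nat) (C : 'M[int]_r) (Ws : seq 'M[int]_r) (F : fieldType).
Hypothesis CF : cartan_finite C.
Hypothesis Ws_uniq : uniq Ws.
Hypothesis WsP : forall w, w \in Ws <-> inW C w.
Let C2 := cartan_diag CF.
Local Notation FL := (FL r F).
Local Notation weight := 'rV[int]_r.
Local Notation Wmat := 'M[int]_r.
Implicit Types (f g h : FL) (l k mu : weight) (u v w : Wmat) (i j : 'I_r) (D : {set 'I_r}).
Local Notation expo := (expo F).
Local Notation inW := (inW C).
Local Notation len := (lengthW C).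
Local Notation wm := (wmat C).
Local Notation form := (form Ws).
Local Notation qn l := (form l l).
Local Notation desc := (descents C).
Local Notation dbL_word := (dbL_word C).
Local Notation below := (below C Ws).
Local Notation inv_ i := (ainv F Ws i).

Definition orbit_fundw i := undup [seq act w (fundw i) | w <- Ws].

Lemma mem_orbit_fundw i l : reflect (exists2 w, inW w & l = act w (fundw i)) (l \in orbit_fundw i).
Proof.
rewrite mem_undup; apply: (iffP mapP) => -[w hw ->]; exists w => //; exact/WsP.
Qed.

Lemma wact_ainv v i : inW v -> wact v (inv_ i) = inv_ i.
Proof.
move=> hv; rewrite /ainv linear_sum /=.
rewrite (eq_bigr (fun l => expo (act v l))) => [|l _]; last exact: wactX.
rewrite -(big_map (act v) xpredT expo) -/(orbit_fundw i); apply: perm_big.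
have inj : injective (act v : weight -> weight) by move=> x y; apply: (act_inj C2 hv).
apply: uniq_perm; rewrite ?map_inj_uniq ?undup_uniq // => l.
apply/mapP/mem_orbit_fundw => [[k /mem_orbit_fundw[w hw ->] ->]|[w hw ->]].
  by exists (wmul v w); [apply: inW_mul | rewrite act_mul].
exists (act (wmul (invmx v) w) (fundw i)); last by rewrite -act_mul (wmulVKV C2).
by apply/mem_orbit_fundw; exists (wmul (invmx v) w) => //; apply: inW_mul => //; apply: (inW_inv C2).
Qed.

Lemma coeff_ainv_mul i f l :
  coeff l (lmul (inv_ i) f) = \sum_(m <- orbit_fundw i) coeff (l - m) f.
Proof.
rewrite /ainv lmul_suml raddf_sum; apply: eq_bigr => m _ /=.
exact: coeff_lmulX.
Qed.

(* The terms of f in the orbit W mu are of the form e^(v mu) with v in w W_J, where W_J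
   is the stabilizer of lambda_D; they include e^(w mu), with coefficient 1. *)
Definition leads f mu w D :=
  [/\ supp_in (below^~ mu) f,
      forall l v, coeff l f != 0 -> inW v -> l = act v mu -> act v (lamset D) = act w (lamset D) &
      coeff (act w mu) f = 1].

(** By [below_split], an extremal weight of the product splits into extremal weights of the factors
    for the same group element, and in only one way. *)
Lemma leads_ainv f mu w D i : dom_wt mu -> inW w -> leads f mu w D ->
  leads (lmul (inv_ i) f) (mu + fundw i) w D.
Proof.
move=> dm hw [sf ef cf].
have bO m : m \in orbit_fundw i -> below m (fundw i).
  by move/mem_orbit_fundw => [v hv ->]; apply: (below_orbit CF Ws_uniq WsP) => //; apply: dom_fundw.
have ex l : coeff l (lmul (inv_ i) f) != 0 -> exists2 m, m \in orbit_fundw i & coeff (l - m) f != 0.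
  rewrite coeff_ainv_mul => H; apply/hasP; apply: contraNT H => /hasPn H.
  by rewrite big1_seq // => m /andP[_ /H]; rewrite negbK => /eqP.
split.
- move=> l /ex[m mO cm]; rewrite -(subrK m l); apply: belowD; first exact: sf.
  exact: bO.
- move=> l v /ex[m mO cm] hv e; apply: (ef (l - m)) => //.
  by case: (below_split CF Ws_uniq WsP hv (sf _ cm) (bO _ mO)); rewrite ?subrK.
rewrite coeff_ainv_mul (bigD1_seq (act w (fundw i))) ?undup_uniq //=; last first.
  by apply/mem_orbit_fundw; exists w.
rewrite actD addrK cf big1_seq ?addr0 // => m /andP[mn mO].
apply/eqP/negPn/negP => cm.
have [] := below_split CF Ws_uniq WsP hw (sf _ cm) (bO _ mO); first by rewrite subrK actD.
by move=> _ em; rewrite em eqxx in mn.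
Qed.

Definition inv_monomial (s : seq 'I_r) (n : 'I_r -> nat) f : FL :=
  foldr (fun j f => iter (n j) (lmul (inv_ j)) f) f s.

Lemma lmul_iter a j n f : lmul a (iter n (lmul (inv_ j)) f) = iter n (lmul (inv_ j)) (lmul a f).
Proof. by elim: n => //= n IH; rewrite lmulCA IH. Qed.

Lemma inv_monomial_incr s n n' i f : uniq s -> i \in s ->
  n' i = (n i).+1 -> (forall j, j != i -> n' j = n j) ->
  inv_monomial s n' f = lmul (inv_ i) (inv_monomial s n f).
Proof.
move=> + + ei ej.
have notin t : i \notin t -> inv_monomial t n' f = inv_monomial t n f.
  elim: t => //= j t IH; rewrite inE negb_or => /andP[ij /IH ->].
  by rewrite ej // eq_sym.
elim: s => //= j s IH /andP[js us]; rewrite inE => /orP[/eqP eij|is_].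
  by subst j; rewrite ei notin.
rewrite IH // ej ?lmul_iter //; by apply: contraNneq js => ->.
Qed.

Lemma leads_inv_monomial s n f mu w D : dom_wt mu -> inW w -> leads f mu w D ->
  dom_wt (mu + \sum_(j <- s) fundw j *+ n j) /\
  leads (inv_monomial s n f) (mu + \sum_(j <- s) fundw j *+ n j) w D.
Proof.
move=> dm hw; elim: s => [|j s IH] H /=; first by rewrite big_nil addr0.
have [d L] := IH H; rewrite big_cons addrCA addrC.
elim: (n j) => [|m [d' L']] /=; first by rewrite mulr0n addr0.
rewrite mulrSr addrA; split; last exact: leads_ainv.
by apply: dom_wtD => //; apply: dom_fundw.
Qed.

Definition descent_atom w : FL := dbL_word (redword C w) (expo (lamset (desc w))).

Lemma min_coset_desc w mu : inW w -> dom_wt mu ->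
  (forall j, mu 0 j = 0 -> j \notin desc w) -> min_coset C mu w.
Proof. by move=> hw dm H v hv e; case: (min_coset_len CF Ws_uniq WsP hv hw dm e H). Qed.

Lemma leads_descent_atom w : inW w -> leads (descent_atom w) (lamset (desc w)) w (desc w).
Proof.
move=> hw; set D := desc w; have dD := @dom_lamset r D.
have [e sz] := redword_spec hw.
have mc : min_coset C (lamset D) (wm (redword C w)).
  by rewrite e; apply: min_coset_desc => // j /lamset_eq0.
have [h sh] := dbL_word_extremal F CF Ws_uniq WsP (reduced_redword hw) dD mc.
rewrite -/(descent_atom w) e => ->.
have nh v : inW v -> coeff (act v (lamset D)) h = 0.
  move=> hv; apply: (coeff_supp_in sh) => -[_].
  by rewrite (form_act C2 Ws_uniq WsP) // ltxx.
split.
- apply: (subD (supp_in_subspace _ _)).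
    by apply: supp_in1; apply: (below_orbit CF Ws_uniq WsP).
  by apply: supp_inW sh => k [].
- move=> l v + hv el; rewrite {l}el coeffD coeff1 nh // addr0.
  by case: (act w _ =P act v _) => [->|_] //; rewrite eqxx.
by rewrite coeffD coeff1 nh // addr0 eqxx.
Qed.

(* Every weight is w mu for a unique dominant mu and w of minimal length. *)
Definition nf_spec l w := [/\ inW w, dom_wt (act (invmx w) l) &
  forall v, inW v -> dom_wt (act (invmx v) l) -> (len w <= len v)%N].
Definition nf_elt l : Wmat := epsilon (inhabits 1%:M) (nf_spec l).
Definition nf_dom l : weight := act (invmx (nf_elt l)) l.

Lemma nf_elt_spec l : nf_spec l (nf_elt l).
Proof.
apply: (epsilon_spec (inhabits 1%:M) (nf_spec l)).
have [w hw d] := dominant_rep CF Ws_uniq WsP l.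
have {hw d} : exists2 w, inW w & dom_wt (act (invmx w) l).
  by exists (invmx w); [apply: (inW_inv C2) | rewrite invmxK].
clear w; case=> w; move: {2}(len w) (leqnn (len w)) => n.
elim: n w => [|n IH] w ln hw d.
  by exists w; split=> // v hv _; move: ln; rewrite leqn0 => /eqP->.
case: (excluded_middle_informative (exists2 v, inW v /\ dom_wt (act (invmx v) l) & (len v < len w)%N)).
  by move=> [v [hv dv] lt]; apply: (IH v) => //; rewrite -ltnS; apply: leq_trans lt ln.
move=> ne; exists w; split=> // v hv dv; rewrite leqNgt; apply/negP => lt; apply: ne.
by exists v.
Qed.

Lemma nf_elt_inW l : inW (nf_elt l). Proof. by case: (nf_elt_spec l). Qed.
Lemma nf_dom_dominant l : dom_wt (nf_dom l). Proof. by case: (nf_elt_spec l). Qed.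
Lemma act_nf l : act (nf_elt l) (nf_dom l) = l.
Proof. by rewrite /nf_dom (actVK C2) //; apply: nf_elt_inW. Qed.

Lemma nf_elt_descents l j : nf_dom l 0 j = 0 -> j \notin desc (nf_elt l).
Proof.
have [hw d m] := nf_elt_spec l => e; rewrite inE -leqNgt.
apply: m; first exact: inW_mulr.
rewrite (invmx_wmul C2) // ?(invmx_sref C2) ?act_mul; last exact: inW_sref.
by rewrite -/(nf_dom l) act_sref e mulr0z subr0.
Qed.

Lemma nf_uniq l w mu : inW w -> dom_wt mu -> (forall j, mu 0 j = 0 -> j \notin desc w) ->
  l = act w mu -> nf_elt l = w /\ nf_dom l = mu.
Proof.
move=> hw dm H e.
have em : nf_dom l = mu.
  by apply: (dom_wt_uniq CF Ws_uniq WsP (nf_elt_inW l) hw (nf_dom_dominant l) dm); rewrite act_nf.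
split=> //; have e2 : act (nf_elt l) mu = act w mu by rewrite -em act_nf em.
have [le eq] := min_coset_len CF Ws_uniq WsP (nf_elt_inW l) hw dm e2 H.
apply: eq; apply/eqP; rewrite eqn_leq le andbT.
have [_ _ ->] := nf_elt_spec l => //; by rewrite e (actK C2).
Qed.

Definition nf_exp l j : nat := absz (nf_dom l 0 j - (j \in desc (nf_elt l))%:R)%R.
(* The product of the a_j, to the powers mu_j - [j in D(w)], with pibar_w e^(lambda_D(w)):
   its leading term is e^(w mu). *)
Definition steinberg l : FL := inv_monomial (enum 'I_r) (nf_exp l) (descent_atom (nf_elt l)).

(** [absz] loses nothing: where the dominant coordinate vanishes, minimality of [nf_elt l] excludes
    the descent. *)
Lemma nf_expE l j : (nf_exp l j)%:Z = nf_dom l 0 j - (j \in desc (nf_elt l))%:R.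
Proof.
rewrite /nf_exp gez0_abs // subr_ge0; have := nf_dom_dominant l j; rewrite le_eqVlt.
case/orP => [/eqP/esym e|lt]; first by rewrite (negbTE (nf_elt_descents e)) e.
by case: (_ \in _) => //; exact: ltW.
Qed.

Lemma nf_dom_expand l : nf_dom l = lamset (desc (nf_elt l)) + \sum_(j <- enum 'I_r) fundw j *+ nf_exp l j.
Proof.
have -> : \sum_(j <- enum 'I_r) fundw j *+ nf_exp l j = nf_dom l - lamset (desc (nf_elt l)).
  rewrite big_enum_cond /= (weight_fundw (nf_dom l - _)); apply: eq_bigr => j _.
  by rewrite pmulrn nf_expE !mxE lamsetE.
by rewrite addrC subrK.
Qed.

Lemma leads_steinberg l : leads (steinberg l) (nf_dom l) (nf_elt l) (desc (nf_elt l)).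
Proof.
rewrite [X in leads _ X]nf_dom_expand /steinberg.
by have [] := leads_inv_monomial (enum 'I_r) (nf_exp l) (@dom_lamset r _) (nf_elt_inW l) (leads_descent_atom (nf_elt_inW l)).
Qed.

Lemma coeff_steinberg_diag l : coeff l (steinberg l) = 1.
Proof. by have [_ _] := leads_steinberg l; rewrite act_nf. Qed.

Lemma qn_nf_dom l : qn (nf_dom l) = qn l.
Proof. by rewrite -[in RHS](act_nf l) (form_act C2 Ws_uniq WsP) //; apply: nf_elt_inW. Qed.

(** At equal norm k lies in the orbit of l, and by [leads] its element lies in the coset w W_J,
    where w = [nf_elt l] is the unique shortest one. *)
Lemma coeff_steinberg_lower l k : coeff k (steinberg l) != 0 -> k != l ->
  (qn k < qn l) \/ (qn k = qn l /\ (len (nf_elt l) < len (nf_elt k))%N).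
Proof.
have [s e c] := leads_steinberg l => ck kl.
have [le eq] := below_qn CF Ws_uniq WsP (nf_dom_dominant l) (s _ ck).
move: le; rewrite le_eqVlt => /orP[/eqP eqq|]; last by rewrite qn_nf_dom; left.
right; rewrite eqq qn_nf_dom; split=> //.
have [v hv ek] := eq eqq.
have em : nf_dom k = nf_dom l.
  apply: (dom_wt_uniq CF Ws_uniq WsP (nf_elt_inW k) hv (nf_dom_dominant k) (nf_dom_dominant l)).
  by rewrite act_nf.
have e1 := e k (nf_elt k) ck (nf_elt_inW k); rewrite -em act_nf in e1.
have H j : lamset (desc (nf_elt l)) 0 j = 0 -> j \notin desc (nf_elt l) by move/lamset_eq0.
have [le2 eq2] := min_coset_len CF Ws_uniq WsP (nf_elt_inW k) (nf_elt_inW l) (@dom_lamset r _) (e1 erefl) H.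
rewrite ltn_neqAle le2 andbT; apply: contraNneq kl => /esym /eq2 ew.
by rewrite -(act_nf k) -(act_nf l) ew em.
Qed.

Lemma steinberg_basis : (forall g, fglift steinberg g = 0 -> g = 0) /\ (forall f, exists g, f = fglift steinberg g).
Proof.
have [N HN] := len_bounded WsP.
(* Lexicographic order on norm and length in one number. Longer elements count as lower, so the
   length is subtracted from its bound [N]. *)
pose meas l := (absz (qn l) * N.+1 + (N - len (nf_elt l)))%N.
have lower k k' : coeff k' (steinberg k) != 0 -> k' != k -> (meas k' < meas k)%N.
  move=> ck kk; have h1 := form_ge0 Ws k; have h2 := form_ge0 Ws k'.
  have n1 := HN _ (nf_elt_inW k); have n2 := HN _ (nf_elt_inW k'); rewrite /meas.
  case: (coeff_steinberg_lower ck kk) => [lt|[-> lt]]; last by rewrite ltn_add2l; lia.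
  have : (absz (qn k') < absz (qn k))%N.
    by move: (form _ _) (form _ _) h1 h2 lt => x y; lia.
  move: (absz _) (absz _) => x y xy; nia.
split; first exact: (unitriangular_inj coeff_steinberg_diag lower).
exact: (unitriangular_surj coeff_steinberg_diag lower).
Qed.

End LeadingTerms.

(** * The ideal of the orbit sums in Steinberg's basis *)

Section BasisModuloInvariants.
Variables (r : nat) (C : 'M[int]_r) (Ws : seq 'M[int]_r) (F : fieldType).
Hypothesis CF : cartan_finite C.
Hypothesis Ws_uniq : uniq Ws.
Hypothesis WsP : forall w, w \in Ws <-> inW C w.
Let C2 := cartan_diag CF.
Local Notation FL := (FL r F).
Local Notation weight := 'rV[int]_r.
Local Notation Wmat := 'M[int]_r.
Implicit Types (f g h : FL) (l k mu : weight) (u v w : Wmat) (i j : 'I_r) (D : {set 'I_r}).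
Local Notation expo := (expo F).
Local Notation inW := (inW C).
Local Notation desc := (descents C).
Local Notation inv_ i := (ainv F Ws i).
Local Notation nf_elt := (nf_elt C).
Local Notation nf_dom := (nf_dom C).
Local Notation nf_exp := (nf_exp C).
Local Notation steinberg := (steinberg C Ws F).
Local Notation descent_atom := (descent_atom C F).
Local Notation inI := (@inI r F Ws).

Definition nf_shift i l := act (nf_elt l) (nf_dom l + fundw i).

(** The zeros of mu + lambda_i are zeros of mu, so the same w stays minimal. Hence multiplication by
    a_i maps basis elements to basis elements. *)
Lemma shift_nf i l : nf_elt (nf_shift i l) = nf_elt l /\ nf_dom (nf_shift i l) = nf_dom l + fundw i.
Proof.
have d := nf_dom_dominant CF Ws_uniq WsP l; have hw := nf_elt_inW CF Ws_uniq WsP l.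
apply: (nf_uniq CF Ws_uniq WsP) => // [|j].
  by apply: dom_wtD => //; apply: dom_fundw.
rewrite mxE => e; apply: (nf_elt_descents CF Ws_uniq WsP); move: e (d j) (dom_fundw i j).
by move: (nf_dom l 0 j) (fundw i 0 j) => x y; lia.
Qed.

Lemma nf_exp_shift i l j : nf_exp (nf_shift i l) j = (nf_exp l j + (j == i))%N.
Proof.
apply/eqP; rewrite -eqz_nat PoszD (nf_expE CF Ws_uniq WsP (nf_shift i l)) (nf_expE CF Ws_uniq WsP l).
have [-> ->] := shift_nf i l; rewrite !mxE /= addrAC; apply/eqP; congr (_ + _).
by case: (j == i).
Qed.

Lemma lmul_steinberg i l : lmul (inv_ i) (steinberg l) = steinberg (nf_shift i l).
Proof.
have -> : steinberg (nf_shift i l) = inv_monomial Ws (enum 'I_r) (nf_exp (nf_shift i l)) (descent_atom (nf_elt l)) :=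
  congr1 (fun w => inv_monomial Ws (enum 'I_r) (nf_exp (nf_shift i l)) (descent_atom w)) (shift_nf i l).1.
symmetry; apply: (@inv_monomial_incr _ Ws F _ (nf_exp l) (nf_exp (nf_shift i l)) i); rewrite ?enum_uniq ?mem_enum //.
  by rewrite nf_exp_shift eqxx addn1.
by move=> j ji; rewrite nf_exp_shift (negbTE ji) addn0.
Qed.

Lemma inI_subspace : subspace inI.
Proof.
split=> [|c f g [h ->] [k ->]].
  by exists (fun=> 0); rewrite big1 // => i _; rewrite lmul0l.
exists (fun i => c *: h i + k i); rewrite scaler_sumr -big_split /=.
by apply: eq_bigr => i _; rewrite lmulDl lmulZl.
Qed.

Lemma inI_lmul i f : inI (lmul f (inv_ i)).
Proof.
exists (fun j => if j == i then f else 0); rewrite (bigD1 i) //= eqxx big1 ?addr0 //.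
by move=> j /negbTE ->; rewrite lmul0l.
Qed.

Lemma inI_dbL i f : inI f -> inI (dbL C i f).
Proof.
move=> [h ->]; rewrite linear_sum; apply: (sub_sum inI_subspace) => j _ /=.
rewrite lmulC (dbL_lmul C2); first by rewrite lmulC; apply: inI_lmul.
by apply: (wact_ainv F CF WsP); apply: inW_sref.
Qed.

Definition nf_shifted l := exists j, nf_exp l j != 0%N.

(** Expand each cofactor in Steinberg's basis: multiplying by a_i raises the i-th exponent, so every
    resulting basis element has a nonzero exponent. *)
Lemma inI_supp f : inI f -> exists2 g, supp_in nf_shifted g & f = fglift steinberg g.
Proof.
move=> [h ->].
pose P f := exists2 g, supp_in nf_shifted g & f = fglift steinberg g.
have SP : subspace P.
  split=> [|c u v [g sg ->] [k sk ->]].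
    by exists 0; [exact: (sub0 (supp_in_subspace _ _)) | rewrite linear0].
  exists (c *: g + k); last by rewrite linearP.
  exact: (supp_in_subspace F nf_shifted).2.
apply: (sub_sum SP) => i _.
have [g ->] := (steinberg_basis F CF Ws_uniq WsP).2 (h i).
rewrite lmulC fgliftE linear_sum; apply: (sub_sum SP) => l _.
rewrite linearZ /= lmul_steinberg; apply: (subZ SP); exists (expo (nf_shift i l)); last by rewrite fglift1.
by apply: supp_in1; exists i; rewrite nf_exp_shift eqxx addn1.
Qed.

Lemma inI_steinberg l : nf_shifted l -> inI (steinberg l).
Proof.
move=> [j nj]; rewrite /steinberg.
rewrite (@inv_monomial_incr _ _ _ _ (fun a : 'I_r => if a == j then (nf_exp l j).-1 else nf_exp l a) _ j) ?enum_uniq ?mem_enum //.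
- by rewrite lmulC; apply: inI_lmul.
- by rewrite eqxx prednK // lt0n.
- by move=> k /negbTE ->.
Qed.

Lemma nf_exp_eq0 l : ~ nf_shifted l -> (forall j, nf_exp l j = 0%N).
Proof. by move=> H j; apply/eqP/negPn/negP => nj; apply: H; exists j. Qed.

Lemma steinberg_descent_atom l : ~ nf_shifted l -> steinberg l = descent_atom (nf_elt l).
Proof.
move=> /nf_exp_eq0 H; rewrite /steinberg.
by elim: (enum 'I_r) => //= j s IH; rewrite H.
Qed.

Lemma descent_atom_steinberg w : inW w -> steinberg (act w (lamset (desc w))) = descent_atom w
  /\ ~ nf_shifted (act w (lamset (desc w))).
Proof.
move=> hw; set l := act w _.
have [|e1 e2] := nf_uniq CF Ws_uniq WsP hw (@dom_lamset r (desc w)) _ (erefl l).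
  by move=> j /lamset_eq0.
have ns : ~ nf_shifted l.
  move=> [j]; rewrite -lt0n -ltz_nat (nf_expE CF Ws_uniq WsP) e1 e2 lamsetE subrr ltxx //.
by split; [rewrite (steinberg_descent_atom ns) e1 | exact: ns].
Qed.

Lemma descent_atom_span f : exists c : Wmat -> F, inI (f - \sum_(w <- Ws) c w *: descent_atom w).
Proof.
pose P f := exists c : Wmat -> F, inI (f - \sum_(w <- Ws) c w *: descent_atom w).
have SP : subspace P.
  split=> [|a u v [c cu] [d dv]].
    exists (fun=> 0); rewrite big1 ?subr0; first exact: (sub0 inI_subspace).
    by move=> w _; rewrite scale0r.
  exists (fun w => a * c w + d w).
  have -> : a *: u + v - \sum_(w <- Ws) (a * c w + d w) *: descent_atom w =
     a *: (u - \sum_(w <- Ws) c w *: descent_atom w) + (v - \sum_(w <- Ws) d w *: descent_atom w).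
    rewrite scalerBr scaler_sumr addrACA -opprD -big_split /=; congr (_ - _).
    by apply: eq_bigr => w _; rewrite scalerDl scalerA.
  exact: inI_subspace.2.
have [g ->] := (steinberg_basis F CF Ws_uniq WsP).2 f.
rewrite fgliftE; apply: (sub_sum SP) => l _; apply: (subZ SP).
case: (excluded_middle_informative (nf_shifted l)) => [/inI_steinberg sl|/steinberg_descent_atom ->].
  exists (fun=> 0); rewrite big1 ?subr0 // => w _; by rewrite scale0r.
exists (fun w => (w == nf_elt l)%:R).
have wW : nf_elt l \in Ws by apply/WsP; apply: (nf_elt_inW CF Ws_uniq WsP).
rewrite (bigD1_seq (nf_elt l)) //= eqxx scale1r big1 ?addr0 ?subrr; first exact: (sub0 inI_subspace).
by move=> w /negbTE ->; rewrite scale0r.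
Qed.

(** The atoms are the basis elements with all exponents zero, where elements of the ideal have no
    coordinates. *)
Lemma descent_atom_free (c : Wmat -> F) : inI (\sum_(w <- Ws) c w *: descent_atom w) ->
  forall w, w \in Ws -> c w = 0.
Proof.
move=> /inI_supp[g sg e] w wW; have hw := (WsP w).1 wW.
pose lead w := act w (lamset (desc w)).
pose g' : FL := \sum_(w <- Ws) c w *: expo (lead w).
have eg : g = g'.
  apply/eqP; rewrite -subr_eq0; apply/eqP; apply: (steinberg_basis F CF Ws_uniq WsP).1.
  rewrite linearB /= -e /g' linear_sum -sumrB big1_seq // => v /andP[_ /WsP hv].
  by rewrite linearZ /= fglift1 (descent_atom_steinberg hv).1 subrr.
have lead_wl v : inW v -> nf_elt (lead v) = v.
  move=> hv; apply: (nf_uniq CF Ws_uniq WsP hv (@dom_lamset r (desc v)) _ erefl).1.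
  by move=> j /lamset_eq0.
have : coeff (lead w) g' = c w.
  rewrite /g' raddf_sum /= (bigD1_seq w) //= coeffZ coeff1 eqxx mulr1 big1_seq ?addr0 //.
  move=> v /andP[vw /WsP hv]; rewrite coeffZ coeff1.
  case: (lead v =P lead w) => [ev|_]; last by rewrite mulr0.
  by rewrite -(lead_wl v hv) ev lead_wl ?eqxx in vw.
move=> <-; rewrite -eg; apply: (coeff_supp_in sg); exact: (descent_atom_steinberg hw).2.
Qed.

End BasisModuloInvariants.

(** * Cyclic modules of the 0-Hecke algebra *)

Section HeckeOperators.
Variables (r : nat) (C : 'M[int]_r) (F : fieldType).
Hypothesis CF : cartan_finite C.
Let C2 := cartan_diag CF.
Local Notation FL := (FL r F).
Local Notation weight := 'rV[int]_r.
Local Notation Wmat := 'M[int]_r.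
Implicit Types (f g h z : FL) (l mu : weight) (u v w : Wmat) (i j : 'I_r) (D : {set 'I_r}).
Local Notation s_ := (sref C).
Local Notation inW := (inW C).
Local Notation len := (lengthW C).
Local Notation wm := (wmat C).
Local Notation desc := (descents C).
Local Notation db := (dbL C).
Local Notation dbL_word := (dbL_word C).

Definition dbL_word_of w : FL -> FL := dbL_word (redword C w).
HB.instance Definition _ w := GRing.Linear.copy (dbL_word_of w) (dbL_word (redword C w)).
Definition demL_word_of w f : FL := foldr (fun i => demL C i) f (redword C w).

Lemma dembar_wE w f : dembar_w C w f = dbL_word_of w f.
Proof.
rewrite /dembar_w /dbL_word_of /dbL_word; elim: (redword C w) => //= i s ->.
exact: (dembarE C2).
Qed.

Lemma dbL_word_is_reduced s f : is_reduced C s -> dbL_word s f = dbL_word_of (wm s) f.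
Proof.
move=> rs; have hw := inW_wmat C s.
apply: (matsumoto CF (Op := fun i => db i)) => //.
- move=> i j ij z; exact: (dbL_braid CF).
- exact: reduced_redword.
by case: (redword_spec hw).
Qed.

Lemma dbL_word_of_mul u v f : inW u -> inW v -> len (wmul u v) = (len u + len v)%N ->
  dbL_word_of (wmul u v) f = dbL_word_of u (dbL_word_of v f).
Proof.
move=> hu hv e; have [eu su] := redword_spec hu; have [ev sv] := redword_spec hv.
rewrite {2 3}/dbL_word_of /dbL_word -foldr_cat -/(dbL_word _ f) dbL_word_is_reduced; first by rewrite wmat_cat eu ev.
by rewrite /is_reduced size_cat wmat_cat eu ev e su sv.
Qed.

Lemma dbL_word_of1 f : dbL_word_of 1%:M f = f.
Proof.
have [_] := redword_spec (inW1 C); rewrite len1 /dbL_word_of => /size0nil ->.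
by [].
Qed.

Lemma dbL_word_of_sref i f : dbL_word_of (s_ i) f = db i f.
Proof.
have li : len (s_ i) = 1%N.
  case: (len_mull_cases CF i (inW1 C)) => -[_]; rewrite wmul1 len1 // => e.
by rewrite -(wmat1 C i) -dbL_word_is_reduced // /is_reduced wmat1 li.
Qed.

Lemma dbL_up w i f : inW w -> (len w < len (wmul (s_ i) w))%N ->
  db i (dbL_word_of w f) = dbL_word_of (wmul (s_ i) w) f.
Proof.
move=> hw lt; have li := len_mull i hw; rewrite dbL_word_of_mul ?dbL_word_of_sref //; first exact: inW_sref.
have e : len (wmul (s_ i) w) = (len w).+1 by apply/eqP; rewrite eqn_leq li lt.
rewrite e; apply/eqP; rewrite eqn_leq; apply/andP; split; last by rewrite -add1n leq_add2r len_sref.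
by rewrite -e; apply: len_mul => //; apply: inW_sref.
Qed.

Lemma dbL_down w i f : inW w -> ~~ (len w < len (wmul (s_ i) w))%N ->
  db i (dbL_word_of w f) = - dbL_word_of w f.
Proof.
move=> hw nlt; have hw' := inW_mull i hw.
have ew : w = wmul (s_ i) (wmul (s_ i) w) by rewrite (sref_wmulK C2).
have e : dbL_word_of w f = db i (dbL_word_of (wmul (s_ i) w) f).
  rewrite dbL_up -?ew //.
  by case: (len_mull_cases CF i hw) => -[_ e]; [move: nlt; rewrite e ltnSn | rewrite [X in (_ < X)%N]e].
by rewrite e (dbL_idem C2).
Qed.

Definition killed D z := forall j, j \notin D -> db j z = 0.

Lemma dbL_word_of_killed D z w : killed D z -> inW w -> ~~ (desc w \subset D) -> dbL_word_of w z = 0.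
Proof.
move=> kz hw /subsetPn[j jw jD]; have hw' := inW_mulr j hw.
have lt : (len (wmul w (s_ j)) < len w)%N by move: jw; rewrite inE.
have ew : w = wmul (wmul w (s_ j)) (s_ j) by rewrite (wmul_srefK C2).
have le := len_mulr' C2 j hw; have l1 := len_sref C j.
rewrite ew dbL_word_of_mul ?dbL_word_of_sref ?kz ?linear0 //; first exact: inW_sref.
rewrite -ew; apply/eqP; rewrite eqn_leq; apply/andP; split; last by move: lt l1; lia.
by rewrite {1}ew; apply: len_mul => //; apply: inW_sref.
Qed.

(** Lengthening on the left can only enlarge the descent set. If it acquires some j outside D, a
    reduced word can end in j, which kills z. The formula depends on z only through [killed], so it
    applies alike to all such vectors. *)
Lemma db_atom D z w i : killed D z -> inW w -> desc w = D ->
  db i (dbL_word_of w z) = if ~~ (len w < len (wmul (s_ i) w))%N then - dbL_word_of w z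
    else if desc (wmul (s_ i) w) == D then dbL_word_of (wmul (s_ i) w) z else 0.
Proof.
move=> kz hw dw; case: ifPn => [|/negPn lt]; first exact: dbL_down.
rewrite (dbL_up z hw lt); case: ifPn => // ne; apply: (dbL_word_of_killed kz); first exact: inW_mull.
apply: contraNN ne => sub; rewrite eqEsubset sub -{1}dw.
exact: descents_mull.
Qed.

End HeckeOperators.

(** * Descent classes and cyclic submodules *)

Section HeckeAction.
Variables (r : nat) (C : 'M[int]_r) (Ws : seq 'M[int]_r) (F : fieldType).
Hypothesis CF : cartan_finite C.
Hypothesis Ws_uniq : uniq Ws.
Hypothesis WsP : forall w, w \in Ws <-> inW C w.
Let C2 := cartan_diag CF.
Local Notation FL := (FL r F).
Local Notation weight := 'rV[int]_r.
Local Notation Wmat := 'M[int]_r.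
Implicit Types (f g h z : FL) (l mu : weight) (u v w : Wmat) (i j : 'I_r) (D : {set 'I_r}).
Local Notation s_ := (sref C).
Local Notation inW := (inW C).
Local Notation wm := (wmat C).
Local Notation desc := (descents C).
Local Notation w0 := (w0 C).
Local Notation db := (dbL C).
Local Notation dbL_word := (dbL_word C).

Local Notation dbL_word_of := (dbL_word_of C).
Local Notation demL_word_of := (demL_word_of C).
Local Notation killed := (killed C).

Definition atom_span D z f := exists c : Wmat -> F,
  f = \sum_(w <- Ws | desc w == D) c w *: dbL_word_of w z.

Lemma atom_span_subspace D z : subspace (atom_span D z).
Proof.
split=> [|a f g [c ->] [d ->]].
  by exists (fun=> 0); rewrite big1 // => w _; rewrite scale0r.
exists (fun w => a * c w + d w); rewrite scaler_sumr -big_split /=.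
by apply: eq_bigr => w _; rewrite scalerDl scalerA.
Qed.

Lemma atom_span1 D z w : inW w -> desc w = D -> atom_span D z (dbL_word_of w z).
Proof.
move=> hw dw; exists (fun v => (v == w)%:R).
have wW : w \in Ws by apply/WsP.
rewrite -big_filter (bigD1_seq w) ?filter_uniq ?mem_filter ?dw ?eqxx //= scale1r big1 ?addr0 //.
by move=> v /negbTE->; rewrite scale0r.
Qed.

Lemma atom_span_db D z f i : killed D z -> atom_span D z f -> atom_span D z (db i f).
Proof.
move=> kz [c ->]; rewrite linear_sum; apply: (sub_sum_seq (atom_span_subspace _ _)) => w /WsP hw /eqP dw.
rewrite linearZ; apply: (subZ (atom_span_subspace _ _)); rewrite /= (db_atom CF i kz hw dw).
case: ifP => _; first by apply: (subN (atom_span_subspace _ _)); apply: atom_span1.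
case: eqP => dw'; last exact: (sub0 (atom_span_subspace _ _)).
by apply: atom_span1 => //; apply: inW_mull.
Qed.

Lemma atom_span_dbw D z f s : killed D z -> atom_span D z f -> atom_span D z (dbL_word s f).
Proof. by move=> kz af; elim: s => //= i s IH; apply: atom_span_db. Qed.

Lemma dbL_word_of_factor D z w : inW w -> desc w = D ->
  exists2 v, inW v & dbL_word_of w z = dbL_word_of v (dbL_word_of (w0 D) z).
Proof.
move=> hw dw; have [|v hv [ew lw]] := @w0_factor _ _ _ CF Ws_uniq WsP D w hw; first by rewrite dw.
exists v => //; rewrite {1}ew dbL_word_of_mul //; first exact: (w0_inW WsP).
by rewrite -ew.
Qed.

Definition cyclic_span (z' f : FL) := exists c : Wmat -> F, f = \sum_(w <- Ws) c w *: dbL_word_of w z'.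

Lemma cyclic_span_subspace z' : subspace (cyclic_span z').
Proof.
split=> [|a f g [c ->] [d ->]].
  by exists (fun=> 0); rewrite big1 // => w _; rewrite scale0r.
exists (fun w => a * c w + d w); rewrite scaler_sumr -big_split /=.
by apply: eq_bigr => w _; rewrite scalerDl scalerA.
Qed.

Lemma cyclic_span1 z' w : inW w -> cyclic_span z' (dbL_word_of w z').
Proof.
move=> hw; exists (fun v => (v == w)%:R); have wW : w \in Ws by apply/WsP.
rewrite (bigD1_seq w) //= eqxx scale1r big1 ?addr0 //.
by move=> v /negbTE->; rewrite scale0r.
Qed.

(** The span of the atoms contains the generator and is stable under every pibar_i; conversely each
    w with D(w) = D factors through [w0 D]. *)
Lemma cyclic_atom_span D z f : killed D z ->
  cyclic_span (dbL_word_of (w0 D) z) f <-> atom_span D z f.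
Proof.
move=> kz; split=> -[c ->].
  apply: (sub_sum (atom_span_subspace _ _)) => w _; apply: (subZ (atom_span_subspace _ _)).
  apply: atom_span_dbw => //; apply: atom_span1; first exact: (w0_inW WsP).
  exact: (descents_w0 CF Ws_uniq WsP).
apply: (sub_sum_seq (cyclic_span_subspace _)) => w /WsP hw /eqP dw.
apply: (subZ (cyclic_span_subspace _)); have [v hv ->] := dbL_word_of_factor z hw dw.
exact: cyclic_span1.
Qed.

Lemma is_reduced_letters D s : is_reduced C s -> inWpar C D (wm s) -> all (mem D) s.
Proof.
elim/last_ind: s => [//|s i IH] rs hp; rewrite all_rcons.
have rs' := reduced_rcons rs.
have iD : i \in D.
  apply: (subsetP (descents_inWpar CF Ws_uniq WsP hp)).
  by rewrite inE -rs wmat_rcons (wmul_srefK C2) -rs' size_rcons.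
rewrite /= iD IH // .
by rewrite -[wm s](wmul_srefK C2 i) -wmat_rcons; apply: inWpar_mulr.
Qed.

Lemma w0_letters D : all (mem D) (redword C (w0 D)).
Proof.
have hw := w0_inW WsP D; apply: is_reduced_letters; first exact: reduced_redword.
by rewrite (redword_spec hw).1; apply: (w0_inWpar WsP).
Qed.

Lemma demL_word_of_fix D z : (forall j, j \in D -> demL C j z = z) -> demL_word_of (w0 D) z = z.
Proof.
move=> H; rewrite /demL_word_of; have := w0_letters D.
by elim: (redword C _) => //= j s IH /andP[jD /IH ->]; apply: H.
Qed.

Lemma killed_zD D : killed D (zD F D).
Proof. by move=> j jD; apply: dbL0; apply/lamset_eq0. Qed.

Lemma demL_word_of_zD D : demL_word_of (w0 (~: D)) (zD F D) = zD F D.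
Proof.
apply: demL_word_of_fix => j; rewrite inE => jD.
by rewrite demL_dbL killed_zD // add0r.
Qed.

(** Each j outside D is a left descent of the longest element, so the word may be taken to begin
    with j, and pibar_j pi_j = 0. *)
Lemma killed_demL_word_of D z : killed D (demL_word_of (w0 (~: D)) z).
Proof.
move=> j jD; have jD' : j \in ~: D by rewrite inE.
have hw := w0_inW WsP (~: D); set w := w0 (~: D) in hw *.
have e := w0_left_descent CF WsP jD'; rewrite -/w in e.
have hw' := inW_mull j hw; have [e' sz'] := redword_spec hw'.
have -> : demL_word_of w z = demL C j (foldr (fun i => demL C i) z (redword C (wmul (s_ j) w))).
  rewrite /demL_word_of -[RHS]/(foldr (fun i => demL C i) z (j :: redword C (wmul (s_ j) w))).
  apply: (matsumoto CF (Op := fun i => demL C i)).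
  - move=> a b ab y; exact: (demL_braid CF).
  - exact: reduced_redword.
  - by rewrite /is_reduced [wm _]/= e' (sref_wmulK C2) /= sz' -e.
  by rewrite [wm _ in RHS]/= e' (sref_wmulK C2) (redword_spec hw).1.
by rewrite (dbL_demL C) (demL_idem C2) subrr.
Qed.

End HeckeAction.

(** * The 0-Hecke algebra through its action on F[Lambda] *)

Section HeckeModule.
Variables (r : nat) (C : 'M[int]_r) (Ws : seq 'M[int]_r) (F : fieldType).
Hypothesis CF : cartan_finite C.
Hypothesis Ws_uniq : uniq Ws.
Hypothesis WsP : forall w, w \in Ws <-> inW C w.
Let C2 := cartan_diag CF.
Local Notation FL := (FL r F).
Local Notation HH := (HH r F).
Local Notation weight := 'rV[int]_r.
Local Notation Wmat := 'M[int]_r.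
Implicit Types (f g z : FL) (x y h : HH) (l mu : weight) (u v w : Wmat) (i j : 'I_r) (D : {set 'I_r}).
Local Notation expo := (expo F).
Local Notation s_ := (sref C).
Local Notation inW := (inW C).
Local Notation len := (lengthW C).
Local Notation wm := (wmat C).
Local Notation desc := (descents C).
Local Notation w0 := (w0 C).
Local Notation db := (dbL C).
Local Notation dbL_word_of := (dbL_word_of C).
Local Notation demL_word_of := (demL_word_of C).
Local Notation Tact := (@Tact r C F).
Local Notation Tb := (Tb F).
Local Notation T_w := (@T_w r C F).
Local Notation Tp_w := (@Tp_w r C F).
Local Notation xP := (xP C F).
Local Notation inH := (@inH r F Ws).

HB.instance Definition _ i := GRing.Linear.copy (Tact i)
  (fglift (fun w => if (len w < len (wmul (s_ i) w))%N then Tb (wmul (s_ i) w) else - Tb w)).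

Lemma TactX i w : Tact i (Tb w) =
  if (len w < len (wmul (s_ i) w))%N then Tb (wmul (s_ i) w) else - Tb w.
Proof. exact: fglift1. Qed.

Lemma inH_subspace : subspace inH.
Proof.
split=> [|a x y [c ->] [d ->]].
  by exists (fun=> 0); rewrite big1 // => w _; rewrite scale0r.
exists (fun w => a * c w + d w); rewrite scaler_sumr -big_split /=.
by apply: eq_bigr => w _; rewrite scalerDl scalerA.
Qed.

Lemma inH_Tb w : inW w -> inH (Tb w).
Proof.
move=> hw; exists (fun v => (v == w)%:R); have wW : w \in Ws by apply/WsP.
rewrite (bigD1_seq w) //= eqxx scale1r big1 ?addr0 //.
by move=> v /negbTE->; rewrite scale0r.
Qed.

Lemma inH_ind (P : HH -> Prop) : subspace P -> (forall w, inW w -> P (Tb w)) ->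
  forall x, inH x -> P x.
Proof.
move=> SP H x [c ->]; apply: (sub_sum_seq SP) => w /WsP hw _.
by apply: (subZ SP); apply: H.
Qed.

Lemma linear_subspace_pre (V U : lmodType F) (f : {linear V -> U}) (P : U -> Prop) :
  subspace P -> subspace (fun a : V => P (f a)).
Proof.
by move=> [P0 PL]; split=> [|c u v Pu Pv]; rewrite ?linear0 // linearP; apply: PL.
Qed.

Lemma linear_eq_subspace (V U : lmodType F) (f g : {linear V -> U}) :
  subspace (fun a : V => f a = g a).
Proof. by split=> [|c u v eu ev]; rewrite ?linear0 // !linearP eu ev. Qed.

Lemma inH_Tact i x : inH x -> inH (Tact i x).
Proof.
apply: (inH_ind (linear_subspace_pre _ inH_subspace)) => w hw /=; rewrite TactX.
case: ifP => _; first by apply: inH_Tb; apply: inW_mull.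
by apply: (subN inH_subspace); apply: inH_Tb.
Qed.

Lemma inH_T_w w x : inH x -> inH (T_w w x).
Proof. by rewrite /Defs.T_w => hx; elim: (redword C w) => //= i s; apply: inH_Tact. Qed.

Lemma inH_Tp_w w x : inH x -> inH (Tp_w w x).
Proof.
rewrite /Defs.Tp_w => hx; elim: (redword C w) => //= i s IH.
by apply: (subD inH_subspace) => //; apply: inH_Tact.
Qed.

(* [x |-> x . f] for the Demazure action of H_W(0) on F[Lambda] *)
Definition orb_map f : HH -> FL := fglift (fun w => dbL_word_of w f).
HB.instance Definition _ f := GRing.Linear.copy (orb_map f) (fglift (fun w => dbL_word_of w f)).

Lemma orb_mapX f w : orb_map f (Tb w) = dbL_word_of w f. Proof. exact: fglift1. Qed.

(** Restricted to [inH], since for matrices outside W both the length and the reduced word are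
    default values. *)
Lemma orb_map_Tact f i x : inH x -> orb_map f (Tact i x) = db i (orb_map f x).
Proof.
apply: (inH_ind (@linear_eq_subspace _ _ (orb_map f \o Tact i) (db i \o orb_map f))) => w hw /=.
rewrite TactX orb_mapX; case: ifPn => lt; first by rewrite orb_mapX dbL_up.
by rewrite linearN /= orb_mapX dbL_down.
Qed.

Lemma orb_map_T_w f w x : inH x -> orb_map f (T_w w x) = dbL_word_of w (orb_map f x).
Proof.
move=> hx; rewrite /Defs.T_w /dbL_word_of /dbL_word.
suff [] : inH (foldr (fun i => Tact i) x (redword C w)) /\
  orb_map f (foldr (fun i => Tact i) x (redword C w)) =
    foldr (fun i => db i) (orb_map f x) (redword C w) by [].
elim: (redword C w) => //= i s [h e]; split; first exact: inH_Tact.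
by rewrite orb_map_Tact // e.
Qed.

Lemma orb_map_Tp_w f w x : inH x -> orb_map f (Tp_w w x) = demL_word_of w (orb_map f x).
Proof.
move=> hx; rewrite /Defs.Tp_w /demL_word_of.
suff [] : inH (foldr (fun i h => Tact i h + h) x (redword C w)) /\
  orb_map f (foldr (fun i h => Tact i h + h) x (redword C w)) =
    foldr (fun i => demL C i) (orb_map f x) (redword C w) by [].
elim: (redword C w) => //= i s [h e]; split.
  by apply: (subD inH_subspace) => //; apply: inH_Tact.
by rewrite linearD /= orb_map_Tact // e demL_dbL.
Qed.

Lemma orb_map_Tb1 f : orb_map f (Tb 1%:M) = f.
Proof. by rewrite orb_mapX dbL_word_of1. Qed.

(** The element T'_(w0(D^c)), which plays in H_W(0) the part of z_D: T_j kills it for j outside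
    D. *)
Definition tail_gen D : HH := Tp_w (w0 (~: D)) (Tb 1%:M).

Lemma inH_tail_gen D : inH (tail_gen D).
Proof. by apply: inH_Tp_w; apply: inH_Tb; apply: inW1. Qed.

Lemma orb_map_tail_gen f D : orb_map f (tail_gen D) = demL_word_of (w0 (~: D)) f.
Proof. by rewrite orb_map_Tp_w ?orb_map_Tb1 //; apply: inH_Tb; apply: inW1. Qed.

Lemma inH_xP D : inH (xP D). Proof. exact/inH_T_w/inH_tail_gen. Qed.

Lemma orb_map_xP f D : orb_map f (xP D) = dbL_word_of (w0 D) (demL_word_of (w0 (~: D)) f).
Proof. by rewrite orb_map_T_w ?orb_map_tail_gen //; apply: inH_tail_gen. Qed.

Let rho : weight := lamset setT.

(* The regular weight [rho] separates the basis: [pibar_w e^rho] is the only one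
   with extremal weight [w rho]. *)
Lemma orb_map_rho_inj x : inH x -> orb_map (expo rho) x = 0 -> x = 0.
Proof.
move=> [c ->] e; apply: big1_seq => w /andP[_ wW]; have hw := (WsP w).1 wW.
have dr : dom_wt rho by apply: dom_lamset.
have rn0 j : rho 0 j = 0 -> forall v, j \notin desc v by move/lamset_eq0; rewrite inE.
have mc v : inW v -> min_coset C rho v.
  by move=> hv; apply: (min_coset_desc CF Ws_uniq WsP) => // j /rn0.
have ext v : inW v -> coeff (act w rho) (dbL_word_of v (expo rho)) = (v == w)%:R.
  move=> hv; have [ev sv] := redword_spec hv.
  have mv : min_coset C rho (wm (redword C v)) by rewrite ev; apply: mc.
  have [h sh eh] := dbL_word_extremal F CF Ws_uniq WsP (reduced_redword hv) dr mv.
  rewrite /dbL_word_of eh coeffD coeff1 ev (coeff_supp_in sh) ?addr0; last first.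
    by move=> [_]; rewrite (form_act C2 Ws_uniq WsP) // ltxx.
  suff -> : (act v rho == act w rho) = (v == w) by [].
  apply/eqP/eqP => [ea|->//].
  have [le1 eq1] := min_coset_len CF Ws_uniq WsP hv hw dr ea (fun j e => rn0 j e w).
  by apply: eq1; apply/eqP; rewrite eqn_leq le1 andbT (mc v hv).
have := congr1 (coeff (act w rho)) e; rewrite coeff0 linear_sum raddf_sum /= (bigD1_seq w) //=.
rewrite linearZ /= coeffZ orb_mapX ext // eqxx mulr1 big1_seq ?addr0 => [->|]; first by rewrite scale0r.
move=> v /andP[vw /WsP hv]; rewrite linearZ /= coeffZ orb_mapX ext // (negbTE vw) mulr0 //.
Qed.

Lemma orb_map_rho_eq x y : inH x -> inH y ->
  orb_map (expo rho) x = orb_map (expo rho) y -> x = y.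
Proof.
move=> hx hy e; apply/eqP; rewrite -subr_eq0; apply/eqP; apply: orb_map_rho_inj.
  exact: (subB inH_subspace).
by rewrite linearB /= e subrr.
Qed.

Let yT D : FL := demL_word_of (w0 (~: D)) (expo rho).

Lemma killed_yT D : killed C D (yT D). Proof. exact: (killed_demL_word_of CF WsP). Qed.

Lemma inH_combo (P : pred Wmat) (c : Wmat -> F) (t : Wmat -> HH) :
  (forall w, inH (t w)) -> inH (\sum_(w <- Ws | P w) c w *: t w).
Proof. by move=> H; apply: (sub_sum inH_subspace) => w _; apply: (subZ inH_subspace). Qed.

Lemma inP_inH D x : inP C Ws D x -> inH x.
Proof. by move=> [c ->]; apply: (inH_combo xpredT) => w; apply/inH_T_w/inH_xP. Qed.

Lemma orb_map_inP f D (c : Wmat -> F) :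
  orb_map f (\sum_(w <- Ws) c w *: T_w w (xP D)) =
  \sum_(w <- Ws) c w *: dbL_word_of w (dbL_word_of (w0 D) (demL_word_of (w0 (~: D)) f)).
Proof.
rewrite linear_sum; apply: eq_bigr => w _.
by rewrite linearZ /= orb_map_T_w ?orb_map_xP //; apply: inH_xP.
Qed.

Lemma orb_map_T_w_tail_gen f D (c : Wmat -> F) :
  orb_map f (\sum_(w <- Ws | desc w == D) c w *: T_w w (tail_gen D)) =
  \sum_(w <- Ws | desc w == D) c w *: dbL_word_of w (demL_word_of (w0 (~: D)) f).
Proof.
rewrite linear_sum; apply: eq_bigr => w _.
by rewrite linearZ /= orb_map_T_w ?orb_map_tail_gen //; apply: inH_tail_gen.
Qed.

(** [cyclic_atom_span] for the images of e^rho, pulled back along the injective map. *)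
Lemma inP_tail_gen D x : inP C Ws D x ->
  exists c : Wmat -> F, x = \sum_(w <- Ws | desc w == D) c w *: T_w w (tail_gen D).
Proof.
move=> hx; have [c ex] := hx.
have [d ed] : atom_span C Ws D (yT D) (orb_map (expo rho) x).
  apply/(cyclic_atom_span CF Ws_uniq WsP _ (@killed_yT D)).
  by exists c; rewrite ex orb_map_inP.
exists d; apply: orb_map_rho_eq; first exact: inP_inH hx.
  by apply: inH_combo => w; apply/inH_T_w/inH_tail_gen.
by rewrite ed orb_map_T_w_tail_gen.
Qed.

(** The same structure constants as in [db_atom]; their agreement makes the regular representation
    match the coinvariant algebra. *)
Lemma Tact_T_w_tail_gen w i : inW w -> Tact i (T_w w (tail_gen (desc w))) =
  if ~~ (len w < len (wmul (s_ i) w))%N then - T_w w (tail_gen (desc w))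
  else if desc (wmul (s_ i) w) == desc w then T_w (wmul (s_ i) w) (tail_gen (desc w)) else 0.
Proof.
move=> hw; have hx := inH_tail_gen (desc w).
apply: orb_map_rho_eq; first exact/inH_Tact/inH_T_w.
  case: ifP => _; first exact/(subN inH_subspace)/inH_T_w.
  by case: ifP => _; [exact: inH_T_w | exact: (sub0 inH_subspace)].
rewrite orb_map_Tact ?orb_map_T_w ?orb_map_tail_gen //; last exact: inH_T_w.
rewrite (db_atom CF i (@killed_yT (desc w)) hw erefl).
case: ifP => _; first by rewrite linearN /= orb_map_T_w ?orb_map_tail_gen.
by case: ifP => _; rewrite ?linear0 // orb_map_T_w ?orb_map_tail_gen.
Qed.

Lemma T_w_Tb w u : inW w -> inW u -> len (wmul w u) = (len w + len u)%N ->
  T_w w (Tb u) = Tb (wmul w u).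
Proof.
move=> hw hu; have [ew sw] := redword_spec hw.
suff H s : len (wmul (wm s) u) = (size s + len u)%N ->
    foldr (fun i => Tact i) (Tb u) s = Tb (wmul (wm s) u).
  by move: (H (redword C w)); rewrite ew sw.
elim: s => [|i s IH] /=; first by rewrite wmul1l.
rewrite -wmulA => e; have hs := inW_mul (inW_wmat C s) hu.
have es : len (wmul (wm s) u) = (size s + len u)%N.
  apply/eqP; rewrite eqn_leq; apply/andP; split.
    apply: leq_trans (len_mul (inW_wmat C s) hu) _.
    by rewrite leq_add2r len_wmat.
  by rewrite -ltnS -addSn -e len_mull.
by rewrite (IH es) TactX e es addSn ltnSn.
Qed.

Lemma tail_gen_unitriangular D :
  supp_in (fun u => inWpar C (~: D) u /\ u != 1%:M) (tail_gen D - Tb 1%:M).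
Proof.
rewrite /tail_gen /Defs.Tp_w; have := w0_letters CF Ws_uniq WsP (~: D).
set S := supp_in _; have SP : subspace S by apply: supp_in_subspace.
elim: (redword C _) => [_|i s IH /= /andP[iD /IH]].
  by rewrite /= subrr; apply: (sub0 SP).
set y := foldr _ _ s => Sy.
have -> : Tact i y + y - Tb 1%:M = Tact i (y - Tb 1%:M) + Tact i (Tb 1%:M) + (y - Tb 1%:M).
  by rewrite linearB /= subrK addrA.
have li : len (s_ i) = 1%N.
  case: (len_mull_cases CF i (inW1 C)) => -[_]; rewrite wmul1 len1 // => e.
apply: (subD SP) => //; apply: (subD SP); last first.
  rewrite TactX wmul1 len1 li /=; apply: supp_in1; split.
    by exists [:: i]; rewrite wmat1 /= iD.
  by apply/eqP => e; move: li; rewrite e len1.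
apply: supp_in_lift => u /Sy[hu un]; case: ifP => lt; last by apply: (subN SP); apply: supp_in1.
apply: supp_in1; split; first exact: inWpar_mull.
by apply/eqP => e; move: lt; rewrite e len1.
Qed.

(** The other terms T_u of [tail_gen] have u in the parabolic subgroup of the non-descents of w.
    There lengths add, so T_w T_u = T_(wu) with wu longer than w. *)
Lemma T_w_tail_gen_unitriangular w : inW w ->
  supp_in (fun u => inW u /\ (len w < len u)%N) (T_w w (tail_gen (desc w)) - Tb w).
Proof.
move=> hw; set S := supp_in _; have SP : subspace S by apply: supp_in_subspace.
have T_lin : linear (T_w w).
  by rewrite /Defs.T_w; elim: (redword C w) => //= i s IH c x y; rewrite IH linearP.
pose TL := GRing.isLinear.Build F HH HH _ (T_w w) T_lin.
pose Tl : {linear HH -> HH} := HB.pack (T_w w) TL.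
have -> : Tb w = Tl (Tb 1%:M) by rewrite /= T_w_Tb ?wmul1 ?len1 ?addn0 //; apply: inW1.
rewrite -[T_w w _]/(Tl _) -linearB [tail_gen _ - _]freeg_expand linear_sum.
apply: (sub_sum_seq SP) => u; rewrite mem_dom => /(@tail_gen_unitriangular _)[hu un] _.
have hu' := inWpar_inW hu.
have e : len (wmul w u) = (len w + len u)%N.
  apply: (parabolic_len CF Ws_uniq WsP hw hu).
  by apply/pred0P => j /=; rewrite inE andNb.
rewrite linearZ; apply: (subZ SP); rewrite /= -/(Tb u) T_w_Tb //; apply: supp_in1; split.
  exact: inW_mul.
rewrite e -[X in (X < _)%N]addn0 ltn_add2l lt0n; apply: contraNneq un => l0.
by rewrite (len0 hu' l0).
Qed.

(* Completed by the identity outside W, so as to be a basis of the whole free module. *)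
Definition regular_basis w : HH := if w \in Ws then T_w w (tail_gen (desc w)) else Tb w.

Lemma regular_basisP : (forall g : HH, fglift regular_basis g = 0 -> g = 0) /\
  (forall x, exists g : HH, x = fglift regular_basis g).
Proof.
have [N HN] := len_bounded WsP.
have diag w : coeff w (regular_basis w) = 1.
  rewrite /regular_basis; case: ifP => [/WsP hw|_]; last by rewrite coeff1 eqxx.
  rewrite -[T_w w _](subrK (Tb w)) coeffD coeff1 eqxx.
  by rewrite (coeff_supp_in (T_w_tail_gen_unitriangular hw)) ?add0r // => -[_]; rewrite ltnn.
have lower w w' : coeff w' (regular_basis w) != 0 -> w' != w -> (N - len w' < N - len w)%N.
  rewrite /regular_basis; case: ifP => [/WsP hw|_] + ww'; last by rewrite coeff1 [w == _]eq_sym (negbTE ww') eqxx.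
  rewrite -[T_w w _](subrK (Tb w)) coeffD coeff1 [w == _]eq_sym (negbTE ww') addr0.
  by move/(T_w_tail_gen_unitriangular hw) => [hw' lt]; have := HN _ hw'; lia.
split; first exact: (unitriangular_inj diag lower).
exact: (unitriangular_surj diag lower).
Qed.

Lemma inH_regular_basis x : inH x -> exists c : Wmat -> F,
  x = \sum_(w <- Ws) c w *: T_w w (tail_gen (desc w)).
Proof.
move=> hx; have [g eg] := regular_basisP.2 x; exists (fun w => coeff w g).
(* Outside W the family is the identity and no other member has a term there, so [g] and [x] have
   the same coefficient at [w]. *)
have supp : forall w, w \notin Ws -> coeff w g = 0.
  move=> w wW.
  have x0 : coeff w x = 0.
    case: hx => c ->; rewrite raddf_sum big1_seq // => v /andP[_ vW] /=.
    rewrite coeffZ coeff1; case: (v =P w) => [e|_]; last by rewrite mulr0.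
    by rewrite -e vW in wW.
  move: x0; rewrite eg fgliftE raddf_sum /=.
  case: (boolP (w \in dom g)) => [wg|/coeff_outdom//].
  rewrite (bigD1_seq w) ?uniq_dom //= coeffZ {1}/regular_basis (negbTE wW) coeff1 eqxx mulr1.
  rewrite big1_seq ?addr0 // => v /andP[vw _]; rewrite coeffZ /regular_basis; case: ifP => [/WsP hv|_].
    rewrite -[T_w v _](subrK (Tb v)) coeffD coeff1 (negbTE vw) addr0.
    rewrite (coeff_supp_in (T_w_tail_gen_unitriangular hv)) ?mulr0 // => -[hw _].
    by move/negP: wW; apply; apply/WsP.
  by rewrite coeff1 (negbTE vw) mulr0.
rewrite eg (fglift_sub regular_basis Ws_uniq); first by apply: eq_big_seq => w wW; rewrite /regular_basis wW.
by move=> w; rewrite mem_dom; apply: contraR => /supp ->.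
Qed.

(** Prescribing values on this basis needs the inverse base change. A preimage of each [Tb w] is
    chosen, the choice is extended linearly, and injectivity identifies the result as the
    inverse. *)
Lemma linear_of_regular_basis (t : Wmat -> FL) :
  exists phi : {linear HH -> FL}, forall w, inW w -> phi (T_w w (tail_gen (desc w))) = t w.
Proof.
pose g w := epsilon (inhabits 0) (fun g : HH => Tb w = fglift regular_basis g).
have gP w : Tb w = fglift regular_basis (g w).
  by apply: (epsilon_spec (inhabits 0) (fun g : HH => Tb w = fglift regular_basis g)); apply: regular_basisP.2.
pose inv : {linear HH -> HH} := fglift g.
have invK x : fglift regular_basis (inv x) = x.
  apply: (@linear_freeg_ext _ _ _ (fglift regular_basis \o inv) idfun) => w /=.
  by rewrite fglift1 -gP.
have inv_regb w : inv (regular_basis w) = Tb w.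
  apply/eqP; rewrite -subr_eq0; apply/eqP; apply: regular_basisP.1.
  by rewrite linearB /= invK fglift1 subrr.
pose phi : {linear HH -> FL} := fglift t \o inv.
exists phi => w /WsP wW; have := inv_regb w; rewrite /regular_basis wW /phi /= => ->.
exact: fglift1.
Qed.

End HeckeModule.

(** * The coinvariant algebra as an H_W(0)-module *)

Section Coinvariants.
Variables (r : nat) (C : 'M[int]_r) (Ws : seq 'M[int]_r) (F : fieldType).
Hypothesis CF : cartan_finite C.
Hypothesis Ws_uniq : uniq Ws.
Hypothesis WsP : forall w, w \in Ws <-> inW C w.
Local Notation FL := (FL r F).
Local Notation HH := (HH r F).
Local Notation Wmat := 'M[int]_r.
Implicit Types (f : FL) (x : HH) (w : Wmat) (i : 'I_r) (D : {set 'I_r}).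
Local Notation inW := (inW C).
Local Notation desc := (descents C).
Local Notation w0 := (w0 C).
Local Notation dbL_word_of := (dbL_word_of C).
Local Notation dbwE := (dembar_wE CF).
Local Notation inI := (@inI r F Ws).
Local Notation inM := (@inM r C F Ws).
Local Notation atoms D c := (\sum_(w <- Ws | desc w == D) c w *: dbL_word_of w (zD F D)).

Let SI : subspace inI := inI_subspace Ws F.

Lemma inM_atoms D f : inM D f <-> exists c : Wmat -> F, inI (f - atoms D c).
Proof.
have kz := @killed_zD r C F D.
split=> -[c hc].
  have [d ed] : atom_span C Ws D (zD F D) (\sum_(w <- Ws) c w *: dbL_word_of w (dbL_word_of (w0 D) (zD F D))).
    by apply/(cyclic_atom_span CF Ws_uniq WsP _ kz); exists c.
  exists d; rewrite -ed; under eq_bigr => w _ do rewrite -!dbwE.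
  exact: hc.
have [d ed] : cyclic_span C Ws (dbL_word_of (w0 D) (zD F D)) (atoms D c).
  by apply/(cyclic_atom_span CF Ws_uniq WsP _ kz); exists c.
exists d; under eq_bigr => w _ do rewrite !dbwE.
by rewrite -ed.
Qed.

Lemma inM_atoms0 D (c : Wmat -> F) : inM D (atoms D c).
Proof. by apply/inM_atoms; exists c; rewrite subrr; apply: (sub0 SI). Qed.

Lemma sum_atoms (c : {set 'I_r} -> Wmat -> F) :
  \sum_D atoms D (c D) = \sum_(w <- Ws) c (desc w) w *: descent_atom C F w.
Proof.
rewrite [RHS](partition_big desc xpredT) //=; apply: eq_bigr => D _.
by apply: eq_bigr => w /eqP <-.
Qed.

Lemma atoms_free D (c : Wmat -> F) : inI (atoms D c) ->
  forall w, w \in Ws -> desc w = D -> c w = 0.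
Proof.
move=> h w wW dw.
have -> : c w = if desc w == D then c w else 0 by rewrite dw eqxx.
apply: (descent_atom_free CF Ws_uniq WsP (c := fun w => if desc w == D then c w else 0)) wW.
move: h; rewrite big_mkcond; congr inI; apply: eq_bigr => v _.
by case: eqP => [<-|_] //; rewrite scale0r.
Qed.

(** The map is evaluation at z_D. It is equivariant in F[Lambda] itself, before passing to the
    quotient; injectivity compares the spanning words of P_D with the atoms, which are independent
    modulo the ideal. *)
Lemma projective_iso D : exists phi : {linear HH -> FL},
  [/\ forall v, inP C Ws D v -> inM D (phi v),
      forall v, inP C Ws D v -> inI (phi v) -> v = 0,
      forall f, inM D f -> exists v, inP C Ws D v /\ inI (f - phi v) &
      forall i v, inP C Ws D v -> inI (phi (Tact C i v) - dembar C i (phi v))].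
Proof.
have phiP c : orb_map C (zD F D) (\sum_(w <- Ws) c w *: T_w C w (xP C F D)) =
    \sum_(w <- Ws) c w *: dembar_w C w (dembar_w C (w0 D) (zD F D)).
  rewrite (orb_map_inP CF Ws_uniq WsP) (demL_word_of_zD F CF Ws_uniq WsP).
  by apply: eq_bigr => w _; rewrite !dbwE.
exists (orb_map C (zD F D)); split.
- by move=> v [c ->]; exists c; rewrite /= phiP subrr; apply: (sub0 SI).
- move=> v /(inP_tail_gen CF Ws_uniq WsP)[c ->]; rewrite /= (orb_map_T_w_tail_gen CF Ws_uniq WsP) (demL_word_of_zD F CF Ws_uniq WsP).
  move/atoms_free => c0; rewrite big1_seq // => w /andP[/eqP dw wW].
  by rewrite c0 // scale0r.
- move=> f [c hc]; exists (\sum_(w <- Ws) c w *: T_w C w (xP C F D)); split; first by exists c.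
  by rewrite /= phiP.
move=> i v /(inP_inH Ws_uniq WsP) hv; rewrite /= (orb_map_Tact CF WsP) // (dembarE (cartan_diag CF)).
by rewrite subrr; apply: (sub0 SI).
Qed.

(** The map is built on bases rather than as evaluation at one vector: T_w T'_(w0(D(w)^c)) goes to
    pibar_w e^(lambda_D(w)), and equivariance is the equality of structure constants. *)
Lemma regular_iso : exists phi : {linear HH -> FL},
  [/\ forall v, inH Ws v -> inI (phi v) -> v = 0,
      forall f, exists v, inH Ws v /\ inI (f - phi v) &
      forall i v, inH Ws v -> inI (phi (Tact C i v) - dembar C i (phi v))].
Proof.
have [phi phiE] := linear_of_regular_basis CF Ws_uniq WsP (descent_atom C F).
pose t w := T_w C w (tail_gen C F (desc w)).
have phi_sum (c : Wmat -> F) :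
    phi (\sum_(w <- Ws) c w *: t w) = \sum_(w <- Ws) c w *: descent_atom C F w.
  rewrite linear_sum; apply: eq_big_seq => w /WsP hw.
  by rewrite linearZ /= phiE.
have inHt w : inH Ws (t w) by apply: (inH_T_w Ws_uniq WsP); apply: (inH_tail_gen _ Ws_uniq WsP) .
exists phi; split.
- move=> v /(inH_regular_basis CF Ws_uniq WsP)[c ->]; rewrite phi_sum => /(descent_atom_free CF Ws_uniq WsP) c0.
  by rewrite big1_seq // => w /andP[_ wW]; rewrite c0 // scale0r.
- move=> f; have [c hc] := descent_atom_span CF Ws_uniq WsP f.
  exists (\sum_(w <- Ws) c w *: t w); rewrite phi_sum; split=> //.
  by apply: (sub_sum (inH_subspace Ws F)) => w _; apply: (subZ (inH_subspace Ws F)).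
move=> i v /(inH_regular_basis CF Ws_uniq WsP)[c ->]; rewrite (dembarE (cartan_diag CF)).
suff -> : phi (Tact C i (\sum_(w <- Ws) c w *: t w)) = dbL C i (phi (\sum_(w <- Ws) c w *: t w)).
  by rewrite subrr; apply: (sub0 SI).
rewrite phi_sum !linear_sum; apply: eq_big_seq => w /WsP hw; rewrite !linearZ /=; congr (_ *: _).
have kz := @killed_zD r C F (desc w).
rewrite (Tact_T_w_tail_gen F CF Ws_uniq WsP) // [RHS](db_atom CF i kz hw erefl).
case: ifP => _; first by rewrite linearN phiE.
case: eqP => e; last by rewrite linear0.
by rewrite -e phiE //; apply: inW_mull.
Qed.

End Coinvariants.

Theorem theorem5p3 (r : nat) (C : 'M[int]_r) (F : fieldType)
    (Ws : seq 'M[int]_r) :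
  cartan_finite C ->
  uniq Ws -> (forall w, w \in Ws <-> inW C w) ->
  [/\
   (* the H_W(0)-action T_i |-> pibar_i is well defined on the quotient *)
   forall i (f : FL r F), inI Ws f -> inI Ws (dembar C i f),
   (* {pibar_w e^{lambda_{D(w)}} : w in W} is an F-basis of the quotient *)
   (forall f : FL r F, exists c : 'M[int]_r -> F,
      inI Ws (f - \sum_(w <- Ws) c w *: dembar_w C w (zD F (descents C w))))
   /\ (forall c : 'M[int]_r -> F,
      inI Ws (\sum_(w <- Ws) c w *: dembar_w C w (zD F (descents C w)) : FL r F) ->
      forall w, w \in Ws -> c w = 0),
   (* the quotient is the direct sum of the summands M_D *)
   (forall f : FL r F, exists m : {set 'I_r} -> FL r F,
      (forall D, inM C Ws D (m D)) /\ inI Ws (f - \sum_D m D))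
   /\ (forall m : {set 'I_r} -> FL r F,
      (forall D, inM C Ws D (m D)) -> inI Ws (\sum_D m D) ->
      forall D, inI Ws (m D)),
   (* each summand M_D has basis {pibar_w z_D : D(w) = D} and is isomorphic to P_D *)
   forall D : {set 'I_r},
     [/\ forall w, w \in Ws -> descents C w = D -> inM C Ws D (dembar_w C w (zD F D) : FL r F),
         forall f : FL r F, inM C Ws D f -> exists c : 'M[int]_r -> F,
           inI Ws (f - \sum_(w <- Ws | descents C w == D) c w *: dembar_w C w (zD F D)),
         forall c : 'M[int]_r -> F,
           inI Ws (\sum_(w <- Ws | descents C w == D) c w *: dembar_w C w (zD F D) : FL r F) ->
           forall w, w \in Ws -> descents C w = D -> c w = 0 &
         exists phi : {linear HH r F -> FL r F},
           [/\ forall v, inP C Ws D v -> inM C Ws D (phi v),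
               forall v, inP C Ws D v -> inI Ws (phi v) -> v = 0,
               forall f, inM C Ws D f -> exists v, inP C Ws D v /\ inI Ws (f - phi v) &
               forall i v, inP C Ws D v -> inI Ws (phi (Tact C i v) - dembar C i (phi v))]] &
   (* the quotient is isomorphic to the regular representation of H_W(0) *)
   exists phi : {linear HH r F -> FL r F},
     [/\ forall v, inH Ws v -> inI Ws (phi v) -> v = 0,
         forall f : FL r F, exists v, inH Ws v /\ inI Ws (f - phi v) &
         forall i v, inH Ws v -> inI Ws (phi (Tact C i v) - dembar C i (phi v))]].

Proof.
move=> CF Ws_uniq WsP; have SI := inI_subspace Ws F.
have bE w : dembar_w C w (zD F (descents C w)) = descent_atom C F w by rewrite (dembar_wE CF).
have aE D (c : 'M[int]_r -> F) : \sum_(w <- Ws | descents C w == D) c w *: dembar_w C w (zD F D) =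
    \sum_(w <- Ws | descents C w == D) c w *: dbL_word_of C w (zD F D).
  by apply: eq_bigr => w _; rewrite (dembar_wE CF).
split.
- by move=> i f; rewrite (dembarE (cartan_diag CF)); apply: inI_dbL.
- split=> [f|c].
    have [c hc] := descent_atom_span CF Ws_uniq WsP f; exists c.
    by under eq_bigr => w _ do rewrite bE.
  by under eq_bigr => w _ do rewrite bE; apply: descent_atom_free.
- split=> [f|m hm].
    have [c hc] := descent_atom_span CF Ws_uniq WsP f.
    exists (fun D => \sum_(w <- Ws | descents C w == D) c w *: dbL_word_of C w (zD F D)).
    split=> [D|]; first exact: inM_atoms0.
    by rewrite (sum_atoms C Ws (fun=> c)).
  pose Q D (c : 'M[int]_r -> F) :=
    inI Ws (m D - \sum_(w <- Ws | descents C w == D) c w *: dbL_word_of C w (zD F D)).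
  (* Coordinates are chosen for every summand at once. Descent classes are disjoint, so they merge
     into one family indexed by W, to which independence applies. *)
  pose c D := epsilon (inhabits (fun=> 0)) (Q D).
  have cP D : Q D (c D).
    by apply: (epsilon_spec (inhabits (fun=> 0)) (Q D)); apply/(inM_atoms CF Ws_uniq WsP).
  move=> sm D.
  have c0 : forall w, w \in Ws -> c (descents C w) w = 0.
    apply: (descent_atom_free CF Ws_uniq WsP (c := fun w => c (descents C w) w)).
    rewrite -sum_atoms -[X in inI _ X](subKr (\sum_D m D)); apply: (subB SI) => //.
    by rewrite -sumrB; apply: (sub_sum SI) => E _; apply: cP.
  have := cP D; rewrite /Q big1_seq ?subr0 // => w /andP[/eqP dw wW].
  by rewrite -[in c D]dw c0 // scale0r.
- move=> D; split.
  + move=> w wW dw; rewrite (dembar_wE CF); apply/(inM_atoms CF Ws_uniq WsP).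
    have [|c ->] := @atom_span1 r C Ws F Ws_uniq WsP D (zD F D) w _ dw; first exact/WsP.
    by exists c; rewrite subrr; apply: (sub0 SI).
  + by move=> f /(inM_atoms CF Ws_uniq WsP)[c hc]; exists c; rewrite aE.
  + by move=> c; rewrite aE; apply: atoms_free.
  exact: projective_iso.
exact: regular_iso.
Qed.
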